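(* For every $\varepsilon>0$ there is an integer $M=M(\varepsilon)\ge1$, not depending on $n$, such that the following holds. Let $(\lambda_n)$ be any sequence with $0\le\lambda_n\le n$ and $\lambda_n=o(\log n)$, and let $G=\mathbb G(n,\lambda_n/n)$ be an Erdős–Rényi random graph on $[n]$ with edge probability $\lambda_n/n$, independent of the uniform random recursive tree $\mathcal T_n$. Then there exist maps $K_n$, where $K_n$ assigns to each graph on the vertex set $[n]$ a subset of $[n]$ of size at most $M$, with $$\liminf_{n\to\infty}\mathbb P\big(\pi_n(1)\in K_n(\pi_n(\mathcal T_n(G)))\big)\ \ge\ 1-\varepsilon .$$ (That is, observing $\mathcal T_n(G)$ without its vertex labels, one can construct a confidence set, of size not depending on $n$, that contains the root vertex $1$ with asymptotic probability at least $1-\varepsilon$.)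
   Context: $[n]=\{1,\dots,n\}$; $\log$ is the natural logarithm. Uniform random recursive tree: $\mathcal T_1$ is the single vertex $1$; for $i\ge1$, given $\mathcal T_i$, the tree $\mathcal T_{i+1}$ is obtained by adding vertex $i+1$ and joining it by an edge to a vertex chosen uniformly at random from $\{1,\dots,i\}$. Thus $\mathcal T_n$ is a random tree on $[n]$ with root $1$. Noisy recursive tree: for a graph $G$ on $[n]$, $\mathcal T_n(G)=\mathcal T_n\cup G$ is the (simple) graph on $[n]$ in which two vertices are adjacent if and only if they are adjacent in $\mathcal T_n$ or in $G$. Observation without labels: $\pi_n$ is a uniformly random permutation of $[n]$ independent of everything else, and for a graph $F$ on $[n]$, $\pi_n(F)$ is the graph on $[n]$ with edges $\{\pi_n(u),\pi_n(v)\}$, $\{u,v\}\in E(F)$. *)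

(* Defs.v *)
From HB Require Import structures.
From mathcomp Require Import all_boot all_order all_algebra all_fingroup.
From mathcomp Require Import reals.

Set Implicit Arguments.
Unset Strict Implicit.
Unset Printing Implicit Defensive.

Import Order.TTheory GRing.Theory Num.Theory.

Local Open Scope ring_scope.

(* The vertices 1, ..., n are represented by 0, ..., n - 1 : 'I_n; in
   particular the root 1 is ord0. *)
Record sgraph (n : nat) := SGraph {
  edges : {set {set 'I_n}};
  edges_card2 : [forall e in edges, #|e| == 2%N] }.

HB.instance Definition _ (n : nat) := [isSub for @edges n].
HB.instance Definition _ (n : nat) := [Finite of sgraph n by <:].

Section GraphOperations.
Variable n : nat.
Implicit Types F G : sgraph n.

Lemma gempty_subproof : [forall e in set0 : {set {set 'I_n}}, #|e| == 2%N].
Proof. by apply/forall_inP => e; rewrite inE. Qed.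

Definition gempty : sgraph n := SGraph gempty_subproof.

Lemma gunion_subproof F G : [forall e in edges F :|: edges G, #|e| == 2%N].
Proof.
apply/forall_inP => e; rewrite inE => /orP[].
- by move/(forall_inP (edges_card2 F)).
- by move/(forall_inP (edges_card2 G)).
Qed.

Definition gunion F G : sgraph n := SGraph (gunion_subproof F G).

Lemma grelabel_subproof (s : 'S_n) F :
  [forall e in [set s @: e | e : {set 'I_n} in edges F], #|e| == 2%N].
Proof.
apply/forall_inP => _ /imsetP[e eF ->]; rewrite (card_imset _ (@perm_inj _ s)).
exact: (forall_inP (edges_card2 F)).
Qed.

Definition grelabel (s : 'S_n) F : sgraph n := SGraph (grelabel_subproof s F).

Definition old_vertex : 'I_n -> 'I_n.+1 := widen_ord (leqnSn n).

Lemma gattach_subproof F (j : 'I_n) :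
  [forall e in [set old_vertex j; ord_max]
     |: [set old_vertex @: e | e : {set 'I_n} in edges F], #|e| == 2%N].
Proof.
apply/forall_inP => e; rewrite !inE => /orP[/eqP->|/imsetP[e' eF ->]].
- by rewrite cards2 -val_eqE /= neq_ltn ltn_ord.
- rewrite card_imset; first exact: (forall_inP (edges_card2 F)).
  by move=> x y [xy]; apply: val_inj.
Qed.

(* [F] together with a new last vertex, joined to the vertex [j] of [F]. *)
Definition gattach F (j : 'I_n) : sgraph n.+1 := SGraph (gattach_subproof F j).

End GraphOperations.

Section Laws.
Variable R : realType.

(* Probability mass function of the uniform random recursive tree on n + 1
   vertices. *)
Fixpoint urrt_pmf (n : nat) : sgraph n.+1 -> R :=
  match n with
  | 0 => fun T => (T == gempty 1)%:R
  | m.+1 => fun T' => \sum_(T : sgraph m.+1)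
      urrt_pmf T * \sum_(j : 'I_m.+1) m.+1%:R^-1 * (T' == gattach T j)%:R
  end.

Definition er_pmf (n : nat) (p : R) (G : sgraph n) : R :=
  \prod_(e : {set 'I_n} | #|e| == 2%N) (if e \in edges G then p else 1 - p).

(* P(pi(1) \in K(pi(T \cup G))), where the recursive tree T and the
   Erdos-Renyi graph G of edge probability p, both on n + 1 vertices, and the
   uniform permutation pi are independent. *)
Definition root_coverage_prob (n : nat) (p : R)
    (K : sgraph n.+1 -> {set 'I_n.+1}) : R :=
  \sum_(T : sgraph n.+1) \sum_(G : sgraph n.+1) \sum_(s : 'S_n.+1)
    urrt_pmf T * er_pmf p G * (n.+1)`!%:R^-1
    * (s ord0 \in K (grelabel s (gunion T G)))%:R.

End Laws.

(* Main.v *)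
(* Write L for log n. Noise degrees are o(L), so a vertex of degree at least
   (9/10) L in the observed graph has nearly that degree in the recursive tree.
   Since the expectation of the sum of 2^degree is O(n log n), fewer than
   n^(1/2 - c) vertices are of this kind; hence no noise edge joins two of them,
   and the observed graph restricted to them is a sub-forest of the tree.
   Asking moreover for a bounded number j of such neighbours defines the "core":
   it contains most vertices born before n^(1/10 - kappa) and none born after
   n^(1/10 + kappa). The confidence set consists of the approximate centroids of
   the large component of the core, which is that of the root.

   To locate the centroids, let m = n^gamma with gamma much larger than kappa.
   The core masses of the m fringe trees hanging off the first m vertices are
   exchangeable and independent of the tree on these m vertices, and none of
   them dominates. Hence the descendants of v carry about the same proportion
   of the core as they do of the first m vertices, and the latter is governed
   by a Polya urn: it is small uniformly over late v, and uniformly distributed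
   for the second vertex. *)

Require Import Defs.
From HB Require Import structures.
From mathcomp Require Import all_boot all_order all_algebra all_fingroup.
From mathcomp Require Import lra ring zify.
From mathcomp Require Import all_classical all_reals all_analysis.

Set Implicit Arguments.
Unset Strict Implicit.
Unset Printing Implicit Defensive.

Import Order.TTheory GRing.Theory Num.Theory.
Import numFieldNormedType.Exports.

Local Open Scope ring_scope.

(** * Finite expectations *)

(** A high degree alone does not date a vertex: about n^(0.38) vertices reach degree (9/10) log n,
    so most of them are born long after n^(1/10). Having [j] high children does: the expected number
    of high children of a vertex born after n^(1/10 + 2 kappa) is a negative power of n, so [j] of
    them cost the [j]-th power of it, and a large constant [j] beats the union bound over all n
    vertices. In the other direction a union bound puts all of the first m vertices in the core, but
    it cannot reach n^(1/10 - 2 kappa); there the descendants of exceptional vertices are bounded in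
    mean and given up. The size of the core is thus known only up to a factor n^(4 kappa), which m =
    n^(20 kappa) fringes must outweigh for none of them to dominate. The tree is handled through the
    function giving the parent of each vertex. Its values are independent, so independence and
    exchangeability become statements about coordinates. The noise degrees are controlled by an
    exponential moment at a large constant base, which is where lambda = o(log n) is used. *)

Section Expectation.
Variables (R : realFieldType) (T : finType) (P : T -> R).
Implicit Types (X Y : T -> R) (A B : pred T).

Definition Ex X : R := \sum_x P x * X x.
Definition Pr A : R := Ex (fun x => (A x)%:R).

Lemma eq_Ex X Y : (forall x, P x != 0 -> X x = Y x) -> Ex X = Ex Y.
Proof.
move=> XY; apply: eq_bigr => x _.
by have [->|/XY->//] := eqVneq (P x) 0; rewrite !mul0r.
Qed.

Lemma ExD X Y : Ex (fun x => X x + Y x) = Ex X + Ex Y.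
Proof. by rewrite /Ex -big_split; apply: eq_bigr => x _; rewrite mulrDr. Qed.

Lemma ExZ c X : Ex (fun x => c * X x) = c * Ex X.
Proof. by rewrite /Ex mulr_sumr; apply: eq_bigr => x _; rewrite mulrCA. Qed.

Lemma ExB X Y : Ex (fun x => X x - Y x) = Ex X - Ex Y.
Proof.
rewrite /Ex -sumrB; apply: eq_bigr => x _; by rewrite mulrBr.
Qed.

Lemma Ex_sum (I : finType) (Q : pred I) (X : I -> T -> R) :
  Ex (fun x => \sum_(i | Q i) X i x) = \sum_(i | Q i) Ex (X i).
Proof.
rewrite /Ex exchange_big /=; apply: eq_bigr => x _; exact: mulr_sumr.
Qed.

Hypotheses (P_ge0 : forall x, 0 <= P x) (P_sum1 : \sum_x P x = 1).

Lemma le_Ex X Y : (forall x, P x != 0 -> X x <= Y x) -> Ex X <= Ex Y.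
Proof.
move=> XY; apply: ler_sum => x _.
by have [->|/XY/(ler_wpM2l (P_ge0 x))//] := eqVneq (P x) 0; rewrite !mul0r.
Qed.

Lemma Ex_cst c : Ex (fun=> c) = c.
Proof. by rewrite /Ex -mulr_suml P_sum1 mul1r. Qed.

Lemma Ex_ge0 X : (forall x, P x != 0 -> 0 <= X x) -> 0 <= Ex X.
Proof.
by move=> X0; rewrite -[leLHS](Ex_cst 0); apply: le_Ex.
Qed.

Lemma le_Pr A B : (forall x, P x != 0 -> A x -> B x) -> Pr A <= Pr B.
Proof.
move=> AB; apply: le_Ex => x /AB; rewrite ler_nat.
by case: (A x) (B x) => [] [] // /(_ isT).
Qed.

Lemma Pr_union (I : finType) (Q : pred I) (A : I -> pred T) :
  Pr (fun x => [exists i, Q i && A i x]) <= \sum_(i | Q i) Pr (A i).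
Proof.
rewrite /Pr -Ex_sum; apply: le_Ex => x _.
case: existsP => [[i /andP[Qi Ai]]|_]; last exact: sumr_ge0.
by rewrite (bigD1 i) //= Ai lerDl sumr_ge0.
Qed.

Lemma Pr_or A B : Pr (fun x => A x || B x) <= Pr A + Pr B.
Proof.
rewrite /Pr -ExD; apply: le_Ex => x _; rewrite -natrD ler_nat.
by case: (A x) (B x) => [] [].
Qed.

Lemma Ex_markov X c A : 0 < c -> (forall x, P x != 0 -> 0 <= X x) ->
  (forall x, P x != 0 -> A x -> c <= X x) -> Pr A <= Ex X / c.
Proof.
move=> c0 X0 AX; rewrite ler_pdivlMr // mulrC -ExZ; apply: le_Ex => x Px.
by case: (boolP (A x)) => [/(AX _ Px)|_]; rewrite ?mulr1 // mulr0 X0.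
Qed.

End Expectation.

(** * Product measures: independence and resampling of coordinates *)

Section ProductMeasure.
Variables (R : realFieldType) (I J : finType) (w : I -> J -> R).
Hypotheses (w_ge0 : forall i j, 0 <= w i j) (w_sum1 : forall i, \sum_j w i j = 1).
Implicit Types (f g : {ffun I -> J}) (X Y : {ffun I -> J} -> R).

Definition prodw f : R := \prod_i w i (f i).

Lemma prodw_ge0 f : 0 <= prodw f. Proof. exact: prodr_ge0. Qed.

Lemma Ex_prod (phi : I -> J -> R) :
  Ex prodw (fun f => \prod_i phi i (f i)) = \prod_i \sum_j w i j * phi i j.
Proof.
rewrite bigA_distr_bigA; apply: eq_bigr => f _; by rewrite -big_split.
Qed.

Lemma prodw_sum1 : \sum_f prodw f = 1.
Proof.
by rewrite -bigA_distr_bigA big1.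
Qed.

Definition mix (D : pred I) f g : {ffun I -> J} :=
  [ffun i => if D i then g i else f i].

(** Exchanging the coordinates in [D] of two independent samples is an involution that preserves
    their joint weight, so the mixture again has the law of a single sample. *)
Lemma Ex_mix D X :
  Ex prodw (fun f => Ex prodw (fun g => X (mix D f g))) = Ex prodw X.
Proof.
pose sw (u : {ffun I -> J} * {ffun I -> J}) := (mix D u.1 u.2, mix D u.2 u.1).
have swK : involutive sw.
  by case=> f g; congr pair; apply/ffunP => i /=; rewrite !ffunE; case: (D i).
transitivity (\sum_(u : {ffun I -> J} * {ffun I -> J})
    prodw u.1 * prodw u.2 * X (sw u).1).
  rewrite -(pair_bigA _ (fun f g => prodw f * prodw g * X (mix D f g))) /=.
  by apply: eq_bigr => f _; rewrite /Ex mulr_sumr; apply: eq_bigr => g _; rewrite mulrA.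
rewrite (reindex_inj (inv_inj swK)) /=.
transitivity (\sum_(u : {ffun I -> J} * {ffun I -> J}) prodw u.1 * prodw u.2 * X u.1).
  apply: eq_bigr => -[f g] _; congr (_ * _); last by have [] := swK (f, g) => ->.
  rewrite /prodw -!big_split /=; apply: eq_bigr => i _; rewrite !ffunE.
  by case: ifP => // _; rewrite mulrC.
rewrite -(pair_bigA _ (fun f g => prodw f * prodw g * X f)) /=.
apply: eq_bigr => f _; rewrite -mulr_suml -mulr_sumr.
by rewrite prodw_sum1 mulr1.
Qed.

Lemma prodw_neq0 f : (prodw f != 0) = [forall i, w i (f i) != 0].
Proof.
by rewrite prodf_seq_neq0 -big_all big_andE; apply/eq_forallb => i.
Qed.

Lemma prodw_mix_neq0 D f g :
  prodw f != 0 -> prodw g != 0 -> prodw (mix D f g) != 0.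
Proof.
rewrite !prodw_neq0 => /forallP wf /forallP wg; apply/forallP => i.
by rewrite ffunE; case: ifP.
Qed.

(** [X] sees only the coordinates outside [D] and [Y] only those inside, so they can be read off two
    independent samples. Locality is asked on the support only, because ancestors behave well only
    for recursive functions. *)
Lemma Ex_indep (D : pred I) X Y :
  (forall f g, prodw f != 0 -> prodw g != 0 ->
     (forall i, ~~ D i -> f i = g i) -> X f = X g) ->
  (forall f g, prodw f != 0 -> prodw g != 0 ->
     (forall i, D i -> f i = g i) -> Y f = Y g) ->
  Ex prodw (fun f => X f * Y f) = Ex prodw X * Ex prodw Y.
Proof.
move=> XD YD; rewrite -(Ex_mix D) [RHS]mulrC -ExZ; apply: eq_Ex => f wf.
rewrite mulrC -ExZ; apply: eq_Ex => g wg.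
congr (_ * _).
  by apply: XD => [||i /negPf]; rewrite ?prodw_mix_neq0 // ffunE => ->.
by apply: YD => [||i Di]; rewrite ?prodw_mix_neq0 // ffunE Di.
Qed.

Lemma Ex_marginal i (h : J -> R) :
  Ex prodw (fun f => h (f i)) = \sum_j w i j * h j.
Proof.
transitivity (Ex prodw (fun f => \prod_k (if k == i then h (f k) else 1))).
  by apply: eq_Ex => f _; rewrite -big_mkcond big_pred1_eq.
rewrite (Ex_prod (fun k j => if k == i then h j else 1)) (bigD1 i) //= eqxx.
rewrite [X in _ * X]big1 ?mulr1 // => k /negPf->.
by rewrite -[RHS](w_sum1 k); apply: eq_bigr => j _; rewrite mulr1.
Qed.

(* Resampling one coordinate: if [h f] does not look at [f i], averaging over
   [f i] may be done first. *)
Lemma Ex_resample i (h : {ffun I -> J} -> J -> R) :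
  (forall f g, prodw f != 0 -> prodw g != 0 ->
     (forall k, k != i -> f k = g k) -> h f =1 h g) ->
  Ex prodw (fun f => h f (f i)) = Ex prodw (fun f => \sum_j w i j * h f j).
Proof.
move=> hi; rewrite -(Ex_mix (pred1 i)); apply: eq_Ex => f wf.
rewrite -Ex_marginal; apply: eq_Ex => g wg; rewrite ffunE /= eqxx.
rewrite (hi _ f) ?prodw_mix_neq0 // => k /negPf ki; by rewrite ffunE /= ki.
Qed.

End ProductMeasure.

(** * Recursive trees as parent functions *)

Section Parents.
Variable n : nat.
Local Notation V := 'I_n.+1.
Implicit Types (f g : {ffun V -> V}) (u v x : V) (s t : nat).

(** The root is its own parent, which makes [f] total. By [parent_pmf_neq0] this predicate is the
    support of the law of the tree. *)
Definition recursive f := [forall v : V, (f v < v)%N || ((v == 0%N :> nat) && (f v == 0%N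
  :> nat))].

Lemma recursive_lt f v : recursive f -> (0 < v)%N -> (f v < v)%N.
Proof. by move=> /forallP/(_ v)/orP[//|/andP[/eqP-> _]]. Qed.

Lemma recursive0 f v : recursive f -> v = 0%N :> nat -> f v = 0%N :> nat.
Proof. by move=> /forallP/(_ v)/orP[|/andP[_ /eqP]//] + v0; rewrite v0. Qed.

Lemma recursive_le f v : recursive f -> (f v <= v)%N.
Proof. by move=> /forallP/(_ v)/orP[/ltnW//|/andP[_ /eqP->]]. Qed.

Definition up s f x : V := if (x < s)%N then x else f x.

(* The first vertex below [s] on the path from [u] to the root. *)
Definition anc s f u : V := iter n.+1 (up s f) u.

Lemma anc_id s f u : (u < s)%N -> anc s f u = u.
Proof. by move=> us; apply: iter_fix; rewrite /up us. Qed.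

Lemma anc_lt s f u : recursive f -> (0 < s)%N -> (anc s f u < s)%N.
Proof.
move=> rf s0; suff H k v : (v <= k)%N -> (iter k.+1 (up s f) v < s)%N.
  by apply: (H n u); rewrite -ltnS.
elim: k v => [v|k IH v vk].
  rewrite leqn0 /= /up => /eqP v0; by rewrite v0 s0 v0 s0.
rewrite iterSr {2}/up; case: (ltnP v s) => vs.
  by rewrite iter_fix // /up vs.
by apply: IH; have := recursive_lt rf (leq_trans s0 vs); lia.
Qed.

Lemma anc_step s f u : recursive f -> (0 < s)%N -> (s <= u)%N ->
  anc s f u = anc s f (f u).
Proof.
move=> rf s0 su; have := anc_lt u rf s0.
have -> : f u = up s f u by rewrite /up ltnNge su.
rewrite /anc -iterSr [RHS]iterS; set y := iter _ _ _ => ys.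
by rewrite /up ys.
Qed.

Lemma anc_le s f u : recursive f -> (0 < s)%N -> (anc s f u <= u)%N.
Proof.
move=> rf s0; have [k] := ubnP (u : nat); elim: k u => // k IH u uk.
have [us|su] := ltnP u s; first by rewrite anc_id.
have fu := recursive_lt rf (leq_trans s0 su).
by rewrite anc_step //; apply: leq_trans (ltnW fu); apply: IH; lia.
Qed.

Lemma anc_comp s s' f u : recursive f -> (0 < s' <= s)%N ->
  anc s' f u = anc s' f (anc s f u).
Proof.
move=> rf /andP[s0 ss]; have [k] := ubnP (u : nat); elim: k u => // k IH u uk.
have [us|su] := ltnP u s; first by rewrite (anc_id _ us).
have fu := recursive_lt rf (leq_trans s0 (leq_trans ss su)).
have s0' : (0 < s)%N by lia.
rewrite (anc_step rf s0' su) (anc_step rf s0 (leq_trans ss su)); apply: IH; lia.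
Qed.

Lemma eq_anc s f g u : recursive f -> recursive g -> (0 < s)%N ->
  (forall v, (s <= v <= u)%N -> f v = g v) -> anc s f u = anc s g u.
Proof.
move=> rf rg s0; have [k] := ubnP (u : nat); elim: k u => // k IH u uk fg.
have [us|su] := ltnP u s; first by rewrite !anc_id.
have fu := recursive_lt rf (leq_trans s0 su).
rewrite (anc_step rf s0 su) (anc_step rg s0 su) -(fg u) ?su ?leqnn //.
apply: IH => [|v /andP[sv vu]]; first lia.
by apply: fg; rewrite sv; lia.
Qed.

(** Labels decrease along the path from [u] to the root, so [v] lies on it exactly when it is the
    first vertex of the path with label at most [v]. *)
Definition desc f v u := anc v.+1 f u == v.

Lemma desc_refl f v : desc f v v.
Proof. by rewrite /desc anc_id. Qed.

Lemma desc_le f v u : recursive f -> desc f v u -> (v <= u)%N.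
Proof. by move=> rf /eqP <-; apply: anc_le. Qed.

Lemma desc_step f v u : recursive f -> (v < u)%N -> desc f v u = desc f v (f u).
Proof. by move=> rf vu; rewrite /desc anc_step. Qed.

Lemma desc_parent f v u : recursive f -> desc f v (f u) -> desc f v u.
Proof.
move=> rf vfu; have := desc_le rf vfu; have := recursive_le u rf.
have [u0 _|u0 _] := posnP u.
  suff -> : u = f u by [].
  by apply: val_inj; rewrite /= (recursive0 rf u0) u0.
by move=> vu; rewrite desc_step //; have := recursive_lt rf u0; lia.
Qed.

Lemma desc_anc f v s u : recursive f -> (v < s)%N -> desc f v (anc s f u) = desc f v u.
Proof. by move=> rf vs; rewrite /desc -anc_comp. Qed.

(** The size at time [t] of the subtree hanging off [i] once the tree is cut at time [s]: a colour
    class of a Polya urn started from [s] balls of distinct colours. For [s = i.+1] it counts the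
    descendants of [i]. *)
Definition fringe s f (i : V) t := #|[set u : V | (u < t)%N & anc s f u == i]|.

Lemma fringe_init s f (i : V) : (i < s)%N -> fringe s f i s = 1%N.
Proof.
move=> is_; rewrite -(cards1 i); apply: eq_card => u; rewrite !inE.
have [us|su] := ltnP u s; first by rewrite anc_id.
by apply/esym/negbTE; rewrite -val_eqE /=; lia.
Qed.

Lemma fringe_step s f i (t : V) : recursive f -> (0 < s)%N -> (s <= t)%N ->
  fringe s f i t.+1 = (fringe s f i t + (anc s f (f t) == i))%N.
Proof.
move=> rf s0 st; rewrite /fringe (cardsD1 t) inE ltnSn /= anc_step // addnC.
congr (_ + _)%N; apply: eq_card => u; rewrite !inE ltnS -val_eqE /=.
by rewrite ltn_neqAle andbA.
Qed.

Lemma eq_fringe s f g i t : recursive f -> recursive g -> (0 < s)%N ->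
  (forall v, (s <= v < t)%N -> f v = g v) -> fringe s f i t = fringe s g i t.
Proof.
move=> rf rg s0 fg; apply: eq_card => u; rewrite !inE.
case: ltnP => //= ut; rewrite (eq_anc rf rg) // => v /andP[sv vu].
by apply: fg; rewrite sv; lia.
Qed.

Lemma card_ord_lt t : (t <= n.+1)%N -> #|[set u : V | (u < t)%N]| = t.
Proof.
move=> tn; rewrite -[RHS](card_ord t) -sum1dep_card -[RHS]sum1_card.
by rewrite (big_ord_widen n.+1 (fun=> 1%N) tn).
Qed.

Lemma sum_fringe s f t : recursive f -> (0 < s)%N -> (t <= n.+1)%N ->
  (\sum_(i : V) fringe s f i t = t)%N.
Proof.
move=> rf s0 tn; rewrite -[RHS](card_ord_lt tn) -sum1_card.
rewrite [RHS](partition_big (fun u => anc s f u) xpredT) //=.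
apply: eq_bigr => i _; rewrite /fringe -sum1dep_card.
by apply: eq_bigl => u; rewrite inE.
Qed.

End Parents.

(** * The law of the recursive tree and its Polya urns *)

Section UniformRecursive.
Variables (R : realType) (n : nat).
Local Notation V := 'I_n.+1.
Local Notation N := n.+1.
Implicit Types (f g : {ffun V -> V}) (u v x : V) (s t : nat).

Definition parent_prob (v j : V) : R :=
  if v == 0%N :> nat then (j == 0%N :> nat)%:R else (j < v)%N%:R / v%:R.

Lemma parent_prob_ge0 v j : 0 <= parent_prob v j.
Proof. by rewrite /parent_prob; case: ifP => _; rewrite ?divr_ge0 ?ler0n. Qed.

Lemma parent_prob_sum1 v : \sum_j parent_prob v j = 1.
Proof.
rewrite /parent_prob; case: eqVneq => [v0|v0].
  rewrite (bigD1 ord0) //= big1 ?addr0 // => j; rewrite -val_eqE /=.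
  by move/negPf->.
rewrite -mulr_suml -natr_sum.
have -> : (\sum_(j : V) (j < v) = v)%N.
  rewrite -[RHS](card_ord_lt (ltnW (ltn_ord v))) -sum1dep_card [RHS]big_mkcond.
  by apply: eq_bigr => j _; case: ltnP.
by rewrite divff // pnatr_eq0.
Qed.

Definition parent_pmf : {ffun V -> V} -> R := prodw parent_prob.

Lemma parent_pmf_ge0 f : 0 <= parent_pmf f. Proof. exact/prodw_ge0/parent_prob_ge0. Qed.
Lemma parent_pmf_sum1 : \sum_f parent_pmf f = 1. Proof. exact/prodw_sum1/parent_prob_sum1.
  Qed.

Lemma parent_pmf_neq0 f : (parent_pmf f != 0) = recursive f.
Proof.
rewrite /parent_pmf prodw_neq0; apply/eq_forallb => v; rewrite /parent_prob.
case: (eqVneq (v : nat) 0%N) => [->|v0] /=.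
  by rewrite pnatr_eq0 eqb0 negbK.
by rewrite orbF mulf_eq0 invr_eq0 !pnatr_eq0 eqb0 (negPf v0) orbF negbK.
Qed.

Definition ET := Ex parent_pmf.

Lemma eq_ET X Y : (forall f, recursive f -> X f = Y f) -> ET X = ET Y.
Proof. by move=> XY; apply: eq_Ex => f; rewrite parent_pmf_neq0; apply: XY. Qed.

Lemma le_ET X Y : (forall f, recursive f -> X f <= Y f) -> ET X <= ET Y.
Proof.
by move=> XY; apply: (le_Ex parent_pmf_ge0) => f; rewrite parent_pmf_neq0; apply: XY.
Qed.

Lemma sum_parent_prob_anc s f (i t : V) : recursive f -> (0 < s)%N -> (s <= t)%N ->
  \sum_j parent_prob t j * ((j < t)%N && (anc s f j == i))%:R = (fringe s f i t)%:R / t%:R.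
Proof.
move=> rf s0 st; rewrite /fringe -sum1dep_card natr_sum mulr_suml [RHS]big_mkcond /=.
apply: eq_bigr => j _; rewrite /parent_prob ifN; last by lia.
case: ltnP => //=; rewrite ?mul0r //.
by case: eqP => //=; rewrite ?mulr1 ?mulr0.
Qed.

(* One step of the Polya urn counting the vertices whose ancestor below [s] is
   [i]. *)
Lemma ET_fringe_step s (i t : V) (psi : nat -> R) : (0 < s)%N -> (s <= t)%N ->
  ET (fun f => psi (fringe s f i t.+1)) =
  ET (fun f => psi (fringe s f i t)
     + (fringe s f i t)%:R / t%:R * (psi (fringe s f i t).+1 - psi (fringe s f i t))).
Proof.
move=> s0 st.
pose h f (j : V) := psi (fringe s f i t + ((j < t)%N && (anc s f j == i)))%N.
transitivity (ET (fun f => h f (f t))).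
  apply: eq_ET => f rf; rewrite /h fringe_step // recursive_lt //; lia.
rewrite /ET Ex_resample; last 2 first.
- exact: parent_prob_sum1.
- move=> f g; rewrite !parent_pmf_neq0 => rf rg fg j; rewrite /h.
  congr (psi (_ + _))%N.
    apply: eq_fringe => // v /andP[sv vt]; apply: fg.
    by apply/eqP => vt'; rewrite vt' ltnn in vt.
  case: ltnP => //= jt; rewrite (eq_anc rf rg) // => v /andP[sv vj].
  by apply: fg; apply/eqP => vt'; rewrite vt' leqNgt jt in vj.
apply: eq_ET => f rf; rewrite -sum_parent_prob_anc // mulr_suml.
rewrite -[X in X + _]mul1r -(parent_prob_sum1 t) mulr_suml -big_split.
apply: eq_bigr => j _ /=; rewrite /h -mulrA -mulrDr; congr (_ * _).
by rewrite parent_prob_sum1; case: (_ && _) => /=; rewrite ?addn0 ?addn1; ring.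
Qed.

Lemma ET_fringe s (i : V) t : (i < s)%N -> (s <= t <= N)%N ->
  ET (fun f => (fringe s f i t)%:R) = t%:R / s%:R.
Proof.
move=> is_ /andP[]; elim: t => [|t IH]; first by rewrite leqn0; lia.
rewrite leq_eqVlt => /orP[/eqP <- _|st tN].
  rewrite divff ?pnatr_eq0; last lia.
  rewrite -[RHS](Ex_cst parent_pmf_sum1); apply: eq_ET => f _; by rewrite fringe_init.
have s0 : (0 < s)%N by lia.
rewrite (@ET_fringe_step s i (Ordinal tN) (fun k => k%:R)) //=.
transitivity (ET (fun f => (1 + t%:R^-1) * (fringe s f i t)%:R)).
  by apply: eq_ET => f _; rewrite -natr1; ring.
rewrite /ET ExZ -/(ET _) IH //; last exact: ltnW.
rewrite -natr1; field; by rewrite !pnatr_eq0; lia.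
Qed.

(** The mean of the rising factorial X (X + 1), unlike that of X^2, is multiplied by an exact factor
    1 + 2/t in each step of the urn. *)
Lemma ET_fringe2 s (i : V) t : (i < s)%N -> (s <= t <= N)%N ->
  ET (fun f => (fringe s f i t)%:R * ((fringe s f i t)%:R + 1)) =
  2 * (t%:R * (t%:R + 1)) / (s%:R * (s%:R + 1)).
Proof.
move=> is_ /andP[]; elim: t => [|t IH]; first by rewrite leqn0; lia.
have s1 : s%:R != 0 :> R by rewrite pnatr_eq0; lia.
have s2 : s%:R + 1 != 0 :> R by rewrite natr1 pnatr_eq0.
rewrite leq_eqVlt => /orP[/eqP <- _|st tN].
  rewrite mulfK ?mulf_neq0 // -[RHS](Ex_cst parent_pmf_sum1).
  by apply: eq_ET => f _; rewrite fringe_init //; ring.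
have s0 : (0 < s)%N by lia.
rewrite (@ET_fringe_step s i (Ordinal tN) (fun k => k%:R * (k%:R + 1))) //=.
have t1 : t%:R != 0 :> R by rewrite pnatr_eq0; lia.
transitivity (ET (fun f => (1 + 2 / t%:R) * ((fringe s f i t)%:R * ((fringe s f i t)%:R +
  1)))).
  by apply: eq_ET => f _; rewrite -natr1; field.
rewrite /ET ExZ -/(ET _) IH //; last exact: ltnW.
by rewrite -natr1; field; rewrite s1 s2 t1.
Qed.

(** An urn with one ball of each of two colours gives the uniform law on 1, ..., t - 1. If P_t(k) is
    the probability of k, then P_(t+1)(k + 1) = ((t - k - 1) P_t(k + 1) + k P_t(k)) / t, and the
    weights on the right add up to (t - 1) / t. *)
Lemma PT_fringe_uniform (i : V) t k : (i < 2)%N -> (2 <= t <= N)%N -> (k < t)%N ->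
  Pr parent_pmf (fun f => fringe 2 f i t == k) <= (t%:R - 1)^-1.
Proof.
move=> i2 /andP[]; elim: t k => // t IH k.
have IH0 : (2 <= t <= N)%N -> Pr parent_pmf (fun f => fringe 2 f i t == t) <= 0.
  move=> /andP[t2 tN]; rewrite -[leRHS](Ex_cst parent_pmf_sum1); apply: le_ET => f rf /=.
  case: eqP => // ft; exfalso.
  pose i' : V := inord (1 - i).
  have i'E : i' = (1 - i)%N :> nat by rewrite inordK //; lia.
  have := sum_fringe rf (isT : (0 < 2)%N) tN.
  rewrite (bigD1 i) //= (bigD1 i') /=; last by rewrite -val_eqE /= i'E; lia.
  suff : (0 < fringe 2 f i' t)%N by lia.
  apply/card_gt0P; exists i'; rewrite inE anc_id ?eqxx ?i'E; lia.
rewrite leq_eqVlt => /orP[/eqP <- N2 k2|t2 tN kt].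
  rewrite [2%:R - 1](_ : _ = 1) ?invr1; last by ring.
  rewrite -[leRHS](Ex_cst parent_pmf_sum1); apply: le_ET => f _; by case: eqP.
rewrite /Pr -/ET (@ET_fringe_step 2 i (Ordinal tN) (fun j => (j == k)%:R)) //=.
have t1 : t%:R != 0 :> R by rewrite pnatr_eq0; lia.
have t1' : t%:R - 1 != 0 :> R by rewrite subr_eq0 pnatr_eq1; lia.
have tN' : (1 < t <= N)%N by lia.
have H j : (j <= t)%N -> (t%:R - j%:R) * Pr parent_pmf (fun f => fringe 2 f i t == j) <=
    (t%:R - j%:R) * (t%:R - 1)^-1.
  rewrite leq_eqVlt => /orP[/eqP->|jt]; first by rewrite subrr !mul0r.
  by apply: ler_wpM2l; [rewrite subr_ge0 ler_nat ltnW|apply: IH; lia].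
have H' j : (j <= t)%N -> j%:R * Pr parent_pmf (fun f => fringe 2 f i t == j) <=
    j%:R * (t%:R - 1)^-1.
  rewrite leq_eqVlt => /orP[/eqP->|jt].
    apply: ler_wpM2l => //; apply: le_trans (IH0 tN') _.
    by rewrite invr_ge0 subr_ge0 ler1n; lia.
  by apply: ler_wpM2l; [|apply: IH; lia].
case: k => [|k] in kt *.
  rewrite [leLHS](_ : _ = ET (fun f => (fringe 2 f i t == 0%N)%:R)); last first.
    by apply: eq_ET => f rf; case: (fringe 2 f i t) => [|j] /=; ring.
  rewrite [leLHS](_ : _ = 0); first by rewrite -natr1 addrK invr_ge0.
  rewrite -[RHS](Ex_cst parent_pmf_sum1); apply: eq_ET => f rf.
  case: eqP => // /eqP; rewrite finset.cards_eq0 => /eqP/finset.setP/(_ i).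
  by rewrite !inE anc_id // eqxx; lia.
rewrite [leLHS](_ : _ = t%:R^-1 * ((t%:R - k.+1%:R) * Pr parent_pmf (fun f => fringe 2 f i
  t == k.+1)
   + k%:R * Pr parent_pmf (fun f => fringe 2 f i t == k))); last first.
  rewrite /Pr -!ExZ -ExD -ExZ; apply: eq_ET => f rf; rewrite eqSS.
  have [->|] := eqVneq (fringe 2 f i t) k.+1.
    by rewrite [k.+1 == k]gtn_eqF //=; field.
  have [->|_] := eqVneq (fringe 2 f i t) k => _ /=; first by field.
  by ring.
have H1 := H k.+1 kt; have H2 := H' k (ltnW kt).
apply: le_trans (ler_wpM2l _ (lerD H1 H2)) _; first by rewrite invr_ge0.
rewrite -!natr1 le_eqVlt; apply/orP; left; apply/eqP; field; by rewrite addrK t1 t1'.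
Qed.

End UniformRecursive.

(** * Erdos-Renyi noise and relabelling *)

Section Noise.
Variables (R : realType) (n : nat).
Local Notation V := 'I_n.
Implicit Types (F G : sgraph n) (u v x : V) (e : {set V}) (p z : R).

Lemma edges_card G e : e \in edges G -> #|e| = 2%N.
Proof. by move/(forall_inP (edges_card2 G))/eqP. Qed.

Lemma sum_sgraph_prod (a b : {set V} -> R) :
  \sum_G \prod_(e : {set V} | #|e| == 2%N) (if e \in edges G then a e else b e) =
  \prod_(e : {set V} | #|e| == 2%N) (a e + b e).
Proof.
rewrite [RHS]big_mkcond /=.
(* A set that is not a pair receives the weights 0 as an edge and 1 as a non-edge, so only families
   of pairs survive in the expansion over all families of sets. *)
rewrite (eq_bigr (fun e : {set V} => (if #|e| == 2%N then a e else 0) +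
   (if #|e| == 2%N then b e else 1))); last first.
  by move=> e _; case: ifP; rewrite ?add0r.
rewrite bigA_distr (bigID (fun J : {set {set V}} => [forall e in J, #|e| == 2%N])) /=.
rewrite [X in _ = _ + X]big1 ?addr0; last first.
  move=> J; rewrite negb_forall => /existsP[e]; rewrite negb_imply => /andP[eJ e2].
  by rewrite (bigD1 e) //= eJ (negPf e2) mul0r.
rewrite (reindex_onto (@edges n) (insubd (gempty n))) /=; last first.
  by move=> J PJ; rewrite -[LHS]/(val _) insubdK.
rewrite [RHS](eq_bigl xpredT); last first.
  by move=> G; rewrite edges_card2 -[edges G]/(val G) valKd eqxx.
apply: eq_bigr => G _; rewrite big_mkcond; apply: eq_bigr => e _.
case: (boolP (e \in edges G)) => [/edges_card->//|_]; by case: ifP.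
Qed.

Lemma er_ge0 p G : 0 <= p <= 1 -> 0 <= er_pmf p G.
Proof.
by move=> /andP[p0 p1]; apply: prodr_ge0 => e _; case: ifP; rewrite ?subr_ge0.
Qed.

Lemma er_sum1 p : \sum_(G : sgraph n) er_pmf p G = 1.
Proof.
by rewrite sum_sgraph_prod big1 // => e _; rewrite addrC subrK.
Qed.

Definition adj F u v := [set u; v] \in edges F.
Definition deg F v := #|[set x | adj F v x]|.

Lemma adjC F u v : adj F u v = adj F v u.
Proof. by rewrite /adj finset.setUC. Qed.

Lemma adj_neq F u v : adj F u v -> u != v.
Proof. by move/edges_card/eqP; rewrite cards2; case: (u != v). Qed.

Lemma deg_le_edges G v : (deg G v <= #|[set e in edges G | v \in e]|)%N.
Proof.
rewrite /deg -(card_in_imset (f := fun x => [set v; x])).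
  apply: subset_leq_card; apply/fintype.subsetP => e /imsetP[x]; rewrite !inE => vx ->.
  by rewrite -/(adj G v x) vx !inE eqxx.
move=> x y; rewrite !inE => /adj_neq vx _ /finset.setP/(_ x).
by rewrite !inE eqxx orbT eq_sym (negPf vx) => /esym/eqP.
Qed.

Lemma card_pairs_at v : (#|[set e : {set V} | (#|e| == 2%N) && (v \in e)]| <= n)%N.
Proof.
rewrite -[leqRHS]card_ord; apply: leq_trans (leq_imset_card (fun x => [set v; x]) _).
apply: subset_leq_card; apply/fintype.subsetP => e;
  rewrite !inE => /andP[/cards2P[x [y [xy ->]]]].
by rewrite !inE => /orP[] /eqP->; apply/imsetP; [exists y|exists x; rewrite // finset.setUC].
Qed.

(** The degree is at most the number of edges containing [v]. These are independent over at most n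
    pairs, and each pair contributes a factor 1 + p (z - 1). *)
Lemma EG_deg p z v : 0 <= p <= 1 -> 1 <= z ->
  Ex (er_pmf p) (fun G => z ^+ deg G v) <= (1 + p * (z - 1)) ^+ n.
Proof.
move=> p01 z1; have /andP[p0 p1] := p01.
apply: (@le_trans _ _ (Ex (er_pmf p) (fun G => \prod_(e : {set V} | #|e| == 2%N)
   (if e \in edges G then (if v \in e then z else 1) else 1)))).
  apply: le_Ex => [G|G _]; first exact: er_ge0.
  rewrite -big_mkcondr -big_mkcondr /=.
  rewrite prodr_const; apply: ler_weXn2l => //.
  apply: leq_trans (deg_le_edges G v) _; apply: subset_leq_card.
  apply/fintype.subsetP => e; rewrite inE => /andP[eG ve].
  by rewrite unfold_in /= eG (edges_card eG) ve.
rewrite /Ex /er_pmf.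
rewrite (eq_bigr (fun G => \prod_(e : {set V} | #|e| == 2%N)
   (if e \in edges G then p * (if v \in e then z else 1) else 1 - p))); last first.
  move=> G _; rewrite -big_split /=; apply: eq_bigr => e _.
  by case: ifP; rewrite ?mulr1.
rewrite sum_sgraph_prod.
rewrite (eq_bigr (fun e : {set V} => if v \in e then 1 + p * (z - 1) else 1)); last first.
  by move=> e _; case: ifP => _; ring.
rewrite -big_mkcondr prodr_const; apply: ler_weXn2l.
  by rewrite lerDl mulr_ge0 // subr_ge0.
by have := card_pairs_at v; rewrite cardsE.
Qed.

Lemma EG_edge p e : 0 <= p <= 1 -> #|e| = 2%N ->
  Pr (er_pmf p) (fun G => e \in edges G) = p.
Proof.
move=> /andP[p0 p1] e2; rewrite /Pr /Ex /er_pmf.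
(* The indicator of the edge is absorbed into the product by giving [e] the weight 0 as a
   non-edge. *)
rewrite (eq_bigr (fun G => \prod_(e' : {set V} | #|e'| == 2%N)
   (if e' \in edges G then p else if e' == e then 0 else 1 - p))); last first.
  move=> G _; rewrite (bigD1 e) ?e2 //= [RHS](bigD1 e) ?e2 //= eqxx.
  case: (boolP (e \in edges G)) => eG; rewrite ?mulr0 ?mul0r // mulr1.
  by congr (_ * _); apply: eq_bigr => e' /andP[_ /negPf->].
rewrite sum_sgraph_prod (bigD1 e) ?e2 //= eqxx addr0 big1 ?mulr1 // => e'.
by move=> /andP[_ /negPf->]; rewrite addrC subrK.
Qed.

Lemma imset_permK (s : 'S_n) : injective (fun e => s @: e).
Proof. exact: imset_inj perm_inj. Qed.

Lemma mem_grelabel (s : 'S_n) G e :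
  (s @: e \in edges (grelabel s G)) = (e \in edges G).
Proof. exact: (mem_imset _ _ (@imset_permK s)). Qed.

Lemma er_relabel p (s : 'S_n) G : er_pmf p (grelabel s G) = er_pmf p G.
Proof.
rewrite /er_pmf (reindex_inj (@imset_permK s)) /=.
apply: eq_big => [e|e _]; first by rewrite card_imset //; exact: perm_inj.
by rewrite mem_grelabel.
Qed.

Lemma adj_relabel (s : 'S_n) F u v : adj (grelabel s F) (s u) (s v) = adj F u v.
Proof. by rewrite /adj -[RHS](mem_grelabel s) imsetU1 imset_set1. Qed.

Lemma grelabelK (s : 'S_n) : cancel (@grelabel n s) (grelabel s^-1).
Proof.
move=> G; apply: val_inj; apply/finset.setP => e.
have {1}-> : e = s^-1%g @: (s @: e).
  by rewrite -imset_comp (eq_imset (g := id)) ?imset_id // => x /=; rewrite permK.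
by rewrite -[LHS]/(_ \in edges _) !mem_grelabel.
Qed.

Lemma adj_union F G u v : adj (gunion F G) u v = adj F u v || adj G u v.
Proof. by rewrite /adj /= inE. Qed.

End Noise.

(** * The recursive tree as the graph of a random parent function *)

Section ParentTree.
Variables (R : realType).

Section PT.
Variable n : nat.
Local Notation V := 'I_n.+1.
Implicit Types (f g : {ffun V -> V}) (u v x : V).

(** For the root, its own parent, [[set v; f v]] is a singleton, which the cardinality test
    removes. *)
Lemma parent_tree_subproof f : [forall e in [set e : {set V} | (#|e| == 2%N) &&
  [exists v, e == [set v; f v]]], #|e| == 2%N].
Proof. by apply/forall_inP => e; rewrite inE => /andP[]. Qed.

Definition parent_tree f : sgraph n.+1 := SGraph (parent_tree_subproof f).

Lemma adj_parent_tree f u v : adj (parent_tree f) u v = (u != v) && ((f u == v) || (f v ==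
  u)).
Proof.
rewrite /adj inE cards2; case: (eqVneq u v) => //= uv.
apply/existsP/orP => [[x /eqP E]|[]/eqP E]; last first.
- by exists v; rewrite E finset.setUC.
- by exists u; rewrite E.
have /finset.setP/(_ u) := E; have /finset.setP/(_ v) := E.
rewrite !inE !eqxx orbT /= => /esym/orP[]/eqP vE /esym/orP[]/eqP uE.
- by rewrite uE vE eqxx in uv.
- by right; rewrite vE uE.
- by left; rewrite vE uE.
- by rewrite uE vE eqxx in uv.
Qed.

End PT.

Section Extend.
Variable n : nat.
Local Notation V := 'I_n.+1.
Local Notation V' := 'I_n.+2.
Implicit Types (f : {ffun V -> V}) (h : {ffun V' -> V'}) (j : V).

Definition extend_parents f j : {ffun V' -> V'} :=
  [ffun x : V' => if (x < n.+1)%N then old_vertex (f (inord x)) else old_vertex j].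

Definition restrict_parents h : {ffun V -> V} * V :=
  ([ffun x : V => inord (h (old_vertex x))], inord (h ord_max)).

Lemma extend_parents_old f j (x : V) : extend_parents f j (old_vertex x) = old_vertex (f x).
Proof. by rewrite ffunE /= ltn_ord inord_val. Qed.

Lemma extend_parents_max f j : extend_parents f j ord_max = old_vertex j.
Proof. by rewrite ffunE ltnn. Qed.

Lemma extend_parentsK f j : restrict_parents (extend_parents f j) = (f, j).
Proof.
rewrite /restrict_parents extend_parents_max; congr pair; last exact: inord_val.
by apply/ffunP => x; rewrite ffunE extend_parents_old; apply: inord_val.
Qed.

Lemma restrict_parentsK h : recursive h -> extend_parents (restrict_parents h).1
  (restrict_parents h).2 = h.
Proof.
move=> rf; apply/ffunP => x; rewrite ffunE /=.
case: ltnP => xn; apply: val_inj => /=.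
  have -> : x = old_vertex (inord x) by apply: val_inj; rewrite /= inordK.
  rewrite ffunE /= inord_val inordK //.
  by apply: leq_ltn_trans (recursive_le _ rf) _; apply: (ltn_ord (inord x : V)).
have -> : x = ord_max by apply: val_inj => /=; have := ltn_ord x; lia.
by rewrite inordK //; exact: (@recursive_lt _ h ord_max).
Qed.

Lemma parent_pmf_extend f j : parent_pmf R (extend_parents f j) = parent_pmf R f * n.+1%:R^-1.
Proof.
rewrite /parent_pmf /prodw big_ord_recr /=; congr (_ * _); last first.
  by rewrite extend_parents_max /parent_prob /= ltn_ord mul1r.
apply: eq_bigr => x _.
have -> : widen_ord (leqnSn n.+1) x = old_vertex x by [].
by rewrite extend_parents_old.
Qed.

Lemma gattach_parent_tree f j : gattach (parent_tree f) j = parent_tree (extend_parents f j).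
Proof.
have old_inj : injective (@old_vertex n.+1) by move=> x y [xy]; apply: val_inj.
have oldP (x : V') : {y : V | x = old_vertex y} + {x = ord_max}.
  have [xn|xn] := ltnP x n.+1; last first.
    by right; apply: val_inj => /=; have := ltn_ord x; lia.
  by left; exists (Ordinal xn); apply: val_inj.
apply: val_inj; apply/finset.setP => e; rewrite -[LHS]/(_ \in edges _) -[RHS]/(_ \in edges _).
apply/idP/idP => [|].
  rewrite !inE => /orP[/eqP->|/imsetP[e' ]].
    rewrite cards2 -val_eqE /= neq_ltn ltn_ord /=.
    by apply/existsP; exists ord_max; rewrite extend_parents_max finset.setUC.
  rewrite inE => /andP[e2 /existsP[v /eqP E]] ->.
  rewrite card_imset // e2 /=; apply/existsP; exists (old_vertex v).
  by rewrite extend_parents_old E imsetU1 imset_set1.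
rewrite inE => /andP[e2 /existsP[v /eqP E]]; rewrite inE.
case: (oldP v) => [[y yE]|vE]; last by rewrite E vE extend_parents_max finset.setUC inE eqxx.
apply/orP; right; apply/imsetP; exists [set y; f y].
  rewrite inE; apply/andP; split; last by apply/existsP; exists y.
  by move: e2; rewrite E yE extend_parents_old !cards2 (inj_eq old_inj).
by rewrite E yE extend_parents_old imsetU1 imset_set1.
Qed.

End Extend.

(** [urrt_pmf] grows the tree one vertex at a time, [parent_pmf] draws all parents at once. The
    induction splits off the last coordinate through [extend_parents] and [restrict_parents], which
    are mutually inverse on the support. *)
Lemma urrt_parent_tree n (phi : sgraph n.+1 -> R) :
  \sum_T urrt_pmf R T * phi T = ET (fun f => phi (parent_tree f)).
Proof.
elim: n phi => [|n IH] phi.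
  have uE (f : {ffun 'I_1 -> 'I_1}) : parent_tree f = gempty 1.
    apply: val_inj; apply/finset.setP => e; rewrite !inE; apply/negbTE.
    rewrite negb_and; apply/orP; left; rewrite neq_ltn.
    by apply/orP; left; rewrite ltnS -[leqRHS](card_ord 1) max_card.
  rewrite /ET (bigD1 (gempty 1)) //= eqxx mul1r big1 ?addr0; last first.
    by move=> T /negPf->; rewrite mul0r.
  rewrite -[LHS](Ex_cst (parent_pmf_sum1 R 0)); apply: eq_Ex => f _; by rewrite uE.
transitivity (\sum_T urrt_pmf R T * \sum_(j : 'I_n.+1) n.+1%:R^-1 * phi (gattach T j)).
  rewrite /= (eq_bigr (fun T' => \sum_T \sum_j
     urrt_pmf R T * (n.+1%:R^-1 * (T' == gattach T j)%:R * phi T'))); last first.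
    move=> T' _; rewrite mulr_suml; apply: eq_bigr => T _.
    by rewrite -mulrA mulr_suml mulr_sumr.
  rewrite exchange_big /=; apply: eq_bigr => T _.
  rewrite exchange_big /= mulr_sumr; apply: eq_bigr => j _.
  rewrite (bigD1 (gattach T j)) //= eqxx big1 ?addr0 ?mulr1 // => T' /negPf->.
  by rewrite mulr0 mul0r mulr0.
rewrite IH /ET /Ex.
rewrite (eq_bigr (fun f => \sum_j parent_pmf R (extend_parents f j) * phi (parent_tree
  (extend_parents f j)))); last first.
  move=> f _; rewrite mulr_sumr; apply: eq_bigr => j _.
  by rewrite parent_pmf_extend gattach_parent_tree mulrA.
rewrite pair_bigA /= [RHS](bigID (@recursive n.+1)) /= [X in _ = _ + X]big1 ?addr0;
  last first.
  by move=> f; rewrite -(parent_pmf_neq0 R) negbK => /eqP->; rewrite mul0r.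
rewrite [RHS](reindex_onto (fun q => extend_parents q.1 q.2) (@restrict_parents n)) /=;
  last first.
  by move=> f rf; rewrite restrict_parentsK.
rewrite (bigID (fun q => recursive (extend_parents q.1 q.2))) /= [X in _ + X]big1 ?addr0;
  last first.
  by move=> q; rewrite -(parent_pmf_neq0 R) negbK => /eqP->; rewrite mul0r.
by apply: eq_bigl => -[f j]; rewrite extend_parentsK eqxx andbT.
Qed.

(** For an equivariant [K] the event does not involve the permutation, so the average over
    relabellings disappears. *)
Lemma coverage_equivariant n p (K : sgraph n.+1 -> {set 'I_n.+1}) :
  (forall (s : 'S_n.+1) F v, (s v \in K (grelabel s F)) = (v \in K F)) ->
  root_coverage_prob p K =
  ET (fun f => Ex (@er_pmf R n.+1 p) (fun G => (ord0 \in K (gunion (parent_tree f) G))%:R)).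
Proof.
move=> Ks; rewrite /root_coverage_prob.
rewrite -(urrt_parent_tree (fun T => Ex (er_pmf p) (fun G => (ord0 \in K (gunion T G))%:R))).
apply: eq_bigr => T _; rewrite mulr_sumr; apply: eq_bigr => G _.
rewrite (eq_bigr (fun=> urrt_pmf R T * er_pmf p G * n.+1`!%:R^-1 *
   (ord0 \in K (gunion T G))%:R)); last by move=> s _; rewrite Ks.
rewrite sumr_const card_Sn -mulr_natr; field.
by rewrite pnatr_eq0 -lt0n fact_gt0.
Qed.

End ParentTree.

(** * The core and its centroids *)

Section Centrality.
Variables (T : finType) (e : rel T).

Definition comp v := [set x | connect e v x].
(** The graph with [v] deleted; for [u != v], [branch v u] is then the component of [u] in what
    remains. *)
Definition brel v : rel T := [rel a b | [&& e a b, a != v & b != v]].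
Definition branch v u := [set x | connect (brel v) u x].

Lemma compE v x : (x \in comp v) = connect e v x. Proof. by rewrite finset.in_set. Qed.
Lemma branchE v u x : (x \in branch v u) = connect (brel v) u x.
Proof. by rewrite finset.in_set. Qed.

End Centrality.

Section RelabelCentrality.
Variables (T : finType) (e e' : rel T) (s : {perm T}).
Hypothesis es : forall x y, e' (s x) (s y) = e x y.

Lemma connect_perm x y : connect e' (s x) (s y) = connect e x y.
Proof.
have H (r r' : rel T) (h : T -> T) : (forall a b, r a b -> r' (h a) (h b)) ->
    forall a b, connect r a b -> connect r' (h a) (h b).
  move=> hr a b /connectP[p]; elim: p a => [|c p IH] a /=.
    by move=> _ ->; apply: connect0.
  move=> /andP[/hr ac pc] bE; apply: connect_trans (connect1 ac) _; exact: IH.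
apply/idP/idP => [|]; last by apply: H => a b; rewrite es.
rewrite -{2}[x](permK s) -{2}[y](permK s); apply: (H e') => a b.
by rewrite -[X in e' X _](permKV s) -[X in e' _ X](permKV s) es.
Qed.

Lemma card_comp_perm v : #|comp e' (s v)| = #|comp e v|.
Proof.
rewrite -[RHS](card_imset _ (@perm_inj _ s)); apply: eq_card => x.
by rewrite -[x](permKV s) (mem_imset _ _ (@perm_inj _ s)) !inE connect_perm.
Qed.

End RelabelCentrality.

Lemma card_branch_perm (T : finType) (e e' : rel T) (s : {perm T}) v u :
  (forall x y, e' (s x) (s y) = e x y) ->
  #|branch e' (s v) (s u)| = #|branch e v u|.
Proof.
move=> es; apply: (card_comp_perm (e := brel e v) (e' := brel e' (s v))) => x y.
by rewrite /brel /= es !(inj_eq perm_inj).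
Qed.

Section Core.
Variables (R : realType) (n : nat) (d j : nat).
Local Notation V := 'I_n.
Implicit Types (F : sgraph n) (u v x : V).

Definition high F v := (d <= deg F v)%N.
Definition core F v := high F v && (j <= #|[set x | adj F v x && high F x]|)%N.
Definition crel F : rel V := [rel u v | [&& core F u, core F v & adj F u v]].

(** An approximate centroid: no branch at [v] holds more than a proportion [c] of its component. The
    lower bound [w] singles out the component of the root. *)
Definition central (c w : R) F v :=
  [&& core F v, w <= #|comp (crel F) v|%:R &
    [forall u, crel F v u ==>
       (#|branch (crel F) v u|%:R <= c * #|comp (crel F) v|%:R)]].

(** The bound on the size must hold for every graph. Replacing an oversized set by the empty one
    achieves this without breaking equivariance. *)
Definition central_set (k : nat) (c w : R) F : {set V} :=
  let A := [set v | central c w F v] in if (#|A| <= k)%N then A else finset.set0.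

Lemma card_central_set k c w F : (#|central_set k c w F| <= k)%N.
Proof. by rewrite /central_set; case: ifP; rewrite ?cards0. Qed.

Variable s : 'S_n.

Lemma deg_relabel F v : deg (grelabel s F) (s v) = deg F v.
Proof.
rewrite /deg -[RHS](card_imset _ (@perm_inj _ s)); apply: eq_card => x.
by rewrite -[x](permKV s) (mem_imset _ _ (@perm_inj _ s)) !inE adj_relabel.
Qed.

Lemma high_relabel F v : high (grelabel s F) (s v) = high F v.
Proof. by rewrite /high deg_relabel. Qed.

Lemma core_relabel F v : core (grelabel s F) (s v) = core F v.
Proof.
rewrite /core high_relabel; congr (_ && (_ <= _)%N).
rewrite -[RHS](card_imset _ (@perm_inj _ s)); apply: eq_card => x.
rewrite -[x](permKV s) (mem_imset _ _ (@perm_inj _ s)) !inE adj_relabel.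
by rewrite high_relabel.
Qed.

Lemma crel_relabel F u v : crel (grelabel s F) (s u) (s v) = crel F u v.
Proof. by rewrite /crel /= !core_relabel adj_relabel. Qed.

Lemma central_relabel c w F v : central c w (grelabel s F) (s v) = central c w F v.
Proof.
rewrite /central core_relabel (card_comp_perm (crel_relabel F)).
congr [&& _, _ & _]; apply/forallP/forallP => H u; last first.
  rewrite -[u](permKV s) crel_relabel (card_branch_perm _ _ (crel_relabel F)).
  exact: H.
by have := H (s u); rewrite crel_relabel (card_branch_perm _ _ (crel_relabel F)).
Qed.

Lemma central_set_relabel k c w F v :
  (s v \in central_set k c w (grelabel s F)) = (v \in central_set k c w F).
Proof.
have E : [set u | central c w (grelabel s F) u] = s @: [set u | central c w F u].
  apply/finset.setP => x; rewrite -[x](permKV s) (mem_imset _ _ (@perm_inj _ s)) !inE.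
  exact: central_relabel.
rewrite /central_set E card_imset; last exact: perm_inj.
by case: ifP => _; rewrite ?inE // (mem_imset _ _ (@perm_inj _ s)) inE.
Qed.

End Core.

(** * Components, branches and masses in a vertex set of the tree *)

Section Subtree.
Variables (R : realType) (n : nat).
Local Notation V := 'I_n.+1.
Variables (f : {ffun V -> V}) (C : pred V) (e : rel V).
Hypothesis rf : recursive f.
Hypothesis eE : forall u x, e u x = [&& C u, C x & adj (parent_tree f) u x].
Implicit Types (u v x : V).

(** When the root satisfies [C], this is its component in the subgraph of the tree induced by [C];
    see [comp_closed_up]. *)
Definition closed_up := [set u | [forall x, desc f x u ==> C x]].
Local Notation A := closed_up.
Definition mass v := #|[set u in A | desc f v u]|.

Lemma closed_upP u : reflect (forall x, desc f x u -> C x) (u \in A).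
Proof. by rewrite inE; apply: (iffP forall_inP). Qed.

Lemma closed_up_C u : u \in A -> C u.
Proof. by move/closed_upP; apply; apply: desc_refl. Qed.

Lemma closed_up_parent u : u \in A -> f u \in A.
Proof.
move=> /closed_upP uA; apply/closed_upP => x xfu; apply: uA; exact: desc_parent.
Qed.

Lemma closed_up_child u : f u \in A -> C u -> u \in A.
Proof.
move=> /closed_upP uA Cu; apply/closed_upP => x xu.
have := desc_le rf xu; rewrite leq_eqVlt => /orP[/eqP/val_inj->//|xltu].
by apply: uA; rewrite -desc_step.
Qed.

Lemma core_rel_sym : symmetric e.
Proof. by move=> u x; rewrite !eE adjC andbCA. Qed.

Let e_connect_sym : connect_sym e. Proof. exact/sym_connect_sym/core_rel_sym. Qed.

Lemma closed_closed_up : fingraph.closed e A.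
Proof.
apply: (intro_closed e_connect_sym) => u x; rewrite eE adj_parent_tree.
move=> /and3P[Cu Cx /andP[_ /orP[/eqP<-|/eqP E]]]; first exact: closed_up_parent.
by rewrite -{1}E => /closed_up_child; apply.
Qed.

Lemma recursive_neq u : (0 < u)%N -> u != f u.
Proof. by move=> u0; rewrite -val_eqE /=; have := recursive_lt rf u0; lia. Qed.

Lemma connect_root u : u \in A -> connect e u ord0.
Proof.
have [k] := ubnP (u : nat); elim: k u => // k IH u uk uA.
have [u0|u0] := posnP u.
  by rewrite (_ : u = ord0) ?connect0 //; apply: val_inj.
have fA := closed_up_parent uA; apply: (@connect_trans _ _ (f u)).
  by apply: connect1; rewrite eE adj_parent_tree recursive_neq // eqxx !closed_up_C.
by apply: IH => //; have := recursive_lt rf u0; lia.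
Qed.

Lemma comp_closed_up u : u \in A -> comp e u = A.
Proof.
move=> uA; apply/finset.setP => x; rewrite compE; apply/idP/idP => [ux|xA].
  by rewrite -(closed_connect closed_closed_up ux).
apply: connect_trans (connect_root uA) _; rewrite e_connect_sym; exact: connect_root.
Qed.

(* Components other than that of the root hang off a single vertex below [m]. *)
Lemma comp_notin_closed_up m m' u : (0 < m)%N -> (forall v, (v < m)%N -> C v) ->
  (forall v, C v -> (v < m')%N) -> C u -> u \notin A ->
  (#|comp e u| <= fringe m f (anc m f u) m')%N.
Proof.
move=> m0 Cm Cm' Cu uA; apply: subset_leq_card; apply/fintype.subsetP => x;
  rewrite compE => ux.
have mA v : (v < m)%N -> v \in A.
  move=> vm; apply/closed_upP => y /(desc_le rf) yv; apply: Cm; lia.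
have outside y : y \notin A -> (m <= y)%N.
  by move=> yA; rewrite leqNgt; apply: contra yA; apply: mA.
(* Vertices outside [A] are born at time [m] or later, so a tree edge between two of them leaves the
   ancestor below [m] unchanged; [B] is therefore closed under [e]. *)
pose B := [set y | [&& y \notin A, C y & anc m f y == anc m f u]].
have BE y : (y \in B) = [&& y \notin A, C y & anc m f y == anc m f u].
  by rewrite finset.in_set.
have Bcl : fingraph.closed e B.
  apply: (intro_closed e_connect_sym) => y z eyz; rewrite !BE.
  move=> /and3P[yA Cy /eqP ym].
  have zA : z \notin A by rewrite -(closed_closed_up eyz).
  have ymm := outside _ yA; have zmm := outside _ zA.
  move: eyz; rewrite eE adj_parent_tree zA => /and3P[_ -> /andP[_ /orP[/eqP E|/eqP E]]] /=.
    by rewrite -E -anc_step // ym.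
  by rewrite anc_step // E ym.
have : x \in B by rewrite -(closed_connect Bcl ux) BE uA Cu eqxx.
by rewrite BE => /and3P[_ Cx xu]; rewrite inE Cm'.
Qed.

Lemma brel_sym v : symmetric (brel e v).
Proof.
by move=> u x; rewrite /brel /= core_rel_sym; case: (e x u) => //=; rewrite andbC.
Qed.

(** A vertex of [A] that does not descend from [v] reaches the root through its ancestors without
    meeting [v]. So all of [A] except the descendants of [v] lies in the branch of its parent. *)
Lemma card_branch_parent v : v \in A -> (0 < v)%N ->
  (#|A| <= #|branch e v (f v)| + mass v)%N.
Proof.
move=> vA v0; rewrite -[X in (X <= _)%N](cardsID [set u | desc f v u]) addnC.
apply: leq_add; last by apply: subset_leq_card; apply/fintype.subsetP => u; rewrite !inE.
apply: subset_leq_card; apply/fintype.subsetP => x;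
  rewrite finset.in_setD inE => /andP[vx xA].
have toroot u : u \in A -> ~~ desc f v u -> connect (brel e v) u ord0.
  have [k] := ubnP (u : nat); elim: k u => // k IH u uk uA vu.
  have [u0|u0] := posnP u.
    by rewrite (_ : u = ord0) ?connect0 //; apply: val_inj.
  have fA := closed_up_parent uA.
  have vfu : ~~ desc f v (f u) by apply: contra vu; apply: desc_parent.
  apply: (@connect_trans _ _ (f u)).
    apply: connect1; rewrite /brel /= eE adj_parent_tree recursive_neq // eqxx !closed_up_C
      //=.
    apply/andP; split; last by apply: contraNneq vfu => ->; apply: desc_refl.
    by apply: contraNneq vu => ->; apply: desc_refl.
  by apply: IH => //; have := recursive_lt rf u0; lia.
rewrite branchE; apply: connect_trans (toroot _ (closed_up_parent vA) _) _.
  by apply/negP => /(desc_le rf); have := recursive_lt rf v0; lia.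
by rewrite (sym_connect_sym (brel_sym v)); apply: toroot.
Qed.

Lemma branch_root u : ord0 \in A -> e ord0 u ->
  branch e ord0 u \subset [set x in A | desc f u x].
Proof.
move=> rA eu; apply/fintype.subsetP => x; rewrite branchE => ux.
have fu : f u = ord0.
  move: eu; rewrite eE adj_parent_tree => /and3P[_ _ /andP[ru /orP[/eqP E|/eqP//]]].
  by case/eqP: ru; rewrite -E; apply: val_inj; rewrite /= (recursive0 rf).
have uA : u \in A by rewrite -(closed_closed_up eu).
set B := [set x in A | desc f u x].
have BE y : (y \in B) = (y \in A) && desc f u y by rewrite finset.in_set.
have Bcl : fingraph.closed (brel e ord0) B.
  apply: (intro_closed (sym_connect_sym (brel_sym _))) => y z.
  rewrite /brel /= => /and3P[eyz y0 z0]; rewrite !BE => /andP[yA uy].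
  have zA : z \in A by rewrite -(closed_closed_up eyz).
  rewrite zA /=.
  move: eyz; rewrite eE adj_parent_tree => /and3P[_ _ /andP[_ /orP[/eqP E|/eqP E]]].
    have := desc_le rf uy; rewrite leq_eqVlt => /orP[/eqP/val_inj uyE|].
      by rewrite -E -uyE fu eqxx in z0.
    by rewrite -E => uylt; rewrite -desc_step.
  by apply: desc_parent => //; rewrite E.
by rewrite -(closed_connect Bcl ux) BE uA desc_refl.
Qed.

(** Vertex 1 is always a child of the root. The branch of [u] lies among the descendants of 1 if [u]
    is 1, and avoids them if [u] is another child, so one split of the component controls all
    branches at the root. *)
Lemma card_branch_root (v : V) u : v = 1%N :> nat -> ord0 \in A -> e ord0 u ->
  (#|branch e ord0 u| <= maxn (mass v) (#|A| - mass v))%N.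
Proof.
move=> v1 rA eu; have [uv|uv] := eqVneq u v.
  by rewrite leq_max subset_leq_card // -uv; apply: branch_root.
rewrite leq_max; apply/orP; right.
have -> : (#|A| - mass v = #|A :\: [set x | desc f v x]|)%N.
  rewrite -(cardsID [set x | desc f v x] A) /mass (_ : [set u in A | desc f v u] = A :&:
    [set x | desc f v x]) ?addKn //.
  by apply/finset.setP => x; rewrite !inE.
apply: subset_leq_card; apply: fintype.subset_trans (branch_root rA eu) _.
apply/fintype.subsetP => x; rewrite finset.in_set => /andP[xA ux];
  rewrite finset.in_setD xA andbT inE.
have := eu; rewrite eE adj_parent_tree => /and3P[_ _ /andP[ru fu]].
have u0 : (0 < u)%N by rewrite lt0n; apply: contra ru => /eqP E; apply/eqP/val_inj.
have uv' : (v < u)%N by move: uv; rewrite -val_eqE /=; lia.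
have {}fu : f u = ord0.
  case/orP: fu => /eqP // E; case/eqP: ru; rewrite -E.
  by apply: val_inj; rewrite /= (recursive0 rf).
rewrite -(@desc_anc _ f v u.+1) ?ltnS ?(ltnW uv') // (eqP ux).
by rewrite desc_step // fu; apply/negP => /(desc_le rf); rewrite v1.
Qed.

Lemma mass_fringe m v : (0 < m <= v)%N ->
  (mass v <= #|[set u in A | anc m f u == anc m f v]|)%N.
Proof.
move=> /andP[m0 mv]; apply: subset_leq_card; apply/fintype.subsetP => u.
rewrite finset.in_set => /andP[uA /eqP vu]; rewrite finset.in_set uA /=.
by rewrite (@anc_comp _ v.+1 m f u) ?m0 ?leqW // vu.
Qed.

End Subtree.

(** * The noisy tree *)

Section NoisyTree.
Variable n : nat.
Local Notation V := 'I_n.+1.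
Implicit Types (f g : {ffun V -> V}) (G : sgraph n.+1) (u v x : V).

Definition noisy f G := gunion (parent_tree f) G.

Definition children f v := [set u : V | (v < u)%N & f u == v].
Definition nchildren f v := #|children f v|.

Lemma children_adj f G v x : x \in children f v -> adj (noisy f G) v x.
Proof.
rewrite inE adj_union adj_parent_tree => /andP[vx ->]; rewrite orbT andbT.
by rewrite -val_eqE /= neq_ltn vx.
Qed.

Lemma parent_tree_adj f v x : recursive f -> adj (parent_tree f) v x ->
  (x == f v) || (x \in children f v).
Proof.
move=> rf; rewrite adj_parent_tree eq_sym [x == f v]eq_sym => /andP[vx /orP[->//|/eqP E]].
apply/orP; right; rewrite inE E eqxx andbT.
have := recursive_le x rf; rewrite E leq_eqVlt => /orP[/eqP/val_inj vE|//].
by rewrite vE eqxx in vx.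
Qed.

Section Bounds.
Variables (f : {ffun V -> V}) (G : sgraph n.+1) (d j r : nat).
Hypothesis rf : recursive f.
Local Notation F := (noisy f G).

Lemma nchildren_le_deg v : (nchildren f v <= deg F v)%N.
Proof.
apply: subset_leq_card; apply/fintype.subsetP => x xv; rewrite inE; exact: children_adj.
Qed.

Lemma deg_le_nchildren v : (deg F v <= nchildren f v + deg G v + 1)%N.
Proof.
rewrite /deg; set B := [set x | adj G v x].
apply: (@leq_trans #|children f v :|: B :|: [set f v]|).
  apply: subset_leq_card; apply/fintype.subsetP => x;
    rewrite finset.in_set adj_union => /orP[|].
    by move/(parent_tree_adj rf); rewrite finset.in_setU finset.in_set1 finset.in_setU =>
      /orP[]->; rewrite ?orbT.
  by move=> vx; rewrite !finset.in_setU [x \in B]finset.in_set vx orbT.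
apply: leq_trans (leq_card_setU _ _) _; rewrite cards1 leq_add2r.
exact: leq_card_setU.
Qed.

Lemma core_ge v : (d <= nchildren f v)%N ->
  (j <= #|[set u in children f v | (d <= nchildren f u)%N]|)%N -> core d j F v.
Proof.
move=> dv jv; rewrite /core /high (leq_trans dv (nchildren_le_deg v)) /=.
apply: leq_trans jv _; apply: subset_leq_card; apply/fintype.subsetP => x.
rewrite finset.in_set => /andP[xv dx]; rewrite inE children_adj //=.
exact: leq_trans dx (nchildren_le_deg x).
Qed.

(** Of the observed degree at most [r] comes from the noise and 1 from the parent; the rest are
    children, a quantity of the tree alone. *)
Definition nearly_high v := (d <= nchildren f v + r + 1)%N.

Hypothesis noise_deg : forall v, (deg G v <= r)%N.
Hypothesis noise_free : forall u v, u != v -> nearly_high u -> nearly_high v -> ~~ adj G u v.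

Lemma high_nearly v : high d F v -> nearly_high v.
Proof.
rewrite /high /nearly_high => /leq_trans; apply; apply: leq_trans (deg_le_nchildren v) _.
by rewrite leq_add2r leq_add2l.
Qed.

Lemma high_adj u v : high d F u -> high d F v -> adj F u v = adj (parent_tree f) u v.
Proof.
move=> /high_nearly hu /high_nearly hv; rewrite adj_union.
case: (boolP (adj G u v)) => [Guv|]; last by rewrite orbF.
by have := noise_free (adj_neq Guv) hu hv; rewrite Guv.
Qed.

(** The additional 1 allows for the parent, the only tree neighbour that is not a child. *)
Lemma core_le v : core d j F v ->
  (j <= #|[set u in children f v | nearly_high u]| + 1)%N.
Proof.
move=> /andP[hv /leq_trans]; apply; rewrite -(cards1 (f v)).
apply: leq_trans (leq_card_setU _ _); apply: subset_leq_card; apply/fintype.subsetP => x.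
rewrite finset.in_set => /andP[vx hx]; rewrite finset.in_setU finset.in_set1 finset.in_set.
move: vx; rewrite high_adj // => /(parent_tree_adj rf)/orP[->|->]; first by rewrite orbT.
by rewrite high_nearly.
Qed.

Lemma crelE u v : crel d j F u v = [&& core d j F u, core d j F v & adj (parent_tree f) u v].
Proof.
rewrite /crel /=; case: (boolP (core d j F u)) => //= /andP[hu _].
by case: (boolP (core d j F v)) => //= /andP[hv _]; apply: high_adj.
Qed.

End Bounds.

Section Fringe.
Variables (d j m : nat).

(* [core] with the vertices below [m] counted as high, so that it does not
   depend on the tree restricted to them. *)
Definition fringe_core F v :=
  high d F v && (j <= #|[set x : V | adj F v x && ((x < m)%N || high d F x)]|)%N.

Definition core_tree f G := closed_up f (fun x => (x < m)%N || fringe_core (noisy f G) x).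
Definition fringe_mass f G (i : V) := #|[set u in core_tree f G | anc m f u == i]|.

(** If the first [m] vertices are in the core they are high, and the two notions of core agree. This
    leads from the decoupled version back to the observed graph. *)
Lemma core_treeE f G : (forall v, (v < m)%N -> core d j (noisy f G) v) ->
  core_tree f G = closed_up f (core d j (noisy f G)).
Proof.
move=> Cm; apply/finset.setP => u; rewrite !finset.in_set; apply: eq_forallb => x;
  congr (_ ==> _).
have [xm|xm] := ltnP x m; first by rewrite Cm.
rewrite /fringe_core /core /=; congr (_ && (_ <= _)%N); apply: eq_card => y.
rewrite !finset.in_set; case: ltnP => //= ym; congr (_ && _).
by have /andP[->] := Cm y ym.
Qed.

Section Equivariance.
Variables (f g : {ffun V -> V}) (G G' : sgraph n.+1) (s : 'S_n.+1).
Hypotheses (rf : recursive f) (rg : recursive g) (m0 : (0 < m)%N).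
Hypothesis s_fix : forall t : V, (m <= t)%N -> s t = t.
Hypothesis fg : forall t : V, (m <= t)%N -> g t = s (f t).
Hypothesis GG' : forall u v, adj G' (s u) (s v) = adj G u v.

Lemma perm_fix_lt k u : (m <= k)%N -> (s u < k)%N = (u < k)%N.
Proof.
move=> mk; have [um|um] := ltnP u m; last by rewrite s_fix.
rewrite (leq_trans um mk); apply: leq_trans mk; rewrite ltnNge; apply/negP => sm.
have E : s u = u by apply: (@perm_inj _ s); rewrite s_fix.
by move: sm; rewrite E leqNgt um.
Qed.

Lemma anc_perm k u : (m <= k)%N -> anc k g (s u) = s (anc k f u).
Proof.
move=> mk; have [l] := ubnP (u : nat); elim: l u => // l IH u ul.
have k0 : (0 < k)%N by apply: leq_trans mk.
have [uk|ku] := ltnP u k; first by rewrite !anc_id // perm_fix_lt.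
have mu : (m <= u)%N by apply: leq_trans ku.
rewrite s_fix // anc_step // [in RHS]anc_step // fg //; apply: IH.
by have := recursive_lt rf (leq_trans m0 mu); lia.
Qed.

Lemma noisy_adj_perm u x : (m <= u)%N ->
  adj (noisy g G') u (s x) = adj (noisy f G) u x.
Proof.
move=> mu; rewrite !adj_union; congr (_ || _); last by rewrite -{1}(s_fix mu) GG'.
rewrite !adj_parent_tree -{1}(s_fix mu) (inj_eq perm_inj); congr (_ && (_ || _)).
  by rewrite fg // (inj_eq perm_inj).
have [xm|xm] := ltnP x m.
  have below h (y : V) : recursive h -> (y < m)%N -> (h y == u) = false.
    move=> rh ym; apply/negP => /eqP E; have := recursive_le y rh.
    by rewrite E leqNgt (leq_trans ym mu).
  by rewrite !below // perm_fix_lt.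
by rewrite s_fix // fg // -{1}(s_fix mu) (inj_eq perm_inj).
Qed.

Lemma high_perm u : (m <= u)%N -> high d (noisy g G') u = high d (noisy f G) u.
Proof.
move=> mu; rewrite /high /deg -[in RHS](card_imset _ (@perm_inj _ s)).
congr (_ <= _)%N; apply: eq_card => x; rewrite -[x](permKV s).
by rewrite (mem_imset _ _ (@perm_inj _ s)) !finset.in_set noisy_adj_perm.
Qed.

Lemma fringe_core_perm u : (m <= u)%N -> fringe_core (noisy g G') u = fringe_core (noisy f
  G) u.
Proof.
move=> mu; rewrite /fringe_core high_perm // -[in RHS](card_imset _ (@perm_inj _ s)).
congr (_ && (_ <= _)%N); apply: eq_card => x; rewrite -[x](permKV s).
rewrite (mem_imset _ _ (@perm_inj _ s)) !finset.in_set noisy_adj_perm // perm_fix_lt //.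
by case: ltnP => //= xm; rewrite s_fix // high_perm.
Qed.

Lemma core_tree_perm u : (s u \in core_tree g G') = (u \in core_tree f G).
Proof.
have H x : ((x < m)%N || fringe_core (noisy g G') x) = ((x < m)%N || fringe_core (noisy f
  G) x).
  by case: ltnP => //= mx; rewrite fringe_core_perm.
rewrite !finset.in_set; apply: eq_forallb => x; rewrite H.
case: ltnP => mx /=; first by rewrite !implybT.
congr (_ ==> _); rewrite /desc anc_perm; last by apply: leqW.
by rewrite -{2}(s_fix mx) (inj_eq perm_inj).
Qed.

(** Nothing relates [f] and [g] below [m]. With [s] the identity this yields the independence of the
    masses from the tree on the first [m] vertices, with a general [s] their exchangeability. *)
Lemma fringe_mass_perm i : fringe_mass g G' (s i) = fringe_mass f G i.
Proof.
rewrite /fringe_mass -[RHS](card_imset _ (@perm_inj _ s)); apply: eq_card => x.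
rewrite -[x](permKV s) (mem_imset _ _ (@perm_inj _ s)) finset.in_set [in RHS]finset.in_set.
by rewrite core_tree_perm anc_perm // (inj_eq perm_inj).
Qed.

End Equivariance.

Lemma fringe_mass_local f g G i : recursive f -> recursive g -> (0 < m)%N ->
  (forall t : V, (m <= t)%N -> f t = g t) -> fringe_mass f G i = fringe_mass g G i.
Proof.
move=> rf rg m0 fg; rewrite -[X in fringe_mass g G X](perm1 i).
by apply/esym/fringe_mass_perm => //= [t|t mt|u v]; rewrite ?perm1 ?fg.
Qed.

Lemma sum_fringe_mass f G (B : pred V) :
  (\sum_(i | B i) fringe_mass f G i = #|[set u in core_tree f G | B (anc m f u)]|)%N.
Proof.
rewrite -sum1dep_card [RHS](partition_big (anc m f) B) /=; last by move=> u /andP[].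
apply: eq_bigr => i Bi; rewrite /fringe_mass -sum1dep_card; apply: eq_bigl => u.
by case: eqP => [->|]; rewrite ?andbF // Bi !andbT.
Qed.

Lemma fringe_mass_gt0 f G (i : V) : recursive f -> (i < m)%N -> (0 < fringe_mass f G i)%N.
Proof.
move=> rf im; apply/card_gt0P; exists i; rewrite finset.in_set anc_id // eqxx andbT.
by rewrite finset.in_set; apply/forall_inP => x /(desc_le rf) xi; apply/orP; left; lia.
Qed.

Lemma fringe_mass_eq0 f G (i : V) : recursive f -> (0 < m)%N -> (m <= i)%N -> fringe_mass f
  G i = 0%N.
Proof.
move=> rf m0 mi; apply/eqP; rewrite finset.cards_eq0; apply/eqP/finset.setP => u.
rewrite finset.in_set finset.in_set0; apply/negP => /andP[_ /eqP E].
by have := anc_lt u rf m0; rewrite E; lia.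
Qed.

End Fringe.
End NoisyTree.

(** * The joint law of tree and noise, and its symmetries *)

Section Joint.
Variables (R : realType) (n : nat) (p : R).
Local Notation V := 'I_n.+1.
Local Notation Om := ({ffun V -> V} * sgraph n.+1)%type.
Implicit Types (f g : {ffun V -> V}) (G : sgraph n.+1) (om : Om).

Definition joint_pmf om : R := parent_pmf R om.1 * er_pmf p om.2.

Lemma joint_pmf_ge0 om : 0 <= p <= 1 -> 0 <= joint_pmf om.
Proof. by move=> p01; rewrite mulr_ge0 ?parent_pmf_ge0 ?er_ge0. Qed.

Lemma Ex_joint X : Ex joint_pmf X = ET (fun f => Ex (er_pmf p) (fun G => X (f, G))).
Proof.
transitivity (\sum_f \sum_G joint_pmf (f, G) * X (f, G)).
  by rewrite pair_bigA; apply: eq_bigr => -[].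
apply: eq_bigr => f _; rewrite mulr_sumr; apply: eq_bigr => G _.
by rewrite /joint_pmf mulrA.
Qed.

Lemma joint_pmf_sum1 : \sum_om joint_pmf om = 1.
Proof.
have := Ex_joint (fun=> 1); rewrite /Ex; under eq_bigr do rewrite mulr1.
move=> ->; rewrite -[RHS](Ex_cst (parent_pmf_sum1 R n)); apply: eq_Ex => f _.
by apply: Ex_cst; apply: er_sum1.
Qed.

Lemma joint_pmf_recursive om : joint_pmf om != 0 -> recursive om.1.
Proof. by rewrite mulf_eq0 negb_or => /andP[+ _]; rewrite parent_pmf_neq0. Qed.

Lemma Pr_joint_tree (A : pred {ffun V -> V}) : Pr joint_pmf (fun om => A om.1) = Pr
  (@parent_pmf R n) A.
Proof.
by rewrite /Pr Ex_joint; apply: eq_Ex => f _; rewrite /= Ex_cst //; apply: er_sum1.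
Qed.

Lemma Pr_joint_noise (A : pred (sgraph n.+1)) : Pr joint_pmf (fun om => A om.2) = Pr
  (er_pmf p) A.
Proof. by rewrite /Pr Ex_joint /ET /= Ex_cst //; apply: parent_pmf_sum1. Qed.

Section Shift.
Variables (m : nat) (s : 'S_n.+1).
Hypothesis m0 : (0 < m)%N.
Hypothesis s_fix : forall t : V, (m <= t)%N -> s t = t.

Definition shift_parents (s : 'S_n.+1) f : {ffun V -> V} :=
  [ffun t : V => if (t < m)%N then f t else s (f t)].

(** For t >= m the permutation preserves the set of vertices below [t], over which the parent of [t]
    is uniform; earlier parents are untouched. *)
Lemma parent_pmf_shift f : parent_pmf R (shift_parents s f) = parent_pmf R f.
Proof.
apply: eq_bigr => t _; rewrite ffunE; case: ltnP => // mt.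
rewrite /parent_prob ifN; last by lia.
rewrite ifN; last by lia.
by rewrite (perm_fix_lt s_fix).
Qed.

Lemma shift_parentsK : cancel (shift_parents s) (shift_parents s^-1).
Proof.
by move=> f; apply/ffunP => t; rewrite !ffunE; case: ltnP => // _; rewrite permK.
Qed.

Lemma Ex_shift X : Ex joint_pmf X = Ex joint_pmf (fun om => X (shift_parents s om.1,
  grelabel s om.2)).
Proof.
have inj : injective (fun om : Om => (shift_parents s om.1, grelabel s om.2)).
  move=> [f G] [g H] E; have := congr1 fst E; have := congr1 snd E.
  by move=> /= /(can_inj (@grelabelK _ s)) -> /(can_inj shift_parentsK) ->.
rewrite /Ex (reindex_inj inj) /=; apply: eq_bigr => om _.
by rewrite /joint_pmf /= parent_pmf_shift er_relabel.
Qed.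

End Shift.

Lemma Ex_indep_below m (X : {ffun V -> V} -> R) (Y : Om -> R) :
  (forall f g, recursive f -> recursive g -> (forall t : V, (t < m)%N -> f t = g t) -> X f
    = X g) ->
  (forall f g G, recursive f -> recursive g -> (forall t : V, (m <= t)%N -> f t = g t) ->
     Y (f, G) = Y (g, G)) ->
  Ex joint_pmf (fun om => X om.1 * Y om) = ET X * Ex joint_pmf Y.
Proof.
move=> Xm Ym; rewrite !Ex_joint.
transitivity (ET (fun f => X f * Ex (er_pmf p) (fun G => Y (f, G)))).
  by apply: eq_Ex => f _; rewrite -ExZ.
apply: (@Ex_indep _ _ _ _ _ (fun t : V => (m <= t)%N)); first exact: parent_prob_sum1.
  move=> f g; rewrite !parent_pmf_neq0 => rf rg fg; apply: Xm => // t tm; apply: fg.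
  by rewrite -ltnNge.
move=> f g; rewrite !parent_pmf_neq0 => rf rg fg.
by apply: eq_Ex => G _; apply: Ym.
Qed.

End Joint.

(** * Exchangeability of the fringe masses *)

Section Exchangeable.
Variables (R : realType) (n : nat) (p : R) (d j m : nat) (q0 : R).
Hypotheses (p01 : 0 <= p <= 1) (m_gt1 : (1 < m <= n.+1)%N).
Local Notation V := 'I_n.+1.
Local Notation Om := ({ffun V -> V} * sgraph n.+1)%type.
Local Notation E := (Ex (@joint_pmf R n p)).
Implicit Types (om : Om) (i k v : V) (f g : {ffun V -> V}) (G : sgraph n.+1).

Let m0 : (0 < m)%N. Proof. by case/andP: m_gt1; lia. Qed.

Local Notation Y om i := ((fringe_mass d j m om.1 om.2 i)%:R : R).
Definition core_size om : R := #|core_tree d j m om.1 om.2|%:R.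
(** For exchangeable proportions the sum of squares governs the variance of partial sums; it also
    bounds the largest fringe. *)
Definition spread om := \sum_i Y om i ^+ 2 <= q0 * core_size om ^+ 2.

(* The proportion of the core in fringe [i], on the event that no
   single fringe dominates. *)
Definition share om i : R := (spread om)%:R * (Y om i / core_size om).

Lemma core_sizeE om : core_size om = \sum_i Y om i.
Proof.
rewrite /core_size -natr_sum (sum_fringe_mass d j m om.1 om.2 xpredT); congr (_%:R).
by apply: eq_card => u; rewrite finset.in_set andbT.
Qed.

Lemma core_size_gt0 om : recursive om.1 -> 0 < core_size om.
Proof.
move=> rf; rewrite core_sizeE (bigD1 ord0) //= ltr_wpDr //.
  by apply: sumr_ge0 => i _; rewrite ler0n.
by rewrite ltr0n fringe_mass_gt0.
Qed.

Lemma share_ge0 om i : 0 <= share om i.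
Proof. by rewrite !mulr_ge0 ?invr_ge0 ?ler0n. Qed.

Lemma sum_share om : recursive om.1 -> \sum_i share om i = (spread om)%:R.
Proof.
move=> rf; rewrite -mulr_sumr -mulr_suml -core_sizeE divff ?mulr1 //.
by rewrite gt_eqF // core_size_gt0.
Qed.

Lemma share_eq0 om i : recursive om.1 -> (m <= i)%N -> share om i = 0.
Proof. by move=> rf mi; rewrite /share fringe_mass_eq0 // mul0r mulr0. Qed.

Lemma sum_share2 om : recursive om.1 -> 0 <= q0 -> \sum_i share om i ^+ 2 <= q0.
Proof.
move=> rf q; rewrite /share; case: (boolP (spread om)) => [sp|_]; last first.
  by rewrite big1 // => i _; rewrite mul0r expr0n.
under eq_bigr do rewrite mul1r expr_div_n.
by rewrite -mulr_suml ler_pdivrMr // exprn_gt0 // core_size_gt0.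
Qed.

Section Local.
Variables (f g : {ffun V -> V}) (G : sgraph n.+1).
Hypotheses (rf : recursive f) (rg : recursive g).
Hypothesis fg : forall t : V, (m <= t)%N -> f t = g t.

Let YE k : fringe_mass d j m f G k = fringe_mass d j m g G k. Proof. exact:
  fringe_mass_local. Qed.

Let core_size_local : core_size (f, G) = core_size (g, G).
Proof. by rewrite !core_sizeE; apply: eq_bigr => k _; rewrite /= YE. Qed.

Lemma spread_local : spread (f, G) = spread (g, G).
Proof.
rewrite /spread core_size_local; congr (_ <= _).
by apply: eq_bigr => k _; rewrite /= YE.
Qed.

Lemma share_local i : share (f, G) i = share (g, G) i.
Proof. by rewrite /share spread_local core_size_local /= YE. Qed.

End Local.

Section Perm.
Variable s : 'S_n.+1.
Hypothesis s_fix : forall t : V, (m <= t)%N -> s t = t.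

Lemma share_perm om i : recursive om.1 ->
  share (shift_parents m s om.1, grelabel s om.2) (s i) = share om i.
Proof.
case: om => f G /= rf.
have rg : recursive (shift_parents m s f) by rewrite -(parent_pmf_neq0 R) parent_pmf_shift
  // parent_pmf_neq0.
have YE k : fringe_mass d j m (shift_parents m s f) (grelabel s G) (s k) = fringe_mass d j
  m f G k.
  apply: fringe_mass_perm => // [t mt|u v]; last exact: adj_relabel.
  by rewrite ffunE ltnNge mt.
set om' := (_, _); have tE : core_size om' = core_size (f, G).
  rewrite !core_sizeE (reindex_inj (@perm_inj _ s)).
  by apply: eq_bigr => k _; rewrite /= YE.
have sE : spread om' = spread (f, G).
  rewrite /spread tE (reindex_inj (@perm_inj _ s)); congr (_ <= _).
  by apply: eq_bigr => k _; rewrite /= YE.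
by rewrite /share sE tE /= YE.
Qed.

Lemma Ex_share_perm i : E (share ^~ (s i)) = E (share ^~ i).
Proof.
rewrite (Ex_shift p m0 s_fix); apply: eq_Ex => om /joint_pmf_recursive rf; exact: share_perm.
Qed.

Lemma Ex_share2_perm i k :
  E (fun om => share om (s i) * share om (s k)) = E (fun om => share om i * share om k).
Proof.
rewrite (Ex_shift p m0 s_fix); apply: eq_Ex => om /joint_pmf_recursive rf;
  by rewrite !share_perm.
Qed.

End Perm.

Lemma two_transitive i k i' k' : (i < m)%N -> (k < m)%N -> (i' < m)%N -> (k' < m)%N ->
  (i == k) = (i' == k') -> exists s : 'S_n.+1,
  [/\ forall t : V, (m <= t)%N -> s t = t, s i = i' & s k = k'].
Proof.
move=> im km im' km' ikE.
have tfix (a b t : V) : (a < m)%N -> (b < m)%N -> (m <= t)%N -> tperm a b t = t.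
  by move=> am bm mt; rewrite tpermD // -val_eqE /=; lia.
pose k1 := tperm i i' k.
have k1m : (k1 < m)%N by rewrite /k1; case: tpermP.
exists (tperm i i' * tperm k1 k')%g; split=> [t mt||]; rewrite !permM.
- by rewrite !tfix.
- rewrite tpermL; case: eqVneq ikE => [ik /esym/eqP ik'|ik /esym/negbT ik'].
    by rewrite /k1 -ik tpermL tpermL.
  rewrite tpermD // 1?eq_sym //; apply/eqP => E; move: ik.
  by have := tpermK i i' k; rewrite -/k1 -E tpermR => ->; rewrite eqxx.
- by rewrite -/k1 tpermL.
Qed.

Let i0 : V := ord0.
Let i1 : V := inord 1.
Let i1E : i1 = 1%N :> nat. Proof. by rewrite /i1 inordK //; case/andP: m_gt1; lia. Qed.
Let i0m : (i0 < m)%N := m0.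
Let i1m : (i1 < m)%N. Proof. by rewrite i1E; case/andP: m_gt1. Qed.
Let i01 : i0 != i1. Proof. by rewrite -val_eqE /= -/(nat_of_ord i1) i1E. Qed.

Definition spread_prob := E (fun om => (spread om)%:R).
Definition share_sqr := E (fun om => share om i0 * share om i0).
Definition share_cross := E (fun om => share om i0 * share om i1).

Lemma Ex_share2 i k : (i < m)%N -> (k < m)%N ->
  E (fun om => share om i * share om k) = if i == k then share_sqr else share_cross.
Proof.
move=> im km; case: eqVneq => [<-|ik].
  have [|s [s_fix <- _]] := two_transitive i0m i0m im im; first by rewrite !eqxx.
  exact: Ex_share2_perm.
have [|s [s_fix <- <-]] := two_transitive i0m i1m im km.
  by rewrite (negPf ik) (negPf i01).
exact: Ex_share2_perm.
Qed.

Lemma sum_below (h : V -> R) : (forall i, (m <= i)%N -> h i = 0) ->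
  \sum_i h i = \sum_(i : V | (i < m)%N) h i.
Proof.
move=> h0; rewrite [RHS]big_mkcond; apply: eq_bigr => i _.
by case: ltnP => // /h0.
Qed.

Lemma sum_below_cst (c : R) : \sum_(i : V | (i < m)%N) c = m%:R * c.
Proof.
rewrite sumr_const mulr_natl -[in RHS](@card_ord_lt n m) ?cardsE //.
by case/andP: m_gt1.
Qed.

Lemma Ex_share1 i : (i < m)%N -> m%:R * E (share ^~ i) = spread_prob.
Proof.
move=> im; have H k : (k < m)%N -> E (share ^~ k) = E (share ^~ i).
  move=> km; have [|s [s_fix <- _]] := two_transitive im im km km.
    by rewrite !eqxx.
  exact: Ex_share_perm.
transitivity (E (fun om => \sum_(k : V | (k < m)%N) share om k)).
  by rewrite Ex_sum (eq_bigr _ H) sum_below_cst.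
apply: eq_Ex => om /joint_pmf_recursive rf; rewrite -sum_share // sum_below // => k mk.
exact: share_eq0.
Qed.

Lemma share_sqr_le : 0 <= q0 -> m%:R * share_sqr <= q0.
Proof.
move=> q; rewrite -sum_below_cst.
rewrite (eq_bigr (fun i => E (fun om => share om i * share om i))); last first.
  by move=> i im; rewrite Ex_share2 // eqxx.
rewrite -Ex_sum -[leRHS](Ex_cst (joint_pmf_sum1 n p)).
apply: (le_Ex (fun om => joint_pmf_ge0 om p01)) => om.
move=> /joint_pmf_recursive rf; rewrite -sum_below; first exact: sum_share2.
by move=> i mi; rewrite share_eq0 // mul0r.
Qed.

Lemma share_sqr_ge0 : 0 <= share_sqr.
Proof.
by apply: Ex_ge0 => [||om _]; [move=> om; exact: joint_pmf_ge0|exact: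
  joint_pmf_sum1|rewrite mulr_ge0 ?share_ge0].
Qed.

Lemma share_cross_ge0 : 0 <= share_cross.
Proof.
by apply: Ex_ge0 => [||om _]; [move=> om; exact: joint_pmf_ge0|exact:
  joint_pmf_sum1|rewrite mulr_ge0 ?share_ge0].
Qed.

Lemma spread_prob_le1 : spread_prob <= 1.
Proof.
rewrite -[leRHS](Ex_cst (joint_pmf_sum1 n p));
  apply: (le_Ex (fun om => joint_pmf_ge0 om p01)) => om.
by rewrite lern1 leq_b1.
Qed.

Lemma spread_prob_ge0 : 0 <= spread_prob.
Proof. by apply: Ex_ge0 => [||om _]; [move=> om;
  exact: joint_pmf_ge0|exact: joint_pmf_sum1|rewrite ler0n]. Qed.

(** The shares add up to an indicator, which equals its own square. Expanding that square ties
    [share_cross] to [share_sqr]. *)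
Lemma share_momentsE : m%:R * share_sqr + m%:R * (m%:R - 1) * share_cross = spread_prob.
Proof.
transitivity (\sum_(i : V | (i < m)%N) \sum_(k : V | (k < m)%N)
   E (fun om => share om i * share om k)).
  rewrite (eq_bigr (fun=> share_sqr + (m%:R - 1) * share_cross)); last first.
    move=> i im; rewrite (bigD1 i) //= Ex_share2 // eqxx; congr (_ + _).
    rewrite (eq_bigr (fun=> share_cross)); last first.
      by move=> k /andP[km /negPf ki]; rewrite Ex_share2 // eq_sym ki.
    by have := sum_below_cst share_cross; rewrite (bigD1 i) //= => H;
      rewrite mulrBl mul1r -H; ring.
  by rewrite sum_below_cst; ring.
under eq_bigr do rewrite -Ex_sum.
rewrite -Ex_sum; apply: eq_Ex => om /joint_pmf_recursive rf.
have SB : \sum_(i : V | (i < m)%N) share om i = (spread om)%:R.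
  by rewrite -sum_share // sum_below // => i mi; rewrite share_eq0.
under eq_bigr do rewrite -mulr_sumr SB.
by rewrite -mulr_suml SB; case: (spread om); rewrite ?mulr0 ?mulr1.
Qed.

(** * Sums of shares over a set determined by the early tree *)

Section RandomSet.
Variable S : {ffun V -> V} -> {set V}.
Hypothesis S_lt : forall f i, i \in S f -> (i < m)%N.
Hypothesis S_local : forall f g, recursive f -> recursive g ->
  (forall t : V, (t < m)%N -> f t = g t) -> S f = S g.

Lemma sum_mem_card f : \sum_(i : V | (i < m)%N) (i \in S f)%:R = #|S f|%:R :> R.
Proof.
rewrite -sum1_card natr_sum big_mkcond [RHS]big_mkcond; apply: eq_bigr => i _.
by case: (boolP (i \in S f)) => [/S_lt->|_] //; case: ifP.
Qed.

(** [S] depends on the parents of the vertices below [m] and the shares do not, so in the expanded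
    square the indicators of [S] separate from the products of shares. *)
Lemma Ex_sum_share2 :
  E (fun om => (\sum_(i in S om.1) share om i) ^+ 2) =
  share_cross * (ET (fun f => #|S f|%:R ^+ 2) - ET (fun f => #|S f|%:R)) +
  share_sqr * ET (fun f => #|S f|%:R).
Proof.
transitivity (\sum_(i : V | (i < m)%N) \sum_(k : V | (k < m)%N)
   ET (fun f => (i \in S f)%:R * (k \in S f)%:R) * (if i == k then share_sqr else
     share_cross)).
  transitivity (\sum_(i : V | (i < m)%N) \sum_(k : V | (k < m)%N) E (fun om =>
     ((i \in S om.1)%:R * (k \in S om.1)%:R) * (share om i * share om k))).
    under eq_bigr do rewrite -Ex_sum.
    rewrite -Ex_sum; apply: eq_Ex => om _.
    have -> : \sum_(i in S om.1) share om i =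
        \sum_(i : V | (i < m)%N) (i \in S om.1)%:R * share om i.
      rewrite big_mkcond [RHS]big_mkcond; apply: eq_bigr => i _.
      case: (boolP (i \in S om.1)) => [/S_lt->|_]; first by rewrite mul1r.
      by case: ifP; rewrite ?mul0r.
    rewrite expr2 mulr_suml; apply: eq_bigr => i _; rewrite mulr_sumr.
    by apply: eq_bigr => k _; ring.
  apply: eq_bigr => i im; apply: eq_bigr => k km; rewrite -Ex_share2 //.
  apply: (@Ex_indep_below _ _ _ m
    (fun f => (i \in S f)%:R * (k \in S f)%:R) (fun om => share om i * share om k)).
    by move=> f g rf rg fg; rewrite (S_local rf rg fg).
  by move=> f g G rf rg fg; rewrite !(share_local G rf rg fg).
have -> : ET (fun f => #|S f|%:R ^+ 2) = \sum_(i : V | (i < m)%N) \sum_(k : V | (k < m)%N)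
   ET (fun f => (i \in S f)%:R * (k \in S f)%:R) :> R.
  under eq_bigr do rewrite -Ex_sum.
  rewrite -Ex_sum; apply: eq_Ex => f _; rewrite -sum_mem_card expr2 mulr_suml.
  by apply: eq_bigr => i _; rewrite mulr_sumr.
have -> : ET (fun f => #|S f|%:R) = \sum_(i : V | (i < m)%N)
   ET (fun f => (i \in S f)%:R * (i \in S f)%:R) :> R.
  rewrite -Ex_sum; apply: eq_Ex => f _; rewrite -sum_mem_card.
  by apply: eq_bigr => i _; case: (i \in S f); rewrite ?mulr1 ?mulr0.
rewrite -sumrB !mulr_sumr -big_split /=; apply: eq_bigr => i im.
rewrite (bigD1 i) //= eqxx [in RHS](bigD1 i) //=.
rewrite (eq_bigr (fun k => share_cross * ET (fun f => (i \in S f)%:R * (k \in S f)%:R))).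
  by rewrite -mulr_sumr; ring.
by move=> k /andP[_ ki]; rewrite eq_sym (negPf ki) mulrC.
Qed.

Lemma card_S_le f : #|S f|%:R <= m%:R :> R.
Proof.
rewrite ler_nat -(@card_ord_lt n m); last by case/andP: m_gt1.
by apply: subset_leq_card; apply/fintype.subsetP => i /S_lt; rewrite inE.
Qed.

Lemma ET_cardS_ge0 : 0 <= ET (fun f => #|S f|%:R) :> R.
Proof. by apply: Ex_ge0 => [||f _]; [exact: parent_pmf_ge0|exact: parent_pmf_sum1|rewrite
  ler0n]. Qed.

Lemma ET_cardS_le : ET (fun f => #|S f|%:R) <= m%:R :> R.
Proof.
rewrite -[leRHS](Ex_cst (parent_pmf_sum1 R n)); apply: (le_Ex (@parent_pmf_ge0 R n)) => f.
by rewrite card_S_le.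
Qed.

Lemma ET_cardS2_le : ET (fun f => #|S f|%:R ^+ 2) <= m%:R ^+ 2 :> R.
Proof.
rewrite -[leRHS](Ex_cst (parent_pmf_sum1 R n)); apply: (le_Ex (@parent_pmf_ge0 R n)) => f.
by move=> _; rewrite lerXn2r ?nnegrE ?ler0n // card_S_le.
Qed.

Lemma ET_cardS2_ge0 : 0 <= ET (fun f => #|S f|%:R ^+ 2) :> R.
Proof.
by apply: Ex_ge0 => [||f _]; [exact: parent_pmf_ge0|exact: parent_pmf_sum1|rewrite exprn_ge0].
Qed.

Let mR : 1 < m%:R :> R. Proof. by rewrite ltr1n; case/andP: m_gt1. Qed.

Lemma share_cross_le : share_cross <= (m%:R * (m%:R - 1))^-1.
Proof.
rewrite -[leRHS]mul1r ler_pdivlMr; last by rewrite mulr_gt0; have := mR; lra.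
apply: le_trans spread_prob_le1; rewrite -share_momentsE mulrC lerDr mulr_ge0
  ?share_sqr_ge0 //.
Qed.

Lemma Ex_sum_share2_le : 0 <= q0 ->
  E (fun om => (\sum_(i in S om.1) share om i) ^+ 2) <=
  ET (fun f => #|S f|%:R ^+ 2) / (m%:R * (m%:R - 1)) +
  q0 / m%:R * ET (fun f => #|S f|%:R).
Proof.
move=> q; rewrite Ex_sum_share2; apply: lerD.
  apply: (@le_trans _ _ (share_cross * ET (fun f => #|S f|%:R ^+ 2))).
    by rewrite ler_wpM2l ?share_cross_ge0 // gerBl ET_cardS_ge0.
  by rewrite mulrC ler_wpM2l ?share_cross_le ?ET_cardS2_ge0.
rewrite ler_wpM2r ?ET_cardS_ge0 // ler_pdivlMr; last by have := mR; lra.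
by rewrite mulrC share_sqr_le.
Qed.

(** By exchangeability the share of [S] is centred at the proportion #|S| / m. In the expanded
    square the diagonal costs [q0]; the other terms, normalised by m (m - 1) instead of m^2, cost (m
    - 1)^-1. *)
Lemma Ex_share_dev : 0 <= q0 ->
  E (fun om => (\sum_(i in S om.1) share om i -
      (spread om)%:R * (#|S om.1|%:R / m%:R)) ^+ 2) <= (m%:R - 1)^-1 + q0.
Proof.
move=> q.
have m1 : m%:R != 0 :> R by have := mR; lra.
have m2 : m%:R - 1 != 0 :> R by have := mR; lra.
set U := ET (fun f => #|S f|%:R ^+ 2) : R.
have cross : E (fun om => (\sum_(i in S om.1) share om i) * #|S om.1|%:R) = spread_prob /
  m%:R * U.
  transitivity (\sum_(i : V | (i < m)%N) E (fun om =>
     ((i \in S om.1)%:R * #|S om.1|%:R) * share om i)).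
    rewrite -Ex_sum; apply: eq_Ex => om _; rewrite mulr_suml big_mkcond [RHS]big_mkcond.
    apply: eq_bigr => i _; case: (boolP (i \in S om.1)) => [/S_lt->|_].
      by rewrite mul1r mulrC.
    by case: ifP; rewrite ?mul0r.
  transitivity (\sum_(i : V | (i < m)%N) ET (fun f => (i \in S f)%:R * #|S f|%:R) *
    (spread_prob / m%:R)).
    apply: eq_bigr => i im.
    rewrite (@Ex_indep_below _ _ _ m (fun f => (i \in S f)%:R * #|S f|%:R) (share^~ i)).
    - by congr (_ * _); rewrite -(Ex_share1 im) mulrC mulKf.
    - by move=> f g rf rg fg; rewrite (S_local rf rg fg).
    - by move=> f g G rf rg fg; apply: share_local.
  rewrite -mulr_suml mulrC; congr (_ * _); rewrite -Ex_sum; apply: eq_Ex => f _.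
  by rewrite -mulr_suml sum_mem_card.
have sq : E (fun om => (spread om)%:R * #|S om.1|%:R ^+ 2) = spread_prob * U.
  transitivity (E (fun om => #|S om.1|%:R ^+ 2 * (spread om)%:R)).
    by apply: eq_Ex => om _; rewrite mulrC.
  rewrite (@Ex_indep_below _ _ _ m (fun f => #|S f|%:R ^+ 2) (fun om => (spread om)%:R)).
  - by rewrite mulrC.
  - by move=> f g rf rg fg; rewrite (S_local rf rg fg).
  - move=> f g G rf rg fg.
    exact: (congr1 (fun b : bool => b%:R) (spread_local G rf rg fg)).
have -> : E (fun om => (\sum_(i in S om.1) share om i -
      (spread om)%:R * (#|S om.1|%:R / m%:R)) ^+ 2) =
   E (fun om => (\sum_(i in S om.1) share om i) ^+ 2) - 2 / m%:R * (spread_prob / m%:R * U) +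
   (m%:R ^+ 2)^-1 * (spread_prob * U).
  rewrite -cross -sq -!ExZ -ExB -ExD; apply: eq_Ex => om _.
  rewrite /share -!mulr_sumr; case: (spread om);
    last by rewrite !mul0r subrr expr0n /= !mulr0 subrr addr0.
  by rewrite !mul1r; field.
rewrite Ex_sum_share2 -/U.
set T := ET _.
have T0 : 0 <= T := ET_cardS_ge0.
have Tm : T <= m%:R := ET_cardS_le.
have U0 : 0 <= U := ET_cardS2_ge0.
have Um : U <= m%:R ^+ 2 := ET_cardS2_le.
have share_crossE : share_cross = (spread_prob - m%:R * share_sqr) / (m%:R * (m%:R - 1)).
  by rewrite -share_momentsE; field; rewrite m1 m2.
have k1 : share_sqr * T <= q0.
  apply: le_trans (share_sqr_le q); rewrite mulrC.
  by apply: ler_wpM2r => //; apply: share_sqr_ge0.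
have k2 : 0 <= share_cross * T by rewrite mulr_ge0 ?share_cross_ge0.
have k3 : share_cross * U <= spread_prob / (m%:R * (m%:R - 1)) * U.
  apply: ler_wpM2r => //; rewrite share_crossE ler_wpM2r ?invr_ge0 ?mulr_ge0 //;
    first by have := mR; lra.
  by rewrite gerBl mulr_ge0 // share_sqr_ge0.
have k4 : spread_prob / (m%:R * (m%:R - 1)) * U - (m%:R ^+ 2)^-1 * (spread_prob * U) <=
  (m%:R - 1)^-1.
  have -> : spread_prob / (m%:R * (m%:R - 1)) * U - (m%:R ^+ 2)^-1 * (spread_prob * U) =
     spread_prob * (U / m%:R ^+ 2) * (m%:R - 1)^-1 by field; rewrite m1 m2.
  rewrite -[leRHS]mul1r ler_wpM2r ?invr_ge0 //; first by have := mR; lra.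
  rewrite mulr_ile1 ?spread_prob_ge0 ?spread_prob_le1 ?divr_ge0 ?exprn_ge0 //.
  by rewrite ler_pdivrMr ?mul1r // exprn_gt0 //; have := mR; lra.
have -> : 2 / m%:R * (spread_prob / m%:R * U) = 2 * ((m%:R ^+ 2)^-1 * (spread_prob * U)) by
  field.
by move: k1 k2 k3 k4; rewrite mulrBr; lra.
Qed.

End RandomSet.
End Exchangeable.

(** * Tail bounds for numbers of children *)

Section Harmonic.
Variable R : realType.

Definition harmonic (s s' : nat) : R := \sum_(s <= t < s') t%:R^-1.

Lemma harmonic_ge0 s s' : 0 <= harmonic s s'.
Proof. by apply: sumr_ge0 => t _; rewrite invr_ge0 ler0n. Qed.

Lemma harmonic_ge s s' : (0 < s <= s')%N -> ln s'%:R - ln s%:R <= harmonic s s'.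
Proof.
move=> /andP[s0]; elim: s' => [|t IH]; first by rewrite leqn0; lia.
rewrite leq_eqVlt => /orP[/eqP <-|st]; first by rewrite subrr harmonic_ge0.
have t0 : 0 < t%:R :> R by rewrite ltr0n; lia.
rewrite /harmonic big_nat_recr //= -/(harmonic s t).
have : ln (t.+1%:R : R) <= ln t%:R + t%:R^-1.
  rewrite -natr1 (_ : t%:R + 1 = t%:R * (1 + t%:R^-1)); last by field; rewrite gt_eqF.
  rewrite lnM ?posrE // ?addr_gt0 ?invr_gt0 // lerD2l le_ln1Dx //.
  by apply: lt_trans (_ : 0 < t%:R^-1); rewrite ?invr_gt0 // ltrN10.
have := IH st; lra.
Qed.

Lemma harmonic_le s s' : (0 < s <= s')%N -> harmonic s s' <= 1 + ln s'%:R - ln s%:R.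
Proof.
move=> /andP[s0]; rewrite leq_eqVlt => /orP[/eqP <-|].
  by rewrite /harmonic big_geq // addrK.
case: s' => // s'; rewrite ltnS => ss.
have {}ss : harmonic s s'.+1 <= 1 + ln s'%:R - ln s%:R.
  elim: s' ss => [|t IH]; first by rewrite leqn0; lia.
  rewrite leq_eqVlt => /orP[/eqP <-|st].
    by rewrite /harmonic big_nat1 addrK invf_le1 ?ltr0n // ler1n.
  have t0 : 0 < t%:R :> R by rewrite ltr0n; lia.
  rewrite /harmonic big_nat_recr /=; last by lia.
  rewrite -/(harmonic s t.+1); have := IH st.
  have : ln (t%:R : R) <= ln t.+1%:R - t.+1%:R^-1.
    have t1 : t.+1%:R^-1 < 1 :> R by rewrite invf_lt1 ?ltr0n // ltr1n; lia.
    have -> : t%:R = t.+1%:R * (1 - t.+1%:R^-1) :> R.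
      by rewrite mulrBr mulr1 divff ?pnatr_eq0 // -natr1 addrK.
    rewrite lnM ?posrE ?ltr0n ?subr_gt0 // lerD2l le_ln1Dx //.
    by rewrite ltrN2.
  move: (t.+1%:R^-1) => z; lra.
apply: le_trans ss _; rewrite lerD2r lerD2l; have [->|s'0] := posnP s'.
  by rewrite ln0 // ln1.
by rewrite ler_ln ?posrE ?ltr0n // ler_nat.
Qed.

Lemma sum_ord_range n (F : nat -> R) s s' : (s' <= n)%N ->
  \sum_(t < n | (s <= t < s')%N) F t = \sum_(s <= t < s') F t.
Proof.
move=> sn; rewrite (big_nat_widenl _ 0) // (big_nat_widen _ _ n) // big_mkord.
by apply: eq_bigl => t.
Qed.

Lemma one_plus_sum_le (I : finType) (P : pred I) (a : I -> R) :
  1 + \sum_(i | P i) a i <= \prod_(i | P i) expR (a i).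
Proof. by rewrite -expR_sum expR_ge1Dx. Qed.

End Harmonic.

Section TailBounds.
Variables (R : realType) (n : nat).
Local Notation V := 'I_n.+1.
Implicit Types (f g : {ffun V -> V}) (a b u v : V) (h x : R).

Lemma parent_prob_lt (v j : V) : (0 < v)%N -> (j < v)%N -> parent_prob R v j = v%:R^-1.
Proof. by move=> v0 jv; rewrite /parent_prob ifN ?jv ?mul1r // -lt0n. Qed.

Lemma sum_parent_prob_indic (c : bool) (t a : V) x :
  \sum_j parent_prob R t j * (if c && (j == a) then x else 1) =
  1 + (if c then (x - 1) * parent_prob R t a else 0).
Proof.
rewrite -[X in X + _](parent_prob_sum1 R t) (bigD1 a) //= [in RHS](bigD1 a) //= eqxx andbT.
rewrite (eq_bigr (fun j => parent_prob R t j)); last first.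
  by move=> j /negPf->; rewrite andbF mulr1.
by case: c; ring.
Qed.

Definition nchildren_in (s s' : nat) f a := #|[set t : V | (s <= t < s')%N & f t == a]|.

Lemma ET_nchildren_le s s' a h : (a < s <= s')%N -> (s' <= n.+1)%N -> 0 <= h <= 1 ->
  ET (fun f => (1 - h) ^+ nchildren_in s s' f a) <= expR (- (h * (ln s'%:R - ln s%:R))).
Proof.
move=> /andP[as_ ss] sn /andP[h0 h1].
have -> : ET (fun f => (1 - h) ^+ nchildren_in s s' f a) = ET (fun f => \prod_(t : V)
    (if (s <= t < s')%N && (f t == a) then 1 - h else 1)).
  by apply: eq_Ex => f _; rewrite -big_mkcond prodr_const /nchildren_in cardsE.
rewrite /ET (Ex_prod _ (fun t j : V => if (s <= t < s')%N && (j == a) then 1 - h else 1)).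
under eq_bigr do rewrite sum_parent_prob_indic.
apply: (@le_trans _ _ (\prod_(t : V) expR (if (s <= t < s')%N then - h * t%:R^-1 else 0))).
  apply: ler_prod => t _; case: ifP => [/andP[st _]|_];
    last by rewrite addr0 expR0 ler01 lexx.
  rewrite parent_prob_lt; [|lia|lia].
  have -> : 1 - h - 1 = - h by ring.
  rewrite expR_ge1Dx andbT mulNr subr_ge0 -[leRHS]mul1r ler_pM ?invr_ge0 ?ler0n //.
  by rewrite invf_le1 ?ltr0n ?ler1n; lia.
rewrite -expR_sum ler_expR -big_mkcond /= -mulr_sumr (sum_ord_range (fun t => t%:R^-1)) //.
rewrite mulNr lerN2 ler_wpM2l // harmonic_ge //; lia.
Qed.

(** Chernoff bound for the lower tail, from the generating function at 1 - h. *)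
Lemma PT_nchildren_lt s s' a h k : (a < s <= s')%N -> (s' <= n.+1)%N -> 0 <= h < 1 ->
  Pr (@parent_pmf R n) (fun f => (nchildren_in s s' f a < k)%N) <=
  (1 - h) ^- k * expR (- (h * (ln s'%:R - ln s%:R))).
Proof.
move=> ass sn /andP[h0 h1].
have x0 : 0 < 1 - h by rewrite subr_gt0.
apply: (@le_trans _ _ ((1 - h) ^- k * ET (fun f => (1 - h) ^+ nchildren_in s s' f a))).
  rewrite -ExZ; apply: le_ET => f _; case: ltnP => [ck|_]; last first.
    by apply: mulr_ge0; rewrite ?invr_ge0; apply: exprn_ge0; exact: ltW.
  rewrite mulrC -ler_pdivrMr ?invr_gt0 ?exprn_gt0 // invrK mul1r.
  by apply: ler_wiXn2l; rewrite ?(ltW x0) ?gerBl ?(ltnW ck).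
by rewrite ler_wpM2l ?invr_ge0 ?exprn_ge0 ?(ltW x0) // ET_nchildren_le // h0 ltW.
Qed.

Lemma nchildrenE f v : nchildren f v = nchildren_in v.+1 n.+1 f v.
Proof. by apply: eq_card => u; rewrite !inE ltn_ord andbT. Qed.

(* Distinct vertices compete for children, so their numbers of children are
   negatively correlated: the joint generating function is at most the
   product of the marginal bounds. *)
Lemma ET_gf_le (B : {set V}) (c : bool) v h : 0 <= h ->
  (c -> forall b, b \in B -> (v < b)%N) ->
  ET (fun f => \prod_(b in B) ((if c then (f b == v)%:R else 1) * (1 + h) ^+ nchildren f
    b)) <=
  \prod_(b in B) ((if c then b%:R^-1 else 1) * expR (h * harmonic R b.+1 n.+1)).
Proof.
move=> h0 vB.
have vNB : c -> v \notin B by move=> hc; apply/negP => /(vB hc); rewrite ltnn.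
pose phi (t j : V) : R := (if c && (t \in B) then (j == v)%:R else 1) *
   \prod_(b in B) (if (b < t)%N && (j == b) then 1 + h else 1).
have -> : ET (fun f => \prod_(b in B) ((if c then (f b == v)%:R else 1) * (1 + h) ^+
  nchildren f b)) =
    ET (fun f => \prod_t phi t (f t)).
  apply: eq_Ex => f _; rewrite !big_split /=; congr (_ * _).
    rewrite big_mkcond; apply: eq_bigr => t _; case: c {vB vNB phi} => //=; by case: ifP.
  rewrite exchange_big /=; apply: eq_bigr => b _.
  by rewrite -big_mkcond prodr_const /nchildren /children cardsE.
rewrite /ET (Ex_prod _ phi).
apply: (@le_trans _ _ (\prod_(t : V) ((if c && (t \in B) then t%:R^-1 else 1) *
    \prod_(b in B) expR (if (b < t)%N then h * t%:R^-1 else 0)))).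
  apply: ler_prod => t _; apply/andP; split.
    apply: sumr_ge0 => j _; rewrite !mulr_ge0 ?parent_prob_ge0 //; first by case: ifP.
    by apply: prodr_ge0 => b _; case: ifP; rewrite ?addr_ge0.
  (* If [c] holds and [t] is in [B], its parent is forced to be [v], which is not in [B]: the factor
     is 1/t and no vertex of [B] gains a child. *)
  rewrite /phi; case: ifP => [/andP[hc tB]|_].
    rewrite (bigD1 v) //= eqxx [X in _ + X]big1 ?addr0; last first.
      by move=> j /negPf ->; rewrite mul0r mulr0.
    rewrite big1 ?mulr1; last first.
      by move=> b bB; case: eqP => [vb|]; rewrite ?andbF //; move: (vNB hc); rewrite vb bB.
    have vt := vB hc _ tB.
    rewrite parent_prob_lt //; last by lia.
    rewrite -[leLHS]mulr1 ler_wpM2l ?invr_ge0 ?ler0n //.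
    rewrite -expR_sum -[leLHS]expR0 ler_expR; apply: sumr_ge0 => b _.
    by case: ifP; rewrite ?mulr_ge0 ?invr_ge0.
  rewrite mul1r.
  (* A vertex has a single parent, so at most one factor differs from 1. The resulting 1 + sum is
     dominated by a product of exponentials, which is the negative correlation. *)
  have E j : \prod_(b in B) (if (b < t)%N && (j == b) then 1 + h else 1) =
      1 + h * ((j \in B) && (j < t)%N)%:R.
    case: (boolP (j \in B)) => jB; last first.
      rewrite mulr0 addr0 big1 // => b bB; case: eqP => [jb|]; last by rewrite andbF.
      by rewrite jb bB in jB.
    rewrite (bigD1 j) //= eqxx andbT big1 ?mulr1; last first.
      by move=> b /andP[_ /negPf bj]; rewrite eq_sym bj andbF.
    by case: ifP; rewrite ?mulr1 ?mulr0 ?addr0.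
  rewrite (eq_bigr (fun j => parent_prob R t j + parent_prob R t j * (h * ((j \in B) && (j
    < t)%N)%:R))); last first.
    by move=> j _; rewrite E ?mul1r mulrDr mulr1.
  rewrite big_split /= parent_prob_sum1.
  apply: le_trans (one_plus_sum_le _ _); rewrite lerD2l.
  rewrite [leRHS]big_mkcond; apply: ler_sum => j _ /=.
  case: (boolP (j \in B)) => jB /=; last by rewrite !mulr0.
  case: ltnP => jt; last by rewrite !mulr0.
  by rewrite mulr1 (parent_prob_lt (leq_ltn_trans (leq0n j) jt) jt) mulrC.
rewrite !big_split /= exchange_big /= -big_mkcondl /=.
rewrite le_eqVlt; apply/orP; left; apply/eqP; congr (_ * _).
  case: c {vB vNB phi} => /=; last by rewrite !big1 // => *; case: ifP.
  by apply: eq_bigl => b; rewrite andbT.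
apply: eq_bigr => b _; rewrite -expR_sum -big_mkcond /= -mulr_sumr; congr (expR (_ * _)).
rewrite /harmonic -(sum_ord_range _ _ (leqnn n.+1)); apply: eq_bigl => t.
by rewrite ltn_ord andbT.
Qed.

End TailBounds.

(** * High degrees, high children and early core vertices in the tree *)

Section TreeEvents.
Variables (R : realType) (n : nat).
Local Notation V := 'I_n.+1.
Local Notation N := n.+1.
Local Notation L := (ln (n.+1%:R : R)).
Local Notation PT := (Pr (@parent_pmf R n)).
Implicit Types (f g : {ffun V -> V}) (a b u v : V) (h x y : R).

Lemma lnN_ge0 : 0 <= L. Proof. by rewrite ln_ge0 // ler1n. Qed.

Lemma harmonic1_le s : (s <= N)%N -> harmonic R 1 s <= 1 + L.
Proof.
case: s => [|s] sN; first by rewrite /harmonic big_geq // addr_ge0 // lnN_ge0.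
apply: le_trans (harmonic_le _ _) _; first by [].
by rewrite ln1 subr0 lerD2l ler_ln ?posrE ?ltr0n // ler_nat.
Qed.

Lemma harmonic_sub s1 s2 s3 : (s1 <= s2)%N -> harmonic R s2 s3 <= harmonic R s1 s3.
Proof.
move=> s12; have [s23|s32] := leqP s2 s3; last by rewrite {1}/harmonic big_geq
  ?harmonic_ge0 // ltnW.
by rewrite /harmonic (big_cat_nat s12 s23) /= lerDr harmonic_ge0.
Qed.

Lemma sum_inv_succ s : (s <= N)%N -> \sum_(u : V | (u < s)%N) (u.+1%:R)^-1 <= 2 + L.
Proof.
move=> sN; have -> : \sum_(u : V | (u < s)%N) (u.+1%:R)^-1 = harmonic R 1 s.+1.
  by rewrite /harmonic big_add1 -(sum_ord_range (fun u : nat => u.+1%:R^-1) 0 sN).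
case: s => [|s] in sN *; first by rewrite /harmonic big_geq // addr_ge0 // lnN_ge0.
rewrite /harmonic big_nat_recr //= -/(harmonic _ _ _) addrC (_ : 2 + L = 1 + (1 + L));
  last by ring.
by apply: lerD; [rewrite invf_le1 ?ltr0n // ler1n|apply: harmonic1_le].
Qed.

Section ManyHighChildren.
Variable h : R.
Hypothesis h0 : 0 <= h.

Lemma sum_subsets (W : {set V}) (a : V -> R) :
  \sum_(B : {set V} | B \subset W) \prod_(b in B) a b = \prod_(b in W) (1 + a b).
Proof.
rewrite [RHS]big_mkcond /=.
rewrite (eq_bigr (fun b => (if b \in W then a b else 0) + 1)); last first.
  by move=> b _; case: ifP; rewrite ?add0r // addrC.
rewrite bigA_distr [RHS](bigID (fun B : {set V} => B \subset W)) /= [X in _ = _ + X]big1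
  ?addr0; last first.
  move=> B /fintype.subsetPn[b bB bW]; by rewrite (bigD1 b) //= bB (negPf bW) mul0r.
apply: eq_bigr => B /fintype.subsetP BW; rewrite big_mkcond; apply: eq_bigr => b _.
by case: ifP => // /BW ->.
Qed.

(** Bounds the expected number of high children of a vertex born at [m] or later: a later vertex b
    is a child with probability 1/b, with total at most 1 + L, and the other factors are the
    Chernoff bound at 1 + h for b to have [d] children. *)
Definition high_child_rate (d m : nat) h :=
  (1 + L) * (expR (h * (1 + L - ln m%:R)) * (1 + h) ^- d).

(** A set [B] of possible children is given the weight G^(jj - #|B|). On the event, the set of all
    high children contributes at least 1. Summed over all [B] the expectations form a product of
    factors 1 + a b, bounded by the exponential of a sum that is at most 1. *)
Lemma PT_high_children d2 m jj v : (0 < m <= v)%N ->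
  0 < high_child_rate d2 m h <= 1 ->
  PT (fun f => (jj <= #|[set b in children f v | (d2 <= nchildren f b)%N]|)%N) <=
  expR 1 * high_child_rate d2 m h ^+ jj.
Proof.
move=> /andP[m0 mv] /andP[G0 G1]; set G := high_child_rate _ _ _ in G0 G1 *.
have h1 : 0 < 1 + h by rewrite ltr_wpDr.
pose W := [set b : V | (v < b)%N].
pose a b : R := G^-1 * (1 + h) ^- d2 * ((b%:R)^-1 * expR (h * harmonic R b.+1 N)).
have a0 b : 0 <= a b by rewrite !mulr_ge0 ?invr_ge0 ?expR_ge0 ?ler0n ?exprn_ge0 ?(ltW G0)
  ?(ltW h1).
apply: (@le_trans _ _ (G ^+ jj * \sum_(B : {set V} | B \subset W) \prod_(b in B) a b)).
  apply: (@le_trans _ _ (ET (fun f => \sum_(B : {set V} | B \subset W) (G ^+ jj *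
     (\prod_(b in B) (G^-1 * (1 + h) ^- d2) *
      \prod_(b in B) ((if true then (f b == v)%:R else 1) * (1 + h) ^+ nchildren f b)))))).
    have term_ge0 f (B : {set V}) : 0 <= G ^+ jj * (\prod_(b in B) (G^-1 * (1 + h) ^- d2) *
       \prod_(b in B) ((if true then (f b == v)%:R else 1) * (1 + h) ^+ nchildren f b)).
      apply: mulr_ge0; first by rewrite exprn_ge0 // ltW.
      apply: mulr_ge0; apply: prodr_ge0 => b _; apply: mulr_ge0 => //.
      - by rewrite invr_ge0 ltW.
      - by rewrite invr_ge0 exprn_ge0 // ltW.
      - by rewrite exprn_ge0 // ltW.
    apply: le_ET => f rf; case: leqP => [jB|_]; last first.
      by apply: sumr_ge0 => B _; apply: term_ge0.
    set B0 := [set b in children f v | _] in jB.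
    rewrite (bigD1 B0) /=; last by apply/fintype.subsetP => b;
      rewrite !inE => /andP[/andP[->]].
    rewrite -[leLHS]addr0; apply: lerD; last first.
      by apply: sumr_ge0 => B _; apply: term_ge0.
    rewrite -big_split /=.
    apply: (@le_trans _ _ (G ^+ jj * \prod_(b in B0) G^-1)).
      rewrite prodr_const exprVn -(subnKC jB) exprD invfM mulVKf ?expf_neq0 ?gt_eqF //.
      by rewrite invf_ge1 ?exprn_gt0 // exprn_ile1 // ltW.
    rewrite ler_wpM2l ?exprn_ge0 ?(ltW G0) ?(ltW h1) //; apply: ler_prod => b.
    rewrite inE => /andP[]; rewrite inE => /andP[_ /eqP->] db.
    rewrite invr_ge0 ltW //= eqxx mul1r -[leLHS]mulr1 -mulrA ler_wpM2l ?invr_ge0 ?(ltW G0) //.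
    by rewrite [_^-1 * _]mulrC ler_pdivlMr ?exprn_gt0 // mul1r ler_weXn2l // lerDl.
  rewrite /ET Ex_sum mulr_sumr; apply: ler_sum => B /fintype.subsetP BW.
  rewrite ExZ ler_wpM2l ?exprn_ge0 ?(ltW G0) ?(ltW h1) // ExZ.
  rewrite /a [leRHS]big_split /= ler_wpM2l //.
    by apply: prodr_ge0 => b _; rewrite mulr_ge0 ?invr_ge0 ?exprn_ge0 ?(ltW G0) ?(ltW h1).
  apply: (ET_gf_le h0 (c := true)) => _ b /BW; by rewrite inE.
rewrite sum_subsets mulrC ler_wpM2r ?exprn_ge0 ?(ltW G0) ?(ltW h1) //.
apply: (@le_trans _ _ (\prod_(b in W) expR (a b))).
  by apply: ler_prod => b _; rewrite addr_ge0 //= expR_ge1Dx.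
rewrite -expR_sum ler_expR /a -mulr_sumr.
rewrite -mulrA mulrC ler_pdivrMr // mul1r.
apply: (@le_trans _ _ ((1 + h) ^- d2 * \sum_(b in W) b%:R^-1 * expR (h * (1 + L - ln m%:R)))).
  rewrite ler_wpM2l ?invr_ge0 ?exprn_ge0 ?(ltW G0) ?(ltW h1) //; apply: ler_sum => b;
    rewrite inE => vb.
  rewrite ler_wpM2l ?invr_ge0 ?ler0n // ler_expR ler_wpM2l //.
  apply: le_trans (harmonic_le _ _) _; first by have := ltn_ord b; lia.
  by rewrite lerD2l lerN2 ler_ln ?posrE ?ltr0n // ler_nat; lia.
rewrite -mulr_suml mulrC -mulrA /G /high_child_rate.
rewrite ler_wpM2r ?mulr_ge0 ?expR_ge0 ?invr_ge0 ?exprn_ge0 ?(ltW h1) //.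
apply: le_trans (harmonic1_le (leqnn N)).
apply: (@le_trans _ _ (harmonic R v.+1 N)); last exact: harmonic_sub.
rewrite /harmonic -(sum_ord_range _ _ (leqnn N)) le_eqVlt; apply/orP; left; apply/eqP.
by apply: eq_bigl => b; rewrite inE ltn_ord andbT.
Qed.

End ManyHighChildren.

Lemma PT_late_core d2 m jj h : 0 <= h -> (0 < m)%N ->
  0 < high_child_rate d2 m h <= 1 ->
  PT (fun f => [exists v : V, (m <= v)%N &&
      (jj <= #|[set b in children f v | (d2 <= nchildren f b)%N]|)%N]) <=
  N%:R * (expR 1 * high_child_rate d2 m h ^+ jj).
Proof.
move=> h0 m0 G01; have G0 : 0 <= expR 1 * high_child_rate d2 m h ^+ jj.
  by rewrite mulr_ge0 ?expR_ge0 // exprn_ge0 // ltW //; case/andP: G01.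
apply: le_trans (Pr_union (@parent_pmf_ge0 R n) (fun v : V => m <= v)%N _) _.
apply: (@le_trans _ _ (\sum_(v : V | (m <= v)%N) (expR 1 * high_child_rate d2 m h ^+ jj))).
  by apply: ler_sum => v mv; apply: PT_high_children => //; rewrite m0.
rewrite sumr_const -[leLHS]mulr_natl ler_wpM2r // ler_nat.
by rewrite -[leqRHS](card_ord N) max_card.
Qed.

(* The vertex [a] acquires from time [s] on enough children, those born before
   [s'] being themselves of high degree, to be in the core. *)
Definition robust (d jj s s' : nat) f a :=
  (d <= nchildren_in s N f a)%N &&
  (jj <= #|[set t : V | [&& (s <= t < s')%N, f t == a & (d <= nchildren f t)%N]]|)%N.

(** This is why children are counted from time [s] on: robustness is independent of the tree on the
    first [s] vertices, in particular of the number of descendants there. *)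
Lemma robust_local d jj s s' f g a : (0 < s)%N -> recursive f -> recursive g ->
  (forall t : V, (s <= t)%N -> f t = g t) -> robust d jj s s' f a = robust d jj s s' g a.
Proof.
move=> s0 rf rg fg; have chE (t : V) : (s <= t)%N -> nchildren f t = nchildren g t.
  move=> st; apply: eq_card => u; rewrite !inE; case: ltnP => //= tu.
  by rewrite fg //; lia.
rewrite /robust; congr (_ && _); congr (_ <= _)%N; apply: eq_card => t; rewrite !inE.
  by case: (leqP s t) => //= st; rewrite fg.
by case: (leqP s t) => //= st; rewrite fg // chE.
Qed.

Lemma robust_core d jj s s' f a G : (a < s)%N -> robust d jj s s' f a ->
  core d jj (noisy f G) a.
Proof.
move=> as_ /andP[dc jc]; apply: core_ge.
  apply: leq_trans dc _; rewrite nchildrenE; apply: subset_leq_card.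
  by apply/fintype.subsetP => t; rewrite !inE; lia.
apply: leq_trans jc _; apply: subset_leq_card; apply/fintype.subsetP => t; rewrite !inE.
by move=> /and3P[/andP[st _] -> ->]; rewrite !andbT; lia.
Qed.

(** First term: too few later children, for the vertex itself or for one of its children born
    between [s] and [s'], of which at most 1 + L are expected. Second term: fewer than [jj] children
    born in that interval, by the Chernoff bound with h = 1/2. *)
Definition fragile_bound (d jj s s' : nat) h :=
  (2 + L) * ((1 - h) ^- d * expR (- (h * (L - ln s'%:R)))) +
  2 ^+ jj * expR (- ((ln s'%:R - ln s%:R) / 2)).

Lemma PT_fragile d jj s s' h a : (a < s <= s')%N -> (s' <= N)%N -> 0 <= h < 1 ->
  PT (fun f => ~~ robust d jj s s' f a) <= fragile_bound d jj s s' h.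
Proof.
move=> /andP[as_ ss] sN h01; have /andP[h0 h1] := h01.
have s0 : (0 < s)%N by lia.
have x0 : 0 < 1 - h by rewrite subr_gt0.
set c := (1 - h) ^- d * expR (- (h * (L - ln s'%:R))).
have c0 : 0 <= c by rewrite mulr_ge0 ?expR_ge0 ?invr_ge0 ?exprn_ge0 // ltW.
have tail s1 b : (b < s1 <= s')%N -> PT (fun f => (nchildren_in s1 N f b < d)%N) <= c.
  move=> bs; apply: le_trans (PT_nchildren_lt _ _ _ h01) _ => //; first by lia.
  rewrite ler_wpM2l ?invr_ge0 ?exprn_ge0 ?(ltW x0) // ler_expR lerN2 ler_wpM2l //.
  by rewrite lerD2l lerN2 ler_ln ?posrE ?ltr0n ?ler_nat; lia.
apply: (@le_trans _ _ (PT (fun f => (nchildren_in s N f a < d)%N || ((nchildren_in s s' f a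
  < jj)%N ||
   [exists t : V, (s <= t < s')%N && ((f t == a) && (nchildren f t < d)%N)])))).
  apply: (le_Pr (@parent_pmf_ge0 R n)) => f _; rewrite /robust negb_and -!ltnNge.
  case/orP => [->//|jc]; apply/orP; right.
  case: (boolP [exists t, _]) => [_|/existsPn H]; first by rewrite orbT.
  rewrite orbF; apply: leq_trans jc; rewrite ltnS; apply: subset_leq_card.
  apply/fintype.subsetP => t; rewrite !inE => /andP[st /eqP fta]; rewrite st fta eqxx /=.
  by have := H t; rewrite st fta eqxx /= -leqNgt.
apply: le_trans (Pr_or (@parent_pmf_ge0 R n) _ _) _.
rewrite /fragile_bound -/c (_ : 2 + L = 1 + (1 + L)); last by ring.
rewrite mulrDl mul1r -addrA; apply: lerD; first by apply: tail; rewrite as_.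
apply: le_trans (Pr_or (@parent_pmf_ge0 R n) _ _) _; rewrite [leLHS]addrC; apply: lerD;
  last first.
  apply: le_trans (PT_nchildren_lt (h := 2^-1) _ _ _ _) _; [by rewrite as_|by []|lra|].
  rewrite (_ : 1 - 2^-1 = 2^-1); last by lra.
  by rewrite exprVn invrK mulrC [2^-1 * _]mulrC mulrC.
apply: le_trans (Pr_union (@parent_pmf_ge0 R n) _ _) _.
apply: (@le_trans _ _ (\sum_(t : V | (s <= t < s')%N) t%:R^-1 * c)).
  apply: ler_sum => t /andP[st ts].
  (* The parent of [t] is the coordinate [t], while its children depend on later coordinates
     only. *)
  have -> : PT (fun f => (f t == a) && (nchildren f t < d)%N) =
     PT (fun f => f t == a) * PT (fun f => (nchildren f t < d)%N).
    rewrite /Pr -(Ex_indep (@parent_prob_sum1 R n) (D := fun u : V => (t < u)%N)).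
    - by apply: eq_Ex => f _; case: (f t == a); rewrite ?mul1r ?mul0r.
    - by move=> f g _ _ fg; rewrite fg // ltnn.
    - move=> f g _ _ fg; rewrite /nchildren (_ : children f t = children g t) //.
      by apply/setP => u; rewrite !inE; case: ltnP => //= tu; rewrite fg.
  have -> : PT (fun f => f t == a) = t%:R^-1.
    rewrite /Pr (Ex_marginal (@parent_prob_sum1 R n) t (fun j => (j == a)%:R)) (bigD1 a)
      //= eqxx.
    rewrite big1 ?addr0 ?mulr1 ?parent_prob_lt //; [lia|lia|].
    by move=> j /negPf->; rewrite mulr0.
  rewrite ler_wpM2l ?invr_ge0 ?ler0n //.
  have -> : PT (fun f => (nchildren f t < d)%N) = PT (fun f => (nchildren_in t.+1 N f t <
    d)%N).
    by apply: eq_Ex => f _; rewrite nchildrenE.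
  by apply: tail; rewrite ltnSn.
rewrite -mulr_suml ler_wpM2r // (sum_ord_range (fun t : nat => t%:R^-1)) //.
by apply: le_trans (harmonic_sub _ s0) _; apply: harmonic1_le.
Qed.

Lemma PT_early_fragile d jj s s' h : (0 < s <= s')%N -> (s' <= N)%N -> 0 <= h < 1 ->
  PT (fun f => [exists a : V, (a < s)%N && ~~ robust d jj s s' f a]) <=
  s%:R * fragile_bound d jj s s' h.
Proof.
move=> /andP[s0 ss] sN h01.
apply: le_trans (Pr_union (@parent_pmf_ge0 R n) (fun a : V => a < s)%N _) _.
apply: (@le_trans _ _ (\sum_(a : V | (a < s)%N) fragile_bound d jj s s' h)).
  by apply: ler_sum => a as_; apply: PT_fragile => //; rewrite as_.
rewrite sumr_const -[leLHS]mulr_natl.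
by have := @card_ord_lt n s; rewrite cardsE => -> //; lia.
Qed.

(** For [s] too large for a union bound, each fragile vertex is charged with its descendants: [a]
    has s / (a + 1) of them below [s] in mean, independently of its robustness. Summing over [a]
    loses a proportion (2 + L) times [fragile_bound], and Markov's inequality concludes. *)
Lemma PT_few_robust d jj s s' h : (0 < s <= s')%N -> (s' <= N)%N -> 0 <= h < 1 ->
  PT (fun f => (s < 2 * #|[set u : V | (u < s)%N &
      [exists a, desc f a u && ~~ robust d jj s s' f a]]|)%N) <=
  2 * (2 + L) * fragile_bound d jj s s' h.
Proof.
move=> /andP[s0 ss] sN h01; have sN' : (s <= N)%N by lia.
have s0' : 0 < s%:R :> R by rewrite ltr0n.
pose X f : R := \sum_(a : V | (a < s)%N) (fringe a.+1 f a s)%:R * (~~ robust d jj s s' f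
  a)%:R.
have XU f : recursive f -> (#|[set u : V | (u < s)%N &
      [exists a, desc f a u && ~~ robust d jj s s' f a]]|)%:R <= X f.
  move=> rf; apply: (@le_trans _ _ ((\sum_(a : V | (a < s)%N && ~~ robust d jj s s' f a)
      fringe a.+1 f a s)%N%:R)).
    rewrite ler_nat; apply: (@leq_trans #|\bigcup_(a : V | (a < s)%N && ~~ robust d jj s s'
      f a)
       [set u : V | (u < s)%N & anc a.+1 f u == a]|).
      apply: subset_leq_card; apply/fintype.subsetP => u; rewrite inE.
      move=> /andP[us /existsP[a /andP[au ra]]]; apply/bigcupP; exists a.
        by rewrite ra andbT; apply: leq_ltn_trans us; apply: desc_le au.
      by rewrite inE us.
    elim/big_rec2: _ => [|a B k _ IH]; first by rewrite cards0.
    by apply: leq_trans (leq_card_setU _ _) _; rewrite leq_add2l.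
  rewrite natr_sum big_mkcondr /=; apply: ler_sum => a _.
  by case: ifP; rewrite ?mulr1 ?mulr0.
apply: (le_trans (Ex_markov (X := X) (c := s%:R / 2) (@parent_pmf_ge0 R n) _ _ _)).
- by rewrite divr_gt0.
- by move=> f _; apply: sumr_ge0 => a _; rewrite mulr_ge0 ?ler0n.
- move=> f; rewrite parent_pmf_neq0 => /XU XUf sU; apply: le_trans XUf.
  by rewrite ler_pdivrMr // -natrM ler_nat mulnC ltnW.
rewrite ler_pdivrMr ?divr_gt0 // /X Ex_sum.
apply: (@le_trans _ _ (\sum_(a : V | (a < s)%N) s%:R / a.+1%:R * fragile_bound d jj s s' h)).
  apply: ler_sum => a as_.
  rewrite (@Ex_indep _ _ _ _ (@parent_prob_sum1 R n) (fun u : V => (s <= u)%N)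
    (fun f => (fringe a.+1 f a s)%:R) (fun f => (~~ robust d jj s s' f a)%:R)).
  - rewrite -/(ET _) ET_fringe ?ltnSn ?as_ //.
    by rewrite ler_wpM2l ?divr_ge0 ?ler0n // PT_fragile // as_.
  - move=> f g; rewrite !parent_pmf_neq0 => rf rg fg;
    rewrite (@eq_fringe _ _ f g) // => v /andP[_ vs].
    by apply: fg; rewrite -ltnNge.
  - move=> f g; rewrite !parent_pmf_neq0 => rf rg fg.
    by rewrite (@robust_local _ _ _ _ f g).
rewrite -mulr_suml -mulr_sumr.
have F0 : 0 <= fragile_bound d jj s s' h.
  have x0 : 0 < 1 - h by case/andP: h01; rewrite subr_gt0.
  apply: addr_ge0; last by rewrite mulr_ge0 ?expR_ge0 // exprn_ge0.
  apply: mulr_ge0; first by rewrite addr_ge0 ?lnN_ge0.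
  by rewrite mulr_ge0 ?expR_ge0 // invr_ge0 exprn_ge0 // ltW.
have -> : 2 * (2 + L) * fragile_bound d jj s s' h * (s%:R / 2) =
   s%:R * (2 + L) * fragile_bound d jj s s' h by field.
by rewrite ler_wpM2r // ler_wpM2l ?sum_inv_succ // ltW.
Qed.

End TreeEvents.

(** * The root is a centroid on the good event *)

Section RootCentral.
Variables (R : realType) (n d j r m m' k : nat) (eta q0 w0 : R).
Local Notation V := 'I_n.+1.
Variables (f : {ffun V -> V}) (G : sgraph n.+1) (v1 : V).
Local Notation F := (noisy f G).
Local Notation C := (core d j F).
Local Notation A := (closed_up f C).
Local Notation W := (#|A|%:R : R).

Hypotheses (rf : recursive f) (m_gt1 : (1 < m)%N) (v1E : v1 = 1%N :> nat) (k0 : (0 < k)%N).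
Hypotheses (eta0 : 0 < eta) (w00 : 0 < w0) (q01 : q0 < 1) (q0eta : q0 < eta ^+ 2).
Hypothesis noise_deg : forall v, (deg G v <= r)%N.
Hypothesis noise_free : forall u v : V,
  u != v -> nearly_high f d r u -> nearly_high f d r v -> ~~ adj G u v.
Hypothesis early_core : forall v : V, (v < m)%N -> C v.
Hypothesis late_core : forall v : V, C v -> (v < m')%N.
Hypothesis large : w0 <= W.
Hypothesis fringes : \sum_i (fringe m f i m')%:R ^+ 2 <= q0 * w0 ^+ 2.

Definition below_desc v := [set i : V | (i < m)%N & desc f v i].
Local Notation S := below_desc.

Hypothesis small_share : forall v : V, (k <= v < m)%N ->
  \sum_(i in S v) share d j m q0 (f, G) i < eta.
Hypothesis half_share :
  eta <= \sum_(i in S v1) share d j m q0 (f, G) i <= 1 - eta.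

Let m0 : (0 < m)%N. Proof. exact: ltnW. Qed.
Let eE := crelE j rf noise_deg noise_free.
Let W0 : 0 < W. Proof. exact: lt_le_trans large. Qed.

Lemma core_tree_closed_up : core_tree d j m f G = A.
Proof. exact: core_treeE. Qed.

Let Y i : R := (fringe_mass d j m f G i)%:R.

Let Y_le i : Y i <= (fringe m f i m')%:R.
Proof.
rewrite ler_nat /fringe_mass core_tree_closed_up; apply: subset_leq_card;
  apply/fintype.subsetP => u.
rewrite finset.in_set => /andP[uA ui]; rewrite finset.in_set ui andbT.
by apply: late_core; apply: closed_up_C uA.
Qed.

Let sumY2 : \sum_i Y i ^+ 2 <= q0 * W ^+ 2.
Proof.
have q00 : 0 <= q0.
  rewrite -(pmulr_lge0 _ (exprn_gt0 2 w00)); apply: le_trans fringes.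
  by apply: sumr_ge0 => i _; rewrite exprn_ge0.
apply: (@le_trans _ _ (q0 * w0 ^+ 2)).
  apply: le_trans fringes; apply: ler_sum => i _.
  by rewrite lerXn2r ?nnegrE ?ler0n.
by rewrite ler_wpM2l // lerXn2r ?nnegrE ?(ltW w00) ?(ltW W0).
Qed.

Lemma spread_holds : spread d j m q0 (f, G).
Proof. by rewrite /spread /core_size /= core_tree_closed_up. Qed.

Lemma mass_share (v : V) : (v < m)%N ->
  (mass f C v)%:R = W * \sum_(i in S v) share d j m q0 (f, G) i.
Proof.
move=> vm; rewrite /share spread_holds /core_size /= core_tree_closed_up.
rewrite (eq_bigr (fun i => Y i / W)); last by move=> i _; rewrite mul1r.
rewrite -mulr_suml mulrC divfK ?gt_eqF //.
have -> : mass f C v = (\sum_(i | desc f v i) fringe_mass d j m f G i)%N.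
  rewrite sum_fringe_mass core_tree_closed_up; apply: eq_card => u;
    rewrite finset.in_set [in RHS]finset.in_set.
  by rewrite (desc_anc u rf vm).
rewrite natr_sum big_mkcond [RHS]big_mkcond; apply: eq_bigr => i _.
rewrite inE; case: ltnP => //= mi.
by rewrite fringe_mass_eq0 //; case: ifP.
Qed.

(** If [v] is born before [m], its share is small by hypothesis. Otherwise its descendants in [A]
    lie in a single fringe, whose squared mass is at most q0 W^2 < (eta W)^2. *)
Lemma mass_late (v : V) : (k <= v)%N -> (mass f C v)%:R < eta * W.
Proof.
move=> kv; have [vm|mv] := ltnP v m.
  by rewrite mass_share // mulrC ltr_pM2r // small_share // kv.
apply: (@le_lt_trans _ _ (Y (anc m f v))).
  rewrite ler_nat; apply: leq_trans (mass_fringe _ rf (m := m) _) _; first by rewrite m0.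
  by rewrite /fringe_mass core_tree_closed_up.
rewrite -(ltr_pXn2r (n := 2)) ?nnegrE ?ler0n ?mulr_ge0 ?(ltW eta0) ?(ltW W0) //.
apply: (@le_lt_trans _ _ (q0 * W ^+ 2)).
  apply: le_trans sumY2; rewrite (bigD1 (anc m f v)) //= lerDl.
  by apply: sumr_ge0 => i _; rewrite exprn_ge0.
by rewrite exprMn ltr_pM2r // exprn_gt0.
Qed.

Lemma root_in : ord0 \in A.
Proof. by apply/closed_upP => x /(desc_le rf) x0; apply: early_core;
  apply: leq_ltn_trans m0. Qed.

(** A core vertex outside the root component has its component inside one fringe, too small for
    [w0]. A late vertex of the root component has too heavy a branch towards its parent, since less
    than eta W lies below it. *)
Lemma central_early (v : V) : central d j (1 - eta) w0 F v -> (v < k)%N.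
Proof.
move=> /and3P[Cv wv /forallP H]; rewrite ltnNge; apply/negP => kv.
have vA : v \in A.
  apply: contraLR wv => vA; rewrite -ltNge.
  have Zle := comp_notin_closed_up rf eE m0 early_core late_core Cv vA.
  apply: (@le_lt_trans _ _ (fringe m f (anc m f v) m')%:R); first by rewrite ler_nat.
  rewrite -(ltr_pXn2r (n := 2)) ?nnegrE ?ler0n ?(ltW w00) //.
  apply: (@le_lt_trans _ _ (q0 * w0 ^+ 2)); last first.
    by rewrite -[ltRHS]mul1r ltr_pM2r // exprn_gt0.
  apply: le_trans fringes; rewrite (bigD1 (anc m f v)) //= lerDl.
  by apply: sumr_ge0 => i _; rewrite exprn_ge0.
have v0 : (0 < v)%N by apply: leq_trans kv.
have fA := closed_up_parent rf vA.
have vfv : crel d j F v (f v).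
  by rewrite eE adj_parent_tree recursive_neq // eqxx Cv (closed_up_C fA).
have := H (f v); rewrite vfv (comp_closed_up rf eE vA) /= => Hb.
have := card_branch_parent rf eE vA v0; rewrite -(ler_nat R) natrD => Hw.
by have := mass_late kv; lra.
Qed.

Lemma root_central : central d j (1 - eta) w0 F ord0.
Proof.
rewrite /central (comp_closed_up rf eE root_in) large early_core //=.
apply/forall_inP => u ru.
have := card_branch_root rf eE v1E root_in ru.
have mle : (mass f C v1 <= #|A|)%N.
  by apply: subset_leq_card; apply/fintype.subsetP => x; rewrite finset.in_set => /andP[].
have mE := @mass_share v1; rewrite v1E in mE; have {}mE := mE m_gt1.
have /andP[h1 h2] := half_share; have := W0.
rewrite leq_max => W0' /orP[]; rewrite -(ler_nat R) ?natrB // => /le_trans; apply.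
  by rewrite mE mulrC ler_wpM2r // ltW.
rewrite mE; have := ler_wpM2l (ltW W0') h1; lra.
Qed.

Lemma root_in_central_set : ord0 \in central_set d j k (1 - eta) w0 F.
Proof.
rewrite /central_set ifT; first by rewrite inE root_central.
have [kn|nk] := leqP k n.+1; last first.
  by apply: leq_trans (max_card _) _; rewrite card_ord ltnW.
rewrite -[leqRHS](card_ord_lt kn); apply: subset_leq_card; apply/fintype.subsetP => v.
rewrite !inE; exact: central_early.
Qed.

End RootCentral.

(** * Probability of the bad events *)

Section UrnEvents.
Variables (R : realType) (n : nat).
Local Notation V := 'I_n.+1.
Local Notation N := n.+1.
Local Notation L := (ln (n.+1%:R : R)).
Local Notation PT := (Pr (@parent_pmf R n)).

Lemma expR_harmonic_le (u : V) : expR (harmonic R u.+1 N) <= expR 1 * N%:R / u.+1%:R.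
Proof.
apply: (@le_trans _ _ (expR (1 + L - ln u.+1%:R))); last first.
  by rewrite expRD expRN expRD !lnK ?posrE.
by rewrite ler_expR; apply: harmonic_le; rewrite ltn_ord.
Qed.

(** Each of the [m] fringes has a mean square of order (m' / m)^2, so the sum is of order m'^2 / m;
    then Markov's inequality. *)
Lemma PT_fringes m m' (c : R) : (0 < m <= m')%N -> (m' <= N)%N -> 0 < c ->
  PT (fun f => c < \sum_i (fringe m f i m')%:R ^+ 2) <=
  2 * (m'%:R * (m'%:R + 1)) / (m%:R + 1) / c.
Proof.
move=> /andP[m0 mm] mN c0.
apply: le_trans (Ex_markov (X := fun f => \sum_i (fringe m f i m')%:R ^+ 2) (c := c)
  (@parent_pmf_ge0 R n) c0 _ _) _.
- by move=> f _; apply: sumr_ge0 => i _; rewrite exprn_ge0.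
- by move=> f _ /ltW.
rewrite ler_wpM2r ?invr_ge0 ?(ltW c0) // Ex_sum.
rewrite (bigID (fun i : V => (i < m)%N)) /= [X in _ + X]big1 ?addr0; last first.
  move=> i im; rewrite -[RHS](Ex_cst (parent_pmf_sum1 R n)); apply: eq_ET => f rf.
  rewrite (_ : fringe m f i m' = 0%N) ?expr0n //; apply/eqP.
  rewrite cards_eq0; apply/eqP/finset.setP => u; rewrite !finset.inE; apply/negP.
  by move=> /andP[_ /eqP E]; have := anc_lt u rf m0; rewrite E (negPf im).
apply: (@le_trans _ _ (\sum_(i : V | (i < m)%N) 2 * (m'%:R * (m'%:R + 1)) / (m%:R * (m%:R +
  1)))).
  apply: ler_sum => i im; rewrite -(ET_fringe2 (n := n) R im) ?mm //.
  by apply: le_ET => f _; rewrite expr2 ler_wpM2l // lerDl.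
rewrite sumr_const; have := @card_ord_lt n m; rewrite cardsE => ->; last by lia.
rewrite -[leLHS]mulr_natl le_eqVlt; apply/orP; left; apply/eqP; field.
by rewrite natr1 !pnatr_eq0; lia.
Qed.

Lemma PT_balanced (i : V) m K : (i < 2)%N -> (1 < m <= N)%N -> (K < m)%N ->
  PT (fun f => (fringe 2 f i m <= K)%N) <= K.+1%:R / (m%:R - 1).
Proof.
move=> i2 mN Km.
apply: (@le_trans _ _ (PT (fun f => [exists j : 'I_K.+1, xpredT j && (fringe 2 f i m ==
  j)]))).
  apply: (le_Pr (@parent_pmf_ge0 R n)) => f _ fK; apply/existsP.
  by exists (inord (fringe 2 f i m)); rewrite inordK ?eqxx.
apply: le_trans (Pr_union (@parent_pmf_ge0 R n) _ _) _.
apply: (@le_trans _ _ (\sum_(j < K.+1) (m%:R - 1)^-1)).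
  by apply: ler_sum => j _; apply: PT_fringe_uniform => //; have := ltn_ord j; lia.
by rewrite sumr_const card_ord -[leLHS]mulr_natl.
Qed.

End UrnEvents.

Section JointEvents.
Variables (R : realType) (n : nat) (p : R).
Hypothesis p01 : 0 <= p <= 1.
Local Notation V := 'I_n.+1.
Local Notation N := n.+1.
Local Notation L := (ln (n.+1%:R : R)).
Local Notation Om := ({ffun V -> V} * sgraph N)%type.
Local Notation PT := (Pr (@parent_pmf R n)).
Local Notation PJ := (Pr (@joint_pmf R n p)).
Implicit Types (om : Om) (f g : {ffun V -> V}) (G : sgraph N) (a b u v : V) (h x y : R).

Let p0 : 0 <= p. Proof. by case/andP: p01. Qed.

Lemma Pr_noise_deg (z : R) r : 1 <= z ->
  Pr (@er_pmf R N p) (fun G => [exists v, (r < deg G v)%N]) <=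
  N%:R * (expR (N%:R * p * (z - 1)) * z ^- r).
Proof.
move=> z1; have z0 : 0 < z by lra.
have erg0 G : 0 <= er_pmf p G by exact: er_ge0.
apply: le_trans (Pr_union erg0 xpredT (fun v G => r < deg G v)%N) _.
apply: (@le_trans _ _ (\sum_(v : V) expR (N%:R * p * (z - 1)) * z ^- r)); last first.
  by rewrite sumr_const card_ord -[leLHS]mulr_natl.
apply: ler_sum => v _.
apply: le_trans (Ex_markov (X := fun G => z ^+ deg G v) (c := z ^+ r) erg0 _ _ _) _.
- by rewrite exprn_gt0.
- by move=> G _; rewrite exprn_ge0 // ltW.
- by move=> G _ /ltnW rd; rewrite ler_weXn2l.
rewrite ler_wpM2r ?invr_ge0 ?exprn_ge0 ?(ltW z0) //.
apply: le_trans (EG_deg v p01 z1) _.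
rewrite -mulrA expRM_natl lerXn2r ?nnegrE ?expR_ge0 ?expR_ge1Dx //.
by rewrite addr_ge0 // mulr_ge0 // subr_ge0.
Qed.

(** Given the tree, each pair is a noise edge with probability [p]. Bounding the indicator of a high
    vertex by 2^(children - d2) makes the sum over pairs at most [p] times a square. *)
Lemma PJ_noise_between_high d2 :
  PJ (fun om => [exists uv : V * V, [&& uv.1 != uv.2, (d2 <= nchildren om.1 uv.1)%N,
     (d2 <= nchildren om.1 uv.2)%N & adj om.2 uv.1 uv.2]]) <=
  p * (expR 1 * N%:R * (2 + L) * 2 ^- d2) ^+ 2.
Proof.
apply: le_trans (Pr_union (fun om => joint_pmf_ge0 om p01) xpredT (fun (uv : V * V) om =>
  [&& uv.1 != uv.2, (d2 <= nchildren om.1 uv.1)%N, (d2 <= nchildren om.1 uv.2)%N & adj om.2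
    uv.1 uv.2])) _.
pose a u : R := 2 ^- d2 * (expR 1 * N%:R / u.+1%:R).
have a0 u : 0 <= a u by rewrite !mulr_ge0 ?expR_ge0 ?invr_ge0 ?exprn_ge0.
apply: (@le_trans _ _ (\sum_(uv : V * V) p * (a uv.1 * a uv.2))).
  apply: ler_sum => -[u v] _ /=.
  have [<-|uv] := eqVneq u v.
    rewrite /Pr /Ex big1; first by rewrite !mulr_ge0.
    by move=> om _; rewrite mulr0.
  rewrite /Pr Ex_joint.
  apply: (@le_trans _ _ (ET (fun f => p * (2 ^- d2 * 2 ^- d2 * (2 ^+ nchildren f u * 2 ^+
    nchildren f v))))).
    apply: le_ET => f _ /=; case: (leqP d2 (nchildren f u)) => [du|_] /=; last first.
      rewrite /Ex big1; first by rewrite !mulr_ge0 ?invr_ge0 ?exprn_ge0.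
      by move=> G _; rewrite mulr0.
    case: (leqP d2 (nchildren f v)) => [dv|_] /=; last first.
      rewrite /Ex big1; first by rewrite !mulr_ge0 ?invr_ge0 ?exprn_ge0.
      by move=> G _; rewrite mulr0.
    have -> : Ex (er_pmf p) (fun G => (adj G u v)%:R) = p.
      by apply: EG_edge => //; rewrite cards2 uv.
    rewrite -[leLHS]mulr1 ler_wpM2l // mulrACA.
    have one w : (d2 <= nchildren f w)%N -> 1 <= 2 ^- d2 * 2 ^+ nchildren f w :> R.
      by move=> dw; rewrite mulrC ler_pdivlMr ?exprn_gt0 // mul1r ler_weXn2l // ler1n.
    by have := ler_pM ler01 ler01 (one u du) (one v dv); rewrite mul1r.
  rewrite /ET ExZ ExZ ler_wpM2l //.
  (* The value h = 1 gives the base 2, and [c := false] leaves the parents free. *)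
  have H := ET_gf_le (R := R) (B := [set u; v]%SET) (c := false) (v := u) ler01
    (fun h : is_true false => match notF h with end).
  rewrite finset.big_setU1 ?finset.big_set1 ?finset.inE //= in H.
  have {}H : Ex (parent_pmf R (n:=n)) (fun f => 2 ^+ nchildren f u * 2 ^+ nchildren f v) <=
      expR (harmonic R u.+1 N) * expR (harmonic R v.+1 N).
    apply: le_trans (le_trans _ H) _; last by rewrite !mul1r.
    rewrite le_eqVlt; apply/orP; left; apply/eqP; apply: eq_Ex => f _.
    by rewrite finset.big_setU1 ?finset.big_set1 ?finset.inE //= !mul1r.
  rewrite /a mulrACA ler_wpM2l ?mulr_ge0 ?invr_ge0 ?exprn_ge0 //.
  by apply: le_trans H _; rewrite ler_pM ?expR_ge0 ?expR_harmonic_le.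
rewrite -mulr_sumr ler_wpM2l // -(pair_bigA _ (fun u v => a u * a v)) /=.
under eq_bigr do rewrite -mulr_sumr.
rewrite -mulr_suml -expr2; apply: lerXn2r; rewrite ?nnegrE.
- exact: sumr_ge0.
- by rewrite !mulr_ge0 ?expR_ge0 ?invr_ge0 ?exprn_ge0 ?addr_ge0 ?lnN_ge0.
- rewrite /a -mulr_sumr -mulr_sumr mulrC ler_wpM2r ?invr_ge0 ?exprn_ge0 //.
  rewrite ler_wpM2l ?mulr_ge0 ?expR_ge0 //.
  apply: le_trans (sum_inv_succ R (leqnn N)); rewrite le_eqVlt; apply/orP; left; apply/eqP.
  by apply: eq_bigl => u; rewrite ltn_ord.
Qed.

Section Shares.
Variables (d j m k : nat) (q0 eta : R).
Hypotheses (mN : (1 < m <= N)%N) (q00 : 0 <= q0) (eta0 : 0 < eta).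
Local Notation S f v := (below_desc m f v).
Local Notation share := (share d j m q0).

Lemma card_below_desc f v : #|S f v| = fringe v.+1 f v m. Proof. by []. Qed.

Lemma below_desc_lt f v i : i \in S f v -> (i < m)%N.
Proof. by rewrite finset.inE => /andP[]. Qed.

Lemma below_desc_local v f g : recursive f -> recursive g ->
  (forall t : V, (t < m)%N -> f t = g t) -> S f v = S g v.
Proof.
move=> rf rg fg; apply/finset.setP => i; rewrite !finset.inE; case: ltnP => //= im.
rewrite /desc (eq_anc rf rg) // => u /andP[_ ui]; apply: fg.
exact: leq_ltn_trans ui im.
Qed.

Let mR : 1 < m%:R :> R. Proof. by rewrite ltr1n; case/andP: mN. Qed.

(** Up to [q0], the second moment of the share of v is of the order of the urn's 2 / ((v + 1) (v +
    2)), whose sum over v >= k telescopes. This is why a bounded number of candidates suffices. *)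
Lemma PJ_large_share : (0 < k)%N ->
  PJ (fun om => [exists v : V, (k <= v < m)%N && (eta <= \sum_(i in S om.1 v) share om i)]) <=
  (6 / k.+1%:R + q0 * (2 + L)) / eta ^+ 2.
Proof.
move=> k0; have jw0 om : 0 <= joint_pmf p om by exact: joint_pmf_ge0.
apply: le_trans (Pr_union jw0 (fun v : V => k <= v < m)%N _) _.
have E v : (v < m)%N -> PJ (fun om => eta <= \sum_(i in S om.1 v) share om i) <=
   ((m%:R + 1) / (m%:R - 1) * 2 * ((v.+1%:R)^-1 - (v.+2%:R)^-1) + q0 / v.+1%:R) / eta ^+ 2.
  move=> vm.
  apply: le_trans (Ex_markov (X := fun om => (\sum_(i in S om.1 v) share om i) ^+ 2)
     (c := eta ^+ 2) jw0 _ _ _) _.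
  - by rewrite exprn_gt0.
  - by move=> om _; rewrite exprn_ge0 // sumr_ge0 // => i _; apply: share_ge0.
  - move=> om _ es; rewrite lerXn2r ?nnegrE ?(ltW eta0) //.
    exact: le_trans (ltW eta0) es.
  rewrite ler_wpM2r ?invr_ge0 ?exprn_ge0 ?(ltW eta0) //.
  apply: le_trans (Ex_sum_share2_le d j p01 mN (@below_desc_lt ^~ v) (@below_desc_local v)
    q00) _.
  under [X in _ + _ * X]eq_Ex do rewrite card_below_desc.
  apply: lerD; last first.
    rewrite -/(ET _) ET_fringe ?ltnSn //; last by rewrite vm; case/andP: mN.
    rewrite le_eqVlt; apply/orP; left; apply/eqP; field.
    by rewrite nat1r !pnatr_eq0 /=; case/andP: mN => m1 _; lia.
  rewrite ler_pdivrMr; last by rewrite mulr_gt0; have := mR; lra.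
  apply: (@le_trans _ _ (ET (fun f => (fringe v.+1 f v m)%:R * ((fringe v.+1 f v m)%:R +
    1)))).
    by apply: le_ET => f _; rewrite card_below_desc expr2 ler_wpM2l // lerDl.
  rewrite ET_fringe2 ?ltnSn //; last by rewrite vm; case/andP: mN.
  rewrite le_eqVlt; apply/orP; left; apply/eqP; field.
  by rewrite nat1r -natrD !pnatr_eq0 /= subr_eq0 gt_eqF.
apply: (@le_trans _ _ (\sum_(v : V | (k <= v < m)%N)
   ((m%:R + 1) / (m%:R - 1) * 2 * ((v.+1%:R)^-1 - (v.+2%:R)^-1) + q0 / v.+1%:R) / eta ^+ 2)).
  by apply: ler_sum => v /andP[_]; apply: E.
rewrite -mulr_suml ler_wpM2r ?invr_ge0 ?exprn_ge0 ?(ltW eta0) // big_split /=.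
apply: lerD.
  rewrite -mulr_sumr.
  have tele : \sum_(v : V | (k <= v < m)%N) ((v.+1%:R)^-1 - (v.+2%:R)^-1) <= (k.+1%:R)^-1
    :> R.
    have [km|mk] := leqP k m; last first.
      by rewrite big1 ?invr_ge0 // => v; lia.
    rewrite (sum_ord_range (fun v : nat => (v.+1%:R)^-1 - (v.+2%:R)^-1));
      last by case/andP: mN.
    rewrite (eq_bigr (fun v : nat => - ((v.+2%:R)^-1 - (v.+1%:R)^-1))); last first.
      by move=> v _; rewrite opprB.
    rewrite sumrN (telescope_sumr (fun v : nat => (v.+1%:R)^-1)) // opprB gerBl.
    by rewrite invr_ge0.
  apply: (@le_trans _ _ ((m%:R + 1) / (m%:R - 1) * 2 * (k.+1%:R)^-1)).
    by apply: ler_wpM2l tele; rewrite !mulr_ge0 ?invr_ge0 //; have := mR; lra.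
  (* The factor 3 bounds (m + 1) / (m - 1) for m >= 2. *)
  rewrite ler_wpM2r ?invr_ge0 // (_ : 6 = 3 * 2); last by ring.
  rewrite ler_wpM2r // ler_pdivrMr; last by have := mR; lra.
  have : 2 <= m%:R :> R by rewrite ler_nat; case/andP: mN.
  by lra.
rewrite -mulr_sumr ler_wpM2l //.
have mN' : (m <= N)%N by case/andP: mN.
apply: le_trans (sum_inv_succ R mN'); rewrite [leLHS]big_mkcond [leRHS]big_mkcond.
by apply: ler_sum => v _; case: leqP => //= _; case: ltnP; rewrite ?invr_ge0.
Qed.

Lemma PJ_share_dev v :
  PJ (fun om => eta < `|\sum_(i in S om.1 v) share om i -
      (spread d j m q0 om)%:R * (#|S om.1 v|%:R / m%:R)|) <=
  ((m%:R - 1)^-1 + q0) / eta ^+ 2.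
Proof.
have jw0 om : 0 <= joint_pmf p om by exact: joint_pmf_ge0.
apply: le_trans (Ex_markov (X := fun om => (\sum_(i in S om.1 v) share om i -
      (spread d j m q0 om)%:R * (#|S om.1 v|%:R / m%:R)) ^+ 2)
     (c := eta ^+ 2) jw0 _ _ _) _.
- by rewrite exprn_gt0.
- by move=> om _; rewrite sqr_ge0.
- by move=> om _ /ltW es; rewrite -[leRHS]real_normK ?num_real // lerXn2r ?nnegrE ?(ltW eta0).
rewrite ler_wpM2r ?invr_ge0 ?exprn_ge0 ?(ltW eta0) //.
exact: (Ex_share_dev d j p01 mN (@below_desc_lt ^~ v) (@below_desc_local v) q00).
Qed.

End Shares.

End JointEvents.

(** * Union bound over the bad events *)

Section Coverage.
Variables (R : realType) (n : nat) (p : R).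
Variables (d j r m t m' t' m'' k K : nat) (eta q0 z h h' h'' : R).
Local Notation V := 'I_n.+1.
Local Notation N := n.+1.
Local Notation L := (ln (n.+1%:R : R)).
Local Notation Om := ({ffun V -> V} * sgraph N)%type.
Hypotheses (m1 : (1 < m)%N) (mt : (m <= t <= N)%N) (mt' : (m' <= t' <= N)%N).
Hypotheses (mm' : (m <= m')%N) (m'm'' : (m' <= m'' <= N)%N) (Km : (K < m)%N) (k0 : (0 < k)%N).

Let mN : (1 < m <= N)%N. Proof. by rewrite m1; case/andP: mt; apply: leq_trans. Qed.
Let mp : (0 < m)%N. Proof. exact: ltnW. Qed.
Let mp' : (0 < m')%N. Proof. exact: leq_trans mp mm'. Qed.
Let mN' : (m' <= N)%N. Proof. by case/andP: mt'; apply: leq_trans. Qed.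
Let mm'' : (m <= m'')%N. Proof. by case/andP: m'm'' => + _; apply: leq_trans. Qed.
Let mN'' : (m'' <= N)%N. Proof. by case/andP: m'm''. Qed.
Let tN : (t <= N)%N. Proof. by case/andP: mt. Qed.
Let tN' : (t' <= N)%N. Proof. by case/andP: mt'. Qed.
Let mt1 : (0 < m <= t)%N. Proof. by rewrite mp; case/andP: mt. Qed.
Let mt1' : (0 < m' <= t')%N. Proof. by rewrite mp'; case/andP: mt'. Qed.

Hypothesis p01 : 0 <= p <= 1.
Hypotheses (eta0 : 0 < eta) (q00 : 0 < q0) (q01 : q0 < 1) (q0eta : q0 < eta ^+ 2).
Hypotheses (z1 : 1 <= z) (h01 : 0 <= h < 1) (h01' : 0 <= h' < 1) (h0'' : 0 <= h'').
Hypothesis Keta : forall i : nat, (K < i)%N -> 2 * eta * m%:R <= i%:R.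
Let d2 := (d - r - 1)%N.
Hypothesis rate : 0 < high_child_rate n d2 m'' h'' <= 1.
Let w0 : R := m'%:R / 2.

Definition failure_bound : R :=
  N%:R * (expR (N%:R * p * (z - 1)) * z ^- r) +
  (p * (expR 1 * N%:R * (2 + L) * 2 ^- d2) ^+ 2 +
  (m%:R * fragile_bound n d j.+1 m t h +
  (2 * (2 + L) * fragile_bound n d j.+1 m' t' h' +
  (N%:R * (expR 1 * high_child_rate n d2 m'' h'' ^+ j) +
  (2 * (m''%:R * (m''%:R + 1)) / (m%:R + 1) / (q0 * w0 ^+ 2) +
  ((6 / k.+1%:R + q0 * (2 + L)) / eta ^+ 2 +
  (K.+1%:R / (m%:R - 1) + (K.+1%:R / (m%:R - 1) +
  ((m%:R - 1)^-1 + q0) / eta ^+ 2)))))))).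

Let v1 : V := inord 1.
Let v1E : v1 = 1%N :> nat. Proof. by rewrite inordK //; case/andP: mN; apply: leq_trans. Qed.

Definition bad_noise_degree (om : Om) := [exists v, (r < deg om.2 v)%N].
Definition bad_noise_edge (om : Om) := [exists uv : V * V, [&& uv.1 != uv.2,
  (d2 <= nchildren om.1 uv.1)%N, (d2 <= nchildren om.1 uv.2)%N & adj om.2 uv.1 uv.2]].
Definition bad_early (om : Om) := [exists a : V, (a < m)%N && ~~ robust d j.+1 m t om.1 a].
Definition bad_middle (om : Om) := (m' < 2 * #|finset (fun u : V => (u < m')%N &&
  [exists a, desc om.1 a u && ~~ robust d j.+1 m' t' om.1 a])|)%N.
Definition bad_late (om : Om) := [exists v : V, (m'' <= v)%N &&
  (j <= #|finset (fun b : V => (b \in children om.1 v) && (d2 <= nchildren om.1 b)%N)|)%N].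
Definition bad_fringes (om : Om) := q0 * w0 ^+ 2 < \sum_i (fringe m om.1 i m'')%:R ^+ 2.
Definition bad_shares (om : Om) := [exists v : V, (k <= v < m)%N &&
  (eta <= \sum_(i in below_desc m om.1 v) share d j.+1 m q0 om i)].
Definition bad_balance (i : V) (om : Om) := (fringe 2 om.1 i m <= K)%N.
Definition bad_deviation (om : Om) :=
  eta < `|\sum_(i in below_desc m om.1 v1) share d j.+1 m q0 om i -
     (spread d j.+1 m q0 om)%:R * (#|below_desc m om.1 v1|%:R / m%:R)|.

Let nh (om : Om) u : nearly_high om.1 d r u -> (d2 <= nchildren om.1 u)%N.
Proof. by rewrite /nearly_high /d2; clear; lia. Qed.

Let noise_free_of om : ~~ bad_noise_edge om -> forall u v : V,
  u != v -> nearly_high om.1 d r u -> nearly_high om.1 d r v -> ~~ adj om.2 u v.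
Proof.
move=> /existsPn H u v uv /nh hu /nh hv; have := H (u, v).
by rewrite /= uv hu hv.
Qed.

Let good_event om : recursive om.1 ->
  [|| ord0 \in central_set d j.+1 k (1 - eta) w0 (noisy om.1 om.2),
   bad_noise_degree om, bad_noise_edge om, bad_early om, bad_middle om,
   bad_late om, bad_fringes om, bad_shares om, bad_balance v1 om,
   bad_balance ord0 om | bad_deviation om].
Proof.
case: om => f G /= rf; set E := ord0 \in _.
case: (boolP (bad_noise_degree _)) => [_|b1]; first by rewrite orbT.
case: (boolP (bad_noise_edge _)) => [_|b3]; first by rewrite /= orbT.
case: (boolP (bad_early _)) => [_|b4]; first by rewrite /= orbT.
case: (boolP (bad_middle _)) => [_|b5]; first by rewrite /= orbT.
case: (boolP (bad_late _)) => [_|b6]; first by rewrite /= orbT.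
case: (boolP (bad_fringes _)) => [_|b7]; first by rewrite /= orbT.
case: (boolP (bad_shares _)) => [_|b8]; first by rewrite /= orbT.
case: (boolP (bad_balance v1 _)) => [_|b9]; first by rewrite /= orbT.
case: (boolP (bad_balance ord0 _)) => [_|b9']; first by rewrite /= orbT.
case: (boolP (bad_deviation _)) => [_|b10]; first by rewrite /= orbT.
rewrite /= orbF /E {E}.
have hdeg v : (deg G v <= r)%N by move/existsPn: b1 => /(_ v) /=; rewrite -leqNgt.
have hfree := noise_free_of b3.
have hearly (v : V) : (v < m)%N -> core d j.+1 (noisy f G) v.
  move=> vm; apply: (robust_core (s := m) (s' := t)) => //.
  by move/existsPn: b4 => /(_ v); rewrite vm negbK.
have hlate (v : V) : core d j.+1 (noisy f G) v -> (v < m'')%N.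
  move=> Cv; rewrite ltnNge; apply/negP => mv.
  move/existsPn: b6 => /(_ v); rewrite mv /= -ltnNge.
  have := core_le rf hdeg hfree Cv; rewrite addn1 ltnS => jle; rewrite ltnNge => /negP; apply.
  apply: leq_trans jle _; apply: subset_leq_card; apply/fintype.subsetP => u.
  by rewrite !finset.inE /= => /andP[-> /(@nh (f, G))].
have hlarge : w0 <= #|closed_up f (core d j.+1 (noisy f G))|%:R.
  rewrite /w0 ler_pdivrMr // -natrM ler_nat.
  move: b5; rewrite /bad_middle -leqNgt; set B := finset _ => Bm.
  have : (m' <= #|closed_up f (core d j.+1 (noisy f G))| + #|B|)%N.
    rewrite -[X in (X <= _)%N](@card_ord_lt n m'); last exact: mN'.
    apply: leq_trans (leq_card_setU _ _); apply: subset_leq_card; apply/fintype.subsetP => u.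
    rewrite finset.inE => um; rewrite finset.in_setU.
    case: (boolP (u \in B)) => [_|uB]; first by rewrite orbT.
    rewrite orbF; apply/closed_upP => x xu.
    have xm : (x < m')%N by apply: leq_ltn_trans um; exact: desc_le rf xu.
    apply: (robust_core (s := m') (s' := t')) => //.
    apply: contraNT uB => rx; rewrite finset.inE um; apply/existsP; exists x.
    by rewrite xu.
  by move: Bm; clear; lia.
have hfr : \sum_i (fringe m f i m'')%:R ^+ 2 <= q0 * w0 ^+ 2.
  by rewrite leNgt; apply: b7.
have hsmall (v : V) : (k <= v < m)%N ->
    \sum_(i in below_desc m f v) share d j.+1 m q0 (f, G) i < eta.
  by move=> kv; rewrite ltNge; move/existsPn: b8 => /(_ v); rewrite kv.
have w00 : 0 < w0 by rewrite divr_gt0 // ltr0n.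
apply: (root_in_central_set (r := r) (m := m) (m' := m'') (q0 := q0) (v1 := v1)) => //.
have sp : spread d j.+1 m q0 (f, G).
  exact: (@spread_holds _ _ d j.+1 m m'' q0 w0 f G w00 hearly hlate hlarge hfr).
move: b10; rewrite /bad_deviation -leNgt sp mul1r /=; set s := \sum_(i in _) _.
have cE : #|below_desc m f v1| = fringe 2 f v1 m by rewrite card_below_desc v1E.
rewrite cE ler_norml.
have mR : 0 < m%:R :> R by rewrite ltr0n.
(* Vertices 0 and 1 start the two colours of an urn on the first [m] vertices. Both colours exceed
   [K], so the proportion of 1 is between 2 eta and 1 - 2 eta; passing to shares takes away one
   eta. *)
have lo : 2 * eta <= (fringe 2 f v1 m)%:R / m%:R.
  by rewrite ler_pdivlMr //; apply: Keta; rewrite ltnNge.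
have hi : (fringe 2 f v1 m)%:R / m%:R <= 1 - 2 * eta.
  rewrite ler_pdivrMr // mulrBl mul1r lerBrDr.
  have [_ mN2] := andP mN.
  have v10 : ord0 != v1 by rewrite -val_eqE /= -/(nat_of_ord v1) v1E.
  have : (fringe 2 f v1 m + fringe 2 f ord0 m <= m)%N.
    rewrite -[leqRHS](sum_fringe (s := 2) rf isT mN2).
    by rewrite (bigD1 v1) //= (bigD1 ord0) //= addnA leq_addr.
  rewrite -(ler_nat R) natrD => /(le_trans _); apply; rewrite lerD2l.
  by apply: Keta; rewrite ltnNge.
move=> /andP[dl du]; apply/andP; split; lra.
Qed.

Lemma failure_bound_ge :
  1 - failure_bound <= root_coverage_prob p (@central_set R N d j.+1 k (1 - eta) w0).
Proof.
rewrite coverage_equivariant; last by move=> s F v; apply: central_set_relabel.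
have jw0 (om : Om) : 0 <= joint_pmf p om by exact: joint_pmf_ge0.
rewrite -(Ex_joint p (fun om => (ord0 \in central_set d j.+1 k (1 - eta) w0
  (noisy om.1 om.2))%:R)).
rewrite lerBlDr -{1}(Ex_cst (joint_pmf_sum1 n p) 1).
apply: (@le_trans _ _ (Pr (@joint_pmf R n p) (fun om =>
  [|| ord0 \in central_set d j.+1 k (1 - eta) w0 (noisy om.1 om.2),
   bad_noise_degree om, bad_noise_edge om, bad_early om, bad_middle om,
   bad_late om, bad_fringes om, bad_shares om, bad_balance v1 om,
   bad_balance ord0 om | bad_deviation om]))).
  by apply: le_Ex => // om /joint_pmf_recursive/good_event ->.
apply: le_trans (Pr_or jw0 _ _) _; rewrite lerD2l /failure_bound.
apply: (le_trans (Pr_or jw0 _ _)); apply: lerD.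
  rewrite (Pr_joint_noise p (fun G : sgraph N => [exists v, (r < deg G v)%N])).
  exact: Pr_noise_deg.
apply: (le_trans (Pr_or jw0 _ _)); apply: lerD; first exact: PJ_noise_between_high.
apply: (le_trans (Pr_or jw0 _ _)); apply: lerD.
  rewrite (Pr_joint_tree p (fun f : {ffun V -> V} => [exists a : V, (a < m)%N && ~~ robust
    d j.+1 m t f a])).
  exact: PT_early_fragile.
apply: (le_trans (Pr_or jw0 _ _)); apply: lerD.
  rewrite (Pr_joint_tree p (fun f : {ffun V -> V} => (m' < 2 * #|finset (fun u : V => (u <
    m')%N &&
    [exists a, desc f a u && ~~ robust d j.+1 m' t' f a])|)%N)).
  exact: PT_few_robust.
apply: (le_trans (Pr_or jw0 _ _)); apply: lerD.
  rewrite (Pr_joint_tree p (fun f : {ffun V -> V} => [exists v : V, (m'' <= v)%N &&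
    (j <= #|finset (fun b : V => (b \in children f v) && (d2 <= nchildren f b)%N)|)%N])).
  by apply: PT_late_core => //; apply: leq_trans mm''.
apply: (le_trans (Pr_or jw0 _ _)); apply: lerD.
  rewrite (Pr_joint_tree p (fun f : {ffun V -> V} => q0 * w0 ^+ 2 < \sum_i (fringe m f i
    m'')%:R ^+ 2)).
  apply: PT_fringes => //; rewrite ?mp ?mm'' //.
  by rewrite mulr_gt0 // exprn_gt0 // divr_gt0 // ltr0n.
apply: (le_trans (Pr_or jw0 _ _)); apply: lerD.
  by apply: PJ_large_share => //; apply: ltW.
apply: (le_trans (Pr_or jw0 _ _)); apply: lerD.
  rewrite (Pr_joint_tree p (fun f : {ffun V -> V} => (fringe 2 f v1 m <= K)%N)).
  by apply: PT_balanced => //; rewrite v1E.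
apply: (le_trans (Pr_or jw0 _ _)); apply: lerD.
  rewrite (Pr_joint_tree p (fun f : {ffun V -> V} => (fringe 2 f ord0 m <= K)%N)).
  exact: PT_balanced.
by apply: PJ_share_dev => //; apply: ltW.
Qed.

End Coverage.

(** * Choice of the parameters *)

Section Decay.
Variable R : realType.
Implicit Types (a b c e x y C L : R).

Lemma near_decay C c e : 0 < c -> 0 < e ->
  \forall L \near +oo, C * expR (- (c * L)) <= e.
Proof.
move=> c0 e0; near=> L.
have L0 : 0 < L by near: L; apply: nbhs_pinfty_gt; rewrite num_real.
have LC : C / (c * e) <= L by near: L; apply: nbhs_pinfty_ge; rewrite num_real.
rewrite expRN ler_pdivrMr ?expR_gt0 //.
rewrite ler_pdivrMr ?mulr_gt0 // in LC.
apply: (@le_trans _ _ (e * (1 + c * L))); last by rewrite ler_wpM2l ?expR_ge1Dx // ltW.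
have -> : e * (1 + c * L) = e + L * (c * e) by ring.
by apply: le_trans LC _; rewrite lerDr ltW.
Unshelve. all: by end_near. Qed.

Lemma poly_le_exp c L : 0 < c -> 0 <= L -> 2 + L <= (2 + c^-1) * expR (c * L).
Proof.
move=> c0 L0; apply: (@le_trans _ _ ((2 + c^-1) * (1 + c * L))); last first.
  by rewrite ler_wpM2l ?expR_ge1Dx // addr_ge0 // invr_ge0 ltW.
have -> : (2 + c^-1) * (1 + c * L) = 2 + L + (c^-1 + 2 * c * L) by field; rewrite gt_eqF.
by rewrite lerDl addr_ge0 ?invr_ge0 ?mulr_ge0 // ltW.
Qed.

Lemma near_poly_decay C c e : 0 <= C -> 0 < c -> 0 < e ->
  \forall L \near +oo, C * (2 + L) ^+ 3 * expR (- (c * L)) <= e.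
Proof.
(* Each of the three factors 2 + L is absorbed by exp(c L / 6), which leaves half of the rate. *)
move=> C0 c0 e0; pose A := 2 + (c / 6)^-1.
have c6 : 0 < c / 6 by rewrite divr_gt0.
have A0 : 0 <= A by rewrite addr_ge0 // invr_ge0 ltW.
near=> L.
have L0 : 0 <= L by near: L; apply: nbhs_pinfty_ge; rewrite num_real.
apply: (@le_trans _ _ (C * A ^+ 3 * expR (- (c / 2 * L)))); last first.
  by near: L; apply: near_decay => //; rewrite divr_gt0.
have -> : C * A ^+ 3 * expR (- (c / 2 * L)) = C * (A * expR (c / 6 * L)) ^+ 3 * expR (- (c
  * L)).
  have -> : C * (A * expR (c / 6 * L)) ^+ 3 * expR (- (c * L)) =
    C * A ^+ 3 * (expR (c / 6 * L) ^+ 3 * expR (- (c * L))) by ring.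
  by rewrite -expRM_natl -expRD; congr (_ * expR _); field.
rewrite ler_wpM2r ?expR_ge0 // ler_wpM2l //; apply: lerXn2r; last exact: poly_le_exp.
  by rewrite nnegrE addr_ge0.
by rewrite nnegrE mulr_ge0 ?expR_ge0.
Unshelve. all: by end_near. Qed.

Lemma ln2_le1 : ln (2 : R) <= 1.
Proof. by rewrite (_ : 2 = 1 + 1) //; apply: le_trans (le_ln1Dx _) _; rewrite // ltrN10. Qed.

(** For L = ln n this is the integer part of n^a; all birth times used below are of this form. *)
Definition scale a L : nat := Num.truncn (expR (a * L)).

Lemma scale_le a L : (scale a L)%:R <= expR (a * L).
Proof. by have /andP[] := truncn_itv (expR_ge0 (a * L)). Qed.

Lemma scale_gt0 a L : 0 <= a * L -> (0 < scale a L)%N.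
Proof. by move=> aL; rewrite /scale truncn_gt0 -expR0 ler_expR. Qed.

Lemma scale_ge a L : 0 <= a * L -> expR (a * L) / 2 <= (scale a L)%:R.
Proof.
move=> aL; have /andP[_] := truncn_itv (expR_ge0 (a * L)); rewrite -/(scale a L) -natr1.
have : 1 <= (scale a L)%:R :> R by rewrite ler1n scale_gt0.
by lra.
Qed.

Lemma scale_mono a b L : 0 <= L -> a <= b -> (scale a L <= scale b L)%N.
Proof. by move=> L0 ab; apply: le_truncn; rewrite ler_expR ler_wpM2r. Qed.

Lemma ln_scale_le a L : 0 <= a * L -> ln (scale a L)%:R <= a * L.
Proof.
move=> aL; rewrite -[leRHS]expRK ler_ln ?posrE ?expR_gt0 ?ltr0n ?scale_gt0 //.
exact: scale_le.
Qed.

Lemma ln_scale_ge a L : 0 <= a * L -> a * L - 1 <= ln (scale a L)%:R.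
Proof.
move=> aL; apply: (@le_trans _ _ (ln (expR (a * L) / 2))).
  rewrite lnM ?posrE ?expR_gt0 ?invr_gt0 // expRK lnV ?posrE //.
  by have := ln2_le1; lra.
by rewrite ler_ln ?posrE ?ltr0n ?scale_gt0 ?divr_gt0 ?expR_gt0 ?scale_ge.
Qed.

Lemma expV_le x (k : nat) y : 0 <= x < 1 -> 0 <= y -> k%:R <= y ->
  (1 - x) ^- k <= expR (x / (1 - x) * y).
Proof.
move=> /andP[x0 x1] y0 ky; have x2 : 0 < 1 - x by rewrite subr_gt0.
rewrite -exprVn; apply: (@le_trans _ _ (expR (x / (1 - x)) ^+ k)).
  rewrite lerXn2r ?nnegrE ?expR_ge0 ?invr_ge0 ?(ltW x2) //.
  apply: le_trans (expR_ge1Dx _); rewrite le_eqVlt; apply/orP; left; apply/eqP.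
  by field; rewrite gt_eqF.
by rewrite -expRM_natl ler_expR mulrC ler_wpM2l // divr_ge0 // ltW.
Qed.

End Decay.

(** * Exponents of the error terms *)

Section TermBounds.
Variables (R : realType) (n : nat).
Local Notation N := n.+1.
Local Notation L := (ln (n.+1%:R : R)).

Let L0 : 0 <= L. Proof. exact: lnN_ge0. Qed.
Let expL : expR L = N%:R :> R. Proof. by rewrite lnK // posrE. Qed.

Lemma scale_leN (a : R) : a <= 1 -> (scale a L <= N)%N.
Proof.
move=> a1; rewrite -(ler_nat R); apply: le_trans (scale_le _ _) _.
by rewrite -[leRHS]expL ler_expR ler_piMl.
Qed.

Lemma fragile_le d j (a b g del : R) : 0 < g <= 1 -> 0 <= a <= b -> 0 <= del <= 1 -> b =
  del - g ->
  d%:R <= (1 - del) * L ->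
  fragile_bound n d j (scale a L) (scale b L) (g / 4) <=
  (2 + L) * expR (- (g ^+ 2 / 8 * L)) + 2 ^+ j * (expR 1 * expR (- ((b - a) / 2 * L))).
Proof.
move=> /andP[g0 g1] /andP[a0 ab] /andP[del0 del1] bE dL.
have aL : 0 <= a * L by rewrite mulr_ge0.
have bL : 0 <= b * L by rewrite mulr_ge0 // (le_trans a0).
rewrite /fragile_bound; apply: lerD.
  rewrite ler_wpM2l ?addr_ge0 //.
  (* A vertex born at n^b has about (1 - del + g) L children, g L more than required. The choice h =
     g / 4 minimises 2 h^2 - g h and gives the rate g^2 / 8. *)
  set h := g / 4; have h0 : 0 <= h by rewrite /h; lra.
  have h1 : h < 1 by rewrite /h; lra.
  apply: (@le_trans _ _ (expR ((h + 2 * h ^+ 2) * ((1 - del) * L)) * expR (- (h * (L - b *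
    L))))).
    apply: ler_pM; rewrite ?expR_ge0 ?invr_ge0 ?exprn_ge0 //; first by lra.
      apply: le_trans (expV_le _ _ dL) _; rewrite ?h0 ?h1 // ?mulr_ge0 // ?subr_ge0 //.
      rewrite ler_expR ler_wpM2r ?mulr_ge0 ?subr_ge0 //.
      rewrite ler_pdivrMr ?subr_gt0 //.
      have : 0 <= h ^+ 2 * (1 - 2 * h) by rewrite mulr_ge0 ?exprn_ge0 // /h; lra.
      by rewrite !expr2; lra.
    rewrite ler_expR lerN2 ler_wpM2l // lerD2l lerN2; exact: ln_scale_le.
  rewrite -expRD ler_expR bE.
  have -> : (h + 2 * h ^+ 2) * ((1 - del) * L) - h * (L - (del - g) * L) =
     - (g ^+ 2 / 8 * L) - 2 * h ^+ 2 * del * L by rewrite /h; field.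
  rewrite gerDl oppr_le0; apply: mulr_ge0 => //; apply: mulr_ge0 => //;
    apply: mulr_ge0 => //; exact: exprn_ge0.
rewrite ler_wpM2l ?exprn_ge0 // -expRD ler_expR.
have := ln_scale_ge bL; have := ln_scale_le aL; lra.
Qed.

(** The opposite tail: after n^(del + 2 kap) typical degrees are kap L below the threshold. As ln (1
    + h) >= h - h^2, the exponent is at most h^2 - kap h, which is minimal at h = kap / 2. *)
Lemma rate_le d2 (del kap : R) : 0 < kap <= 1 -> 0 <= del -> del + 2 * kap <= 1 ->
  (1 - del - kap) * L - 2 <= d2%:R ->
  0 < high_child_rate n d2 (scale (del + 2 * kap) L) (kap / 2) <=
    (1 + L) * (expR (2 * kap) * expR (- (kap ^+ 2 / 4 * L))).
Proof.
move=> /andP[k0 k1] del0 del1 dL; set h := kap / 2; have h0 : 0 < h by rewrite /h; lra.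
have h1 : h <= 1 by rewrite /h; lra.
have h2 : 0 < 1 + h by lra.
apply/andP; split.
  by rewrite mulr_gt0 ?mulr_gt0 ?expR_gt0 ?invr_gt0 ?exprn_gt0 // ltr_wpDr.
rewrite /high_child_rate ler_wpM2l ?addr_ge0 //.
have bL : 0 <= (del + 2 * kap) * L by rewrite mulr_ge0 // addr_ge0 // mulr_ge0 // ltW.
apply: (@le_trans _ _ (expR (h * (2 + L - (del + 2 * kap) * L)) *
   expR (- ((h - h ^+ 2) * ((1 - del - kap) * L - 2))))).
  apply: ler_pM; rewrite ?expR_ge0 ?invr_ge0 ?exprn_ge0 ?(ltW h2) //.
    rewrite ler_expR ler_wpM2l ?(ltW h0) //.
    have := ln_scale_ge bL; lra.
  apply: (@le_trans _ _ (expR (- (h - h ^+ 2)) ^+ d2)).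
    rewrite -exprVn lerXn2r ?nnegrE ?invr_ge0 ?expR_ge0 ?(ltW h2) //.
    apply: le_trans (expR_ge1Dx _); rewrite -[leLHS]mul1r ler_pdivrMr //.
    have -> : (1 - (h - h ^+ 2)) * (1 + h) = 1 + h ^+ 3 by ring.
    by rewrite lerDl exprn_ge0 // ltW.
  rewrite -expRM_natl ler_expR mulrN lerN2 mulrC ler_wpM2r //.
  by rewrite subr_ge0 expr2 ler_piMl // ltW.
rewrite -!expRD ler_expR.
have -> : h * (2 + L - (del + 2 * kap) * L) - (h - h ^+ 2) * ((1 - del - kap) * L - 2) =
  2 * kap - (kap ^+ 2 / 4 * L) - h ^+ 2 * ((del + kap) * L) - 2 * h ^+ 2 by rewrite /h; field.
have : 0 <= h ^+ 2 * ((del + kap) * L).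
  by rewrite mulr_ge0 ?exprn_ge0 ?mulr_ge0 ?addr_ge0 // ltW.
have : 0 <= 2 * h ^+ 2 by rewrite mulr_ge0 // exprn_ge0 // ltW.
lra.
Qed.

(** The base z makes z^-r of order n^-3, against a factor n for the choice of a vertex and, as lam z
    <= L, at most another n for the exponential moment. Since z depends on kap only, lambda = o(log
    n) suffices. *)
Lemma noise_degree_le (lam z kap : R) r : 0 < kap -> z = expR (3 / kap) ->
  lam * z <= L -> 0 <= lam -> kap * L - 1 <= r%:R ->
  N%:R * (expR (lam * (z - 1)) * z ^- r) <= expR (3 / kap) * expR (- (1 * L)).
Proof.
move=> k0 zE lL lam0 rL.
have -> : z ^- r = expR (- (r%:R * (3 / kap))) by rewrite zE expRN -expRM_natl.
rewrite -{1}expL -!expRD ler_expR.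
have : (kap * L - 1) * (3 / kap) <= r%:R * (3 / kap) by rewrite ler_wpM2r // divr_ge0 // ltW.
have -> : (kap * L - 1) * (3 / kap) = 3 * L - 3 / kap by field; rewrite gt_eqF.
lra.
Qed.

(** What matters is that (1 - del - kap) ln 2 exceeds 1/2, which dictates a threshold as high as
    (9/10) L. With ln 2 >= 6/10 the product is at least 53/100, and 2 * 53/100 - 1 = 3/50. *)
Lemma noise_edge_le (lam del kap : R) d2 : 0 <= lam <= L -> del + kap <= 11 / 100 ->
  (1 - del - kap) * L - 2 <= d2%:R ->
  lam / N%:R * (expR 1 * N%:R * (2 + L) * 2 ^- d2) ^+ 2 <=
  expR 6 * (2 + L) ^+ 3 * expR (- (3 / 50 * L)).
Proof.
move=> /andP[lam0 lamL] dk dL.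
(* This is ln 2 >= 6/10, obtained from exp(1/10) <= 10/9. *)
have e01 : expR (10^-1 : R) ^+ 6 <= 2.
  apply: (@le_trans _ _ ((10 / 9) ^+ 6)).
    rewrite lerXn2r ?nnegrE ?expR_ge0 //.
    rewrite -[leLHS]invrK -expRN (_ : 10 / 9 = (9 / 10)^-1); last by field.
    rewrite lef_pV2 ?posrE ?expR_gt0 //.
    by apply: le_trans (expR_ge1Dx _); lra.
  by rewrite expr_div_n ler_pdivrMr ?exprn_gt0 //; lra.
have H2 : 2 ^- d2 <= expR 2 * expR (- (53 / 100 * L)).
  apply: (@le_trans _ _ (expR (- (6 / 10 * d2%:R)))).
    have -> : expR (- (6 / 10 * d2%:R)) = (expR (10^-1) ^+ 6) ^- d2 :> R.
      rewrite -!expRM_natl -expRN; congr (expR (- _)); by rewrite mulrC; congr (_ * _); field.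
    by rewrite lef_pV2 ?posrE ?exprn_gt0 ?expR_gt0 // lerXn2r ?nnegrE ?exprn_ge0 ?expR_ge0.
  rewrite -expRD ler_expR.
  have : (89 / 100) * L <= (1 - del - kap) * L by rewrite ler_wpM2r //; lra.
  lra.
have N0 : N%:R != 0 :> R by rewrite pnatr_eq0.
have -> : lam / N%:R * (expR 1 * N%:R * (2 + L) * 2 ^- d2) ^+ 2 =
  lam * (expR 1 ^+ 2 * (2 + L) ^+ 2 * (N%:R * (2 ^- d2) ^+ 2)).
  by move: (2 ^- d2) => q; field.
have HN : N%:R * (2 ^- d2) ^+ 2 <= expR 4 * expR (- (3 / 50 * L)).
  apply: (@le_trans _ _ (N%:R * (expR 2 * expR (- (53 / 100 * L))) ^+ 2)).
    by rewrite ler_wpM2l // lerXn2r ?nnegrE ?invr_ge0 ?exprn_ge0 ?mulr_ge0 ?expR_ge0.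
  rewrite -{1}expL -!expRD -expRM_natl -!expRD ler_expR; lra.
have L2 : 0 <= 2 + L by rewrite addr_ge0.
apply: (@le_trans _ _ ((2 + L) * (expR 1 ^+ 2 * (2 + L) ^+ 2 *
    (expR 4 * expR (- (3 / 50 * L)))))).
  apply: ler_pM => //.
  - by rewrite !mulr_ge0 ?exprn_ge0 ?expR_ge0 ?invr_ge0 ?exprn_ge0.
  - by lra.
  - by rewrite ler_wpM2l // mulr_ge0 ?exprn_ge0 ?expR_ge0.
have -> : (2 + L) * (expR 1 ^+ 2 * (2 + L) ^+ 2 * (expR 4 * expR (- (3 / 50 * L)))) =
  expR 1 ^+ 2 * expR 4 * (2 + L) ^+ 3 * expR (- (3 / 50 * L)) by ring.
by rewrite -expRM_natl -expRD (_ : 2 * 1 + 4 = 6) //; lra.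
Qed.

End TermBounds.

(** The squared fringes sum to about m''^2 / m, and m'^2 is the scale of the squared core, so the
    ratio is of order n^((8 - 20) kap). Half of this exponent goes into [q0], the other half into
    the failure probability. *)
Lemma fringes_le (R : realType) (L del kap : R) (m m' m'' : nat) :
  0 <= L -> 0 < kap -> 2 * kap <= del ->
  m = scale (20 * kap) L -> m' = scale (del - 2 * kap) L ->
  m'' = scale (del + 2 * kap) L ->
  2 * (m''%:R * (m''%:R + 1)) / (m%:R + 1) /
    (expR (- (6 * kap * L)) * (m'%:R / 2) ^+ 2) <=
  64 * expR (- (6 * kap * L)).
Proof.
move=> L0 k0 dk mE mE' mE''.
have b0 : 0 <= (del + 2 * kap) * L by rewrite mulr_ge0 //; lra.
have a0 : 0 <= (del - 2 * kap) * L by rewrite mulr_ge0 //; lra.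
have m1 : 1 <= m''%:R :> R by rewrite mE'' ler1n scale_gt0.
have hm : expR (20 * kap * L) <= m%:R + 1 by rewrite natr1 mE ltW // truncnS_gt.
have hm' : expR ((del - 2 * kap) * L) / 4 <= m'%:R / 2.
  by have := scale_ge a0; rewrite -mE'; lra.
have hm'' : m''%:R <= expR ((del + 2 * kap) * L) by rewrite mE''; apply: scale_le.
set q := expR (- (6 * kap * L)); have q0 : 0 < q by exact: expR_gt0.
have e0 : 0 < expR (20 * kap * L) by exact: expR_gt0.
have e1 : 0 < expR ((del - 2 * kap) * L) / 4 by rewrite divr_gt0 ?expR_gt0.
have p1 := lt_le_trans e0 hm; have p2 := lt_le_trans e1 hm'.
rewrite -mulrA -invfM ler_pdivrMr; last by apply: mulr_gt0 => //; apply: mulr_gt0 => //;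
  apply: exprn_gt0.
apply: (@le_trans _ _ (64 * q * (expR (20 * kap * L) * (q * (expR ((del - 2 * kap) * L) /
  4) ^+ 2)))); last first.
  rewrite ler_wpM2l ?mulr_ge0 ?(ltW q0) //; apply: ler_pM => //.
  - by rewrite mulr_ge0 ?exprn_ge0 ?(ltW q0) ?(ltW e1).
  - rewrite ler_wpM2l ?(ltW q0) //; apply: lerXn2r => //; rewrite nnegrE ltW //.
have -> : 64 * q * (expR (20 * kap * L) * (q * (expR ((del - 2 * kap) * L) / 4) ^+ 2)) =
   4 * expR ((del + 2 * kap) * L) ^+ 2.
  rewrite (_ : expR ((del + 2 * kap) * L) ^+ 2 = q * (expR (20 * kap * L) * (q * expR ((del
    - 2 * kap) * L) ^+ 2))).
    by field.
  by rewrite /q -!expRM_natl -!expRD; congr expR; ring.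
apply: (@le_trans _ _ (2 * (m''%:R * (2 * m''%:R)))).
  rewrite ler_wpM2l // ler_wpM2l //; lra.
rewrite (_ : 2 * (m''%:R * (2 * m''%:R)) = 4 * m''%:R ^+ 2); last by ring.
by rewrite ler_wpM2l // lerXn2r // nnegrE ?expR_ge0.
Qed.

(** Non-asymptotic form: [X] and [mu] depend on eps only, and lambda = o(log n) is reduced to a
    bound by mu log n. *)
Theorem finite_confidence_set (R : realType) (eps : R) : 0 < eps ->
  exists k : nat, (1 <= k)%N /\ exists X mu : R, 0 < mu /\
  forall (n : nat) (lam : R), X <= ln n.+1%:R -> 0 <= lam <= n.+1%:R ->
    lam <= mu * ln n.+1%:R ->
    exists K : sgraph n.+1 -> {set 'I_n.+1}, (forall F, (#|K F| <= k)%N) /\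
      1 - eps <= root_coverage_prob (lam / n.+1%:R) K.
Proof.
move=> eps0; pose e := Num.min eps 1.
have e0 : 0 < e by rewrite /e lt_min eps0 ltr01.
have e1 : e <= 1 by rewrite /e ge_min lexx orbT.
have e_eps : e <= eps by rewrite /e ge_min lexx.
(* Each of the two urn balance terms costs 3 eta; in units of e / 20 all the errors add up to 16. *)
pose eta := e / 20; have eta0 : 0 < eta by rewrite /eta; lra.
have eta1 : eta <= 20^-1 by rewrite /eta; lra.
have eta2 : 0 < eta ^+ 2 by rewrite exprn_gt0.
(* Large shares from [k] on cost 6 / (k + 1) / eta^2, to be kept below e / 20; the confidence set
   has size of order e^-3. *)
pose k := (Num.truncn (120 / (eta ^+ 2 * e))).+1.
(* The union bound over n^(20 kap) vertices needs 20 kap = 1/4000 to stay below (del / 2)^2 / 8 =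
   1/3200, the rate at which one of them fails. The difference is the rate 1/16000 required in
   [small]. *)
pose del : R := 10^-1; pose kap : R := (20 * 20 * 20 * 10)^-1.
have kap0 : 0 < kap by rewrite /kap invr_gt0.
have kap2 : 0 < kap ^+ 2 by rewrite exprn_gt0.
(* Each high child costs a late vertex n^(-kap^2 / 8), so [j] of them cost at most n^-2, enough for
   a union over n vertices. *)
pose j := (Num.truncn (16 / kap ^+ 2)).+1.
have hj : 2 <= j%:R * (kap ^+ 2 / 8).
  have := truncnS_gt (16 / kap ^+ 2); rewrite -/j ltr_pdivrMr // => H.
  by rewrite mulrA ler_pdivlMr //; lra.
pose z := expR (3 / kap).
have z1 : 1 <= z by rewrite /z -expR0 ler_expR divr_ge0 // ltW.
have z0 : 0 < z by lra.
(* The first term serves (m - 1)^-1 / eta^2 <= e / 20, the others (K + 1) / (m - 1) <= 3 eta. *)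
pose Mbig := 20 / (e * eta ^+ 2) + eta^-1 + 3.
have e20 : 0 < e / 20 by lra.
have e40 : 0 < e / 40 by lra.
exists k; split=> //.
pose small (L : R) := [/\ 1 <= L, expR (3 / kap) * expR (- (1 * L)) <= e / 20,
    expR 6 * (2 + L) ^+ 3 * expR (- (3 / 50 * L)) <= e / 20,
    1 * (2 + L) ^+ 3 * expR (- ((20 * 20 * 40)^-1 * L)) <= e / 40 &
    [/\ 2 ^+ j.+1 * expR 1 * expR (- (100^-1 * L)) <= e / 40,
     2 * (2 + L) ^+ 3 * expR (- (kap ^+ 2 / 8 * L)) <= e / 40,
     2 * (2 ^+ j.+1 * expR 1) * (2 + L) ^+ 3 * expR (- (kap / 2 * L)) <= e / 40,
     expR (2 * kap) * (2 + L) ^+ 3 * expR (- (kap ^+ 2 / 8 * L)) <= 1 &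
     [/\ expR 1 * expR (- (1 * L)) <= e / 20, 64 * expR (- (6 * kap * L)) <= e / 20,
      (eta ^+ 2)^-1 * (2 + L) ^+ 3 * expR (- (6 * kap * L)) <= e / 20 &
      2 * Mbig * expR (- (20 * kap * L)) <= 1]]].
have [X HX] : exists X : R, forall L : R, X <= L -> small L.
  suff [X [_ HX]] : \forall L \near +oo, small L.
    by exists (X + 1) => L XL; apply: HX; apply: lt_le_trans XL; rewrite ltrDl.
  near=> L; split; [| | | |split; [| | | |split]]; near: L.
  all: try by [apply: near_decay; rewrite ?mulr_gt0 ?divr_gt0 ?invr_gt0
    |apply: near_poly_decay; rewrite ?mulr_ge0 ?exprn_ge0 ?expR_ge0 ?invr_ge0 ?mulr_gt0
      ?divr_gt0 ?invr_gt0 ?(ltW eta2)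
    |apply: nbhs_pinfty_ge; rewrite num_real].
  by apply: near_poly_decay; rewrite ?divr_gt0 // !mulr_ge0 ?exprn_ge0 ?expR_ge0.
(* With mu = z^-1 the bound lam <= mu L becomes lam z <= L, as the exponential moment of the noise
   degrees requires. *)
exists X, z^-1; split; first by rewrite invr_gt0.
move=> n lam XL /andP[lam0 lamN] lamL; have {XL HX} := HX _ XL.
set L : R := ln n.+1%:R in lamL * => HS.
have L0 : 0 <= L by case: HS => L1 _ _ _ _; lra.
have kapE : kap = 80 ^-1 / 1000 by rewrite /kap; field.
have delE : del = 10^-1 by [].
(* Below n^del typical degrees exceed the threshold. The exponent of [t] leaves a margin del / 2
   there, large enough for the union bound up to [m]; that of [t'], squeezed between del - 2 kap and
   del, leaves only kap. *)
pose m := scale (20 * kap) L; pose t := scale (del / 2) L.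
pose m' := scale (del - 2 * kap) L; pose t' := scale (del - kap) L.
pose m'' := scale (del + 2 * kap) L.
pose d := Num.truncn ((1 - del) * L); pose r := Num.truncn (kap * L).
pose K := Num.truncn (2 * eta * m%:R); pose q0 := expR (- (6 * kap * L)).
have q00 : 0 < q0 by exact: expR_gt0.
have dle : d%:R <= (1 - del) * L by rewrite truncn_le mulr_ge0 // delE; lra.
have rle : r%:R <= kap * L by rewrite truncn_le mulr_ge0 // ltW.
have rge : kap * L - 1 <= r%:R.
  by have := truncnS_gt (kap * L); rewrite -natr1 -/r; clear; lra.
have d2ge : (1 - del - kap) * L - 2 <= (d - r - 1)%:R.
  have := truncnS_gt ((1 - del) * L); rewrite -natr1 -/d.
  have : (d <= (d - r - 1) + r + 1)%N by clear; lia.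
  rewrite -(ler_nat R) !natrD; move: rle; clear; lra.
have lamz : lam * z <= L by rewrite -ler_pdivlMr // mulrC.
have lamL' : lam <= L by apply: le_trans lamz; rewrite ler_peMr.
have N0 : 0 < n.+1%:R :> R by [].
have p01 : 0 <= lam / n.+1%:R <= 1 by rewrite divr_ge0 //= ler_pdivrMr ?mul1r.
have ieta : 0 < eta^-1 by rewrite invr_gt0.
have ieta2 : 0 <= 20 / (e * eta ^+ 2).
  by rewrite divr_ge0 // mulr_ge0 ?(ltW e0) ?(ltW eta2).
have mbig : Mbig <= m%:R.
  have mg : expR (20 * kap * L) / 2 <= m%:R.
    by apply: scale_ge; rewrite !mulr_ge0 // ltW.
  have [_ _ _ _ [_ _ _ _ [_ _ _]]] := HS.
  by rewrite expRN ler_pdivrMr ?expR_gt0 // mul1r; move: mg; clear; lra.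
have m3 : 20 / (e * eta ^+ 2) <= m%:R - 1.
  by move: mbig ieta; rewrite /Mbig; clear; lra.
have m4 : eta * m%:R >= 1 + 3 * eta.
  have : eta * (eta^-1 + 3) <= eta * m%:R.
    apply: ler_wpM2l; first exact: ltW.
    by apply: le_trans mbig; rewrite /Mbig -addrA lerDr.
  by rewrite mulrDr divff ?gt_eqF // [eta * 3]mulrC.
have m2 : 2 <= m%:R :> R by move: mbig ieta ieta2; rewrite /Mbig; clear; lra.
have m1 : (1 < m)%N by rewrite -(ltr_nat R); move: m2; clear; lra.
exists (@central_set R n.+1 d j.+1 k (1 - eta) (m'%:R / 2)); split.
  by move=> F; apply: card_central_set.
have q0e : q0 / eta ^+ 2 <= e / 20.
  have [L1 _ _ _ [_ _ _ _ [_ _ + _]]] := HS; apply: le_trans.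
  rewrite mulrC -/q0 ler_wpM2r ?(ltW q00) //.
  rewrite -[leLHS]mulr1 ler_wpM2l ?invr_ge0 ?(ltW eta2) // exprn_ege1 //.
  by move: L0; clear; lra.
have q0eta : q0 < eta ^+ 2.
  rewrite -[ltRHS]mul1r -ltr_pdivrMr //; apply: le_lt_trans q0e _.
  by move: e1; clear; lra.
have q01 : q0 < 1.
  apply: lt_le_trans q0eta _; rewrite exprn_ile1 ?(ltW eta0) //.
  by move: eta1; clear; lra.
have rate : 0 < high_child_rate n (d - r - 1) m'' (kap / 2) <= expR (- (kap ^+ 2 / 8 * L)).
  have /andP[-> h2] : 0 < high_child_rate n (d - r - 1) m'' (kap / 2) <=
      (1 + L) * (expR (2 * kap) * expR (- (kap ^+ 2 / 4 * L))).
    by apply: rate_le => //; rewrite ?kap0 ?kapE ?delE; lra.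
  apply: le_trans h2 _; have [_ _ _ _ [_ _ _ h2 _]] := HS.
  have -> : kap ^+ 2 / 4 * L = kap ^+ 2 / 8 * L + kap ^+ 2 / 8 * L by field.
  rewrite opprD expRD; set x := expR _ in h2 *.
  have x0 : 0 < x by exact: expR_gt0.
  rewrite !mulrA -[leRHS]mul1r ler_wpM2r ?(ltW x0) //; apply: le_trans h2.
  rewrite ler_wpM2r ?(ltW x0) // mulrC ler_wpM2l ?expR_ge0 //.
  apply: (@le_trans _ _ (2 + L)); first by move: L0; clear; lra.
  by rewrite ler_eXnr //; move: L0; clear; lra.
have /andP[rate0 rateq] := rate.
have x1 : expR (- (kap ^+ 2 / 8 * L)) <= 1.
  by rewrite -expR0 ler_expR oppr_le0 !mulr_ge0 // ?invr_ge0 // ltW.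
have a1 : 20 * kap <= del / 2 by rewrite kapE delE; clear; lra.
have a2 : 20 * kap <= del - 2 * kap by rewrite kapE delE; clear; lra.
have a3 : del - 2 * kap <= del - kap by rewrite kapE delE; clear; lra.
have a4 : del - 2 * kap <= del + 2 * kap by rewrite kapE delE; clear; lra.
have a5 : del / 2 <= 1 by rewrite delE; clear; lra.
have a6 : del - kap <= 1 by rewrite kapE delE; clear; lra.
have a7 : del + 2 * kap <= 1 by rewrite kapE delE; clear; lra.
have g1 : 0 <= del / 2 / 4 < 1 by rewrite delE; clear; lra.
have g2 : 0 <= kap / 4 < 1 by rewrite kapE; clear; lra.
have mt : (m <= t <= n.+1)%N by rewrite scale_mono //= scale_leN.
have mt' : (m' <= t' <= n.+1)%N by rewrite scale_mono //= scale_leN.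
have mm' : (m <= m')%N by rewrite scale_mono.
have mm'' : (m' <= m'' <= n.+1)%N by rewrite scale_mono //= scale_leN.
have Km : (K < m)%N.
  have em : 0 <= 2 * eta * m%:R by rewrite !mulr_ge0 // ltW.
  rewrite truncn_lt_nat //.
  by rewrite -[ltRHS]mul1r ltr_pM2r; move: m2 eta1; clear; lra.
have Keta i : (K < i)%N -> 2 * eta * m%:R <= i%:R.
  move=> Ki; apply: le_trans (ltW (truncnS_gt _)) _; by rewrite ler_nat.
have h0 : 0 <= kap / 2 by rewrite divr_ge0 // ltW.
have rate1 : 0 < high_child_rate n (d - r - 1) m'' (kap / 2) <= 1.
  by rewrite rate0 (le_trans rateq x1).
apply: le_trans (failure_bound_ge j m1 mt mt' mm' mm'' Km (ltn0Sn _) p01 eta0 q00 q01 q0eta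
  z1 g1 g2 h0 Keta rate1).
rewrite lerD2l lerN2; apply: le_trans e_eps; rewrite /failure_bound -/L.
have L2 : 1 <= 2 + L by move: L0; clear; lra.
have L20 : 0 <= 2 + L by move: L0; clear; lra.
have b1 : n.+1%:R * (expR (n.+1%:R * (lam / n.+1%:R) * (z - 1)) * z ^- r) <= e / 20.
  rewrite [n.+1%:R * (lam / _)]mulrC divfK ?gt_eqF //.
  by apply: le_trans (noise_degree_le kap0 _ lamz lam0 rge) _ => //; case: HS.
have b3 : lam / n.+1%:R * (expR 1 * n.+1%:R * (2 + L) * 2 ^- (d - r - 1)) ^+ 2 <= e / 20.
  have [_ _ h _ _] := HS; apply: le_trans h.
  apply: noise_edge_le d2ge; first by rewrite lam0.
  by rewrite kapE delE; clear; lra.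
have b4 : m%:R * fragile_bound n d j.+1 m t (del / 2 / 4) <= e / 20.
  have F : fragile_bound n d j.+1 m t (del / 2 / 4) <=
     (2 + L) * expR (- ((del / 2) ^+ 2 / 8 * L)) +
     2 ^+ j.+1 * (expR 1 * expR (- ((del / 2 - 20 * kap) / 2 * L))).
    apply: (@fragile_le R n d j.+1 (20 * kap) (del / 2) (del / 2) del) => //.
    - by rewrite delE; clear; lra.
    - by rewrite a1 mulr_ge0 // ltW.
    - by rewrite delE; clear; lra.
    - by rewrite delE; clear; lra.
  have [_ _ _ h1 [h2 _ _ _ _]] := HS.
  set x := expR _ in F; set y := expR (- (_ / 2 * L)) in F.
  have F0 : 0 <= (2 + L) * x + 2 ^+ j.+1 * (expR 1 * y).
    apply: addr_ge0; first by rewrite mulr_ge0 ?expR_ge0.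
    by rewrite mulr_ge0 ?exprn_ge0 // mulr_ge0 ?expR_ge0.
  apply: le_trans (ler_wpM2l (ler0n _ _) F) _.
  apply: le_trans (ler_wpM2r F0 (scale_le _ _)) _; rewrite mulrDr.
  have -> : e / 20 = e / 40 + e / 40 by field.
  apply: lerD.
    apply: le_trans h1; rewrite mulrCA mul1r -expRD; apply: ler_pM; rewrite ?expR_ge0 //.
      by rewrite ler_eXnr.
    rewrite ler_expR kapE delE; move: L0; clear; lra.
  apply: le_trans h2; rewrite mulrCA -[leRHS]mulrA ler_wpM2l ?exprn_ge0 //.
  rewrite mulrCA ler_wpM2l ?expR_ge0 // -expRD ler_expR kapE delE.
  by move: L0; clear; lra.
have b5 : 2 * (2 + L) * fragile_bound n d j.+1 m' t' (kap / 4) <= e / 20.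
  have F : fragile_bound n d j.+1 m' t' (kap / 4) <=
     (2 + L) * expR (- (kap ^+ 2 / 8 * L)) +
     2 ^+ j.+1 * (expR 1 * expR (- ((del - kap - (del - 2 * kap)) / 2 * L))).
    apply: (@fragile_le R n d j.+1 (del - 2 * kap) (del - kap) kap del) => //.
    - by rewrite kapE; clear; lra.
    - by rewrite kapE delE; clear; lra.
    - by rewrite delE; clear; lra.
  rewrite (_ : del - kap - (del - 2 * kap) = kap) in F; last by ring.
  have [_ _ _ _ [_ h1 h2 _ _]] := HS.
  set x := expR _ in F h1; set y := expR (- (_ / 2 * L)) in F h2.
  apply: le_trans (ler_wpM2l _ F) _; first by rewrite mulr_ge0.
  rewrite mulrDr; have -> : e / 20 = e / 40 + e / 40 by field.
  apply: lerD.
    apply: le_trans h1; rewrite mulrA ler_wpM2r ?expR_ge0 //.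
    by rewrite -mulrA ler_wpM2l // -expr2 ler_weXn2l.
  apply: le_trans h2.
  rewrite (_ : 2 * (2 + L) * _ = 2 * (2 ^+ j.+1 * expR 1) * (2 + L) * y); last by ring.
  have c0 : 0 <= 2 * (2 ^+ j.+1 * expR 1) :> R.
    by rewrite mulr_ge0 // mulr_ge0 ?exprn_ge0 ?expR_ge0.
  by rewrite ler_wpM2r ?expR_ge0 // ler_wpM2l // ler_eXnr.
have b6 : n.+1%:R * (expR 1 * high_child_rate n (d - r - 1) m'' (kap / 2) ^+ j) <= e / 20.
  have [_ _ _ _ [_ _ _ _ [h1 _ _ _]]] := HS; apply: le_trans h1.
  rewrite mulrCA ler_wpM2l ?expR_ge0 //.
  apply: (@le_trans _ _ (n.+1%:R * expR (- (kap ^+ 2 / 8 * L)) ^+ j)).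
    by rewrite ler_wpM2l // lerXn2r // nnegrE ?expR_ge0 // ltW.
  have -> : n.+1%:R = expR L :> R by rewrite lnK // posrE.
  rewrite -expRM_natl -expRD ler_expR.
  have := ler_wpM2r L0 hj; clear; lra.
have b7 : 2 * (m''%:R * (m''%:R + 1)) / (m%:R + 1) / (q0 * (m'%:R / 2) ^+ 2) <= e / 20.
  have [_ _ _ _ [_ _ _ _ [_ h1 _ _]]] := HS; apply: le_trans h1.
  apply: (@fringes_le R L del kap) => //.
  by rewrite kapE delE; clear; lra.
have b8 : (6 / k.+1%:R + q0 * (2 + L)) / eta ^+ 2 <= e / 10.
  have -> : e / 10 = e / 20 + e / 20 by field.
  rewrite mulrDl; apply: lerD.
    rewrite ler_pdivrMr // ler_pdivrMr //.
    have : 120 / (eta ^+ 2 * e) <= k.+1%:R.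
      apply: le_trans (ltW (truncnS_gt _)) _; by rewrite ler_nat.
    rewrite ler_pdivrMr ?mulr_gt0 //; clear; lra.
  have [_ _ _ _ [_ _ _ _ [_ _ h1 _]]] := HS; apply: le_trans h1.
  rewrite mulrC mulrCA -/q0 mulrC ler_wpM2r ?(ltW q00) // ler_wpM2l ?invr_ge0 ?(ltW eta2) //.
  by rewrite ler_eXnr.
have mm1 : 0 < m%:R - 1 :> R by move: m2; clear; lra.
have b9 : K.+1%:R / (m%:R - 1) <= 3 * eta.
  rewrite ler_pdivrMr // -natr1.
  have Kle : K%:R <= 2 * eta * m%:R.
    by rewrite truncn_le !mulr_ge0 // ltW.
  by move: Kle m4; clear; lra.
have b10 : ((m%:R - 1)^-1 + q0) / eta ^+ 2 <= e / 10.
  have -> : e / 10 = e / 20 + e / 20 by field.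
  rewrite mulrDl; apply: lerD => //.
  rewrite ler_pdivrMr // -[leLHS]mul1r ler_pdivrMr //.
  have -> : e / 20 * eta ^+ 2 * (m%:R - 1) = (m%:R - 1) * (e * eta ^+ 2) / 20 by ring.
  by rewrite ler_pdivlMr // mul1r -ler_pdivrMr ?mulr_gt0.
apply: le_trans (lerD b1 (lerD b3 (lerD b4 (lerD b5 (lerD b6 (lerD b7 (lerD b8
  (lerD b9 (lerD b9 b10))))))))) _.
by rewrite /eta; move: e0; clear; lra.
Unshelve. all: by end_near. Qed.

Local Open Scope classical_set_scope.
Local Open Scope ring_scope.

Theorem theorem1p7 (R : realType) (eps : R) (eps_gt0 : 0 < eps) :
  exists M : nat, (1 <= M)%N /\
    forall lam : nat -> R,
      (forall n : nat, (1 <= n)%N -> 0 <= lam n <= n%:R) ->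
      lam =o_\oo (fun n : nat => ln (n%:R : R)) ->
      exists K : forall n : nat, sgraph n.+1 -> {set 'I_n.+1},
        (forall (n : nat) (F : sgraph n.+1), (#|K n F| <= M)%N) /\
        ((1 - eps)%:E <=
          limn_einf (fun n : nat =>
            (root_coverage_prob (lam n.+1 / n.+1%:R) (K n))%:E))%E.
Proof.
have [M [M1 [X [mu [mu0 H]]]]] := finite_confidence_set eps_gt0.
exists M; split=> // lam lamN /eqoP lamo.
have [n0 _ hn0] := lamo _ mu0.
pose n1 := Num.truncn (expR X).
have big n : (maxn n0 n1 <= n)%N -> exists K : sgraph n.+1 -> {set 'I_n.+1},
    (forall F, (#|K F| <= M)%N) /\
    1 - eps <= root_coverage_prob (lam n.+1 / n.+1%:R) K.
  rewrite geq_max => /andP[n0n n1n]; apply: H.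
  - rewrite -[leLHS]expRK ler_ln ?posrE ?expR_gt0 //.
    by apply: le_trans (ltW (truncnS_gt _)) _; rewrite ler_nat ltnS.
  - exact: lamN.
  - have := hn0 n.+1 (leqW n0n).
    rewrite /= ger0_norm; last by have /andP[] := lamN n.+1 isT.
    by rewrite ger0_norm // ln_ge0 // ler1n.
(* Below the threshold on n the empty set serves as a default, so that choice yields a family
   indexed by all n. *)
have {}big n : exists K : sgraph n.+1 -> {set 'I_n.+1}, (forall F, (#|K F| <= M)%N) /\
    ((maxn n0 n1 <= n)%N -> 1 - eps <= root_coverage_prob (lam n.+1 / n.+1%:R) K).
  have [/big[K [K1 K2]]|_] := leqP (maxn n0 n1) n; first by exists K.
  by exists (fun=> finset.set0); split=> // F; rewrite cards0.
pose K n := projT1 (cid (big n)).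
have KP n := projT2 (cid (big n)).
exists K; split=> [n F|]; first by case: (KP n) => KM _; apply: KM.
rewrite limn_einf_lim; apply: lime_ge; first exact: is_cvg_einfs.
exists (maxn n0 n1) => // n /= nn; apply: le_ereal_inf_tmp => _ [i /= ni <-].
by rewrite lee_fin; have [_ Ki] := KP i; apply: Ki; apply: leq_trans nn ni.
Qed.
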